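(* If $M$ is a rank $2$ matroid on $[n]$ and $w\in\mathrm{TGr}_M$, then $\psi_{M,w}:\mathrm{in}_w\mathrm{Gr}_M\to\mathrm{Gr}_{M,w}$ is an isomorphism.
   Context: Let $\mathbf{k}$ be an algebraically closed field of characteristic $0$, $[n]=\{0,\dots,n-1\}$. Thin Schubert cells. A $(d,n)$-matroid is a rank $d$ matroid on $[n]$; $\mathcal{B}(M)$ is its set of bases. Let $p_\lambda$ ($\lambda\in\binom{[n]}{d}$) be the Plücker coordinates of $\mathrm{Gr}(d,n)\subset\mathbb{P}(\wedge^d\mathbf{k}^n)$ and $I^{d,n}$ the Plücker ideal. Put $B_M=\mathbf{k}[p_\lambda:\lambda\in\mathcal{B}(M)]$, $I_M=(I^{d,n}+\langle p_\lambda:\lambda\notin\mathcal{B}(M)\rangle)\cap B_M$, let $T(M)$ be the dense torus of $\mathrm{Proj}(B_M)$, and $\mathrm{Gr}_M=T(M)\cap\mathrm{Proj}(B_M/I_M)$. Face maps. With $e_\lambda=\sum_{i\in\lambda}e_i\in\mathbb{R}^n$, the matroid polytope is $Q_M=\mathrm{conv}\{e_\beta:\beta\in\mathcal{B}(M)\}$. If $Q_{M'}$ is a face of $Q_M$, the inclusion $B_{M'}\subset B_M$ maps $I_{M'}$ into $I_M$ and induces $\varphi_{M,M'}:\mathrm{Gr}_M\to\mathrm{Gr}_{M'}$. Initial degenerations. For $w\in\mathbb{R}^{\mathcal{B}(M)}$, $\mathrm{in}_wf$ is the sum of the terms of $f$ of minimal $w$-weight, $\mathrm{in}_wI_M=\langle\mathrm{in}_wf:f\in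 I_M\rangle$, $\mathrm{in}_w\mathrm{Gr}_M=T(M)\cap\mathrm{Proj}(B_M/\mathrm{in}_wI_M)$, and $\mathrm{TGr}_M$ is the set of $w$ (modulo $\mathbb{R}\mathbf{1}$) with $\mathrm{in}_w\mathrm{Gr}_M\ne\emptyset$. Limits. $\Delta_{M,w}$ is the regular subdivision of $Q_M$ induced by $w$ (cells are projections of lower faces of $\mathrm{conv}\{(e_\beta,w_\beta):\beta\in\mathcal{B}(M)\}$). For $w\in\mathrm{TGr}_M$ every cell $Q$ is a matroid polytope, with matroid $M_Q$. $\mathrm{Gr}_{M,w}=\varprojlim_{Q\in\Delta_{M,w}}\mathrm{Gr}_{M_Q}$ is the limit in affine $\mathbf{k}$-schemes over all cells, with morphisms $\varphi_{M_Q,M_{Q'}}$ for $Q'$ a face of $Q$. For each $Q\in\Delta_{M,w}$, the inclusion $B_{M_Q}\subset B_M$ maps $I_{M_Q}$ into $\mathrm{in}_wI_M$ and so induces a morphism $\psi_{M,M_Q,w}:\mathrm{in}_w\mathrm{Gr}_M\to\mathrm{Gr}_{M_Q}$; these are compatible with the $\varphi$'s and $\psi_{M,w}$ is the induced morphism to the limit. *)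

(* Defs.v *)
From HB Require Import structures.
From mathcomp Require Import all_boot all_order perm all_algebra.
From mathcomp Require Import boolp classical_sets reals.
From mathcomp Require Import mpoly.

Set Implicit Arguments.
Unset Strict Implicit.
Unset Printing Implicit Defensive.

Import Order.TTheory GRing.Theory Num.Theory.

Local Open Scope ring_scope.
Local Open Scope quotient_scope.

(* The quotient constructions and algebra structures of the library exclude
   the zero ring, which is the coordinate ring of the empty scheme; hence
   comPzRingType and the quotient below. *)
Record ring_ideal (R : comPzRingType) := RingIdeal {
  ideal_set :> R -> Prop;
  ideal_0 : ideal_set 0;
  ideal_add : forall x y, ideal_set x -> ideal_set y -> ideal_set (x + y);
  ideal_mul : forall a x, ideal_set x -> ideal_set (a * x)
}.

Section IdealQuotient.
Variables (R : comPzRingType) (I : ring_ideal R).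

Definition ideal_rel (x y : R) := `[< I (x - y) >].

Lemma ideal_opp x : I x -> I (- x).
Proof. by move=> Ix; rewrite -mulN1r; exact: ideal_mul. Qed.

Lemma ideal_rel_equiv : equiv_class_of ideal_rel.
Proof.
split=> [x|x y|y x z].
- by apply/asboolP; rewrite subrr; exact: ideal_0.
- by apply/asboolP/asboolP => /ideal_opp; rewrite opprB.
- move=> /asboolP xy /asboolP yz; apply/asboolP.
  by rewrite -(subrKA y); exact: ideal_add.
Qed.

Canonical ideal_rel_equivRel := EquivRelPack ideal_rel_equiv.

Definition ring_quot := {eq_quot ideal_rel}.
HB.instance Definition _ := Choice.on ring_quot.
HB.instance Definition _ := EqQuotient.on ring_quot.

Lemma ring_quotP (x y : R) :
  (\pi_ring_quot x = \pi_ring_quot y) <-> I (x - y).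
Proof.
split=> [/eqmodP/asboolP //|h].
by apply/eqmodP/asboolP.
Qed.

Definition rq_zero : ring_quot := \pi_ring_quot 0.
Definition rq_one : ring_quot := \pi_ring_quot 1.
Definition rq_opp (x : ring_quot) : ring_quot := \pi_ring_quot (- repr x).
Definition rq_add (x y : ring_quot) : ring_quot := \pi_ring_quot (repr x + repr y).
Definition rq_mul (x y : ring_quot) : ring_quot := \pi_ring_quot (repr x * repr y).

Lemma rq_repr x : I (repr (\pi_ring_quot x) - x).
Proof. by apply/ring_quotP; rewrite reprK. Qed.

Lemma rq_oppE x : rq_opp (\pi_ring_quot x) = \pi_ring_quot (- x).
Proof. by apply/ring_quotP; rewrite -opprD; exact/ideal_opp/rq_repr. Qed.

Lemma rq_addE x y : rq_add (\pi_ring_quot x) (\pi_ring_quot y) = \pi_ring_quot (x + y).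
Proof.
by apply/ring_quotP; rewrite opprD addrACA; apply: ideal_add; exact: rq_repr.
Qed.

Lemma rq_mulE x y : rq_mul (\pi_ring_quot x) (\pi_ring_quot y) = \pi_ring_quot (x * y).
Proof.
apply/ring_quotP; set a := repr _; set b := repr _.
rewrite -(subrKA (a * y)) -mulrBr -mulrBl (mulrC _ y).
by apply: ideal_add; apply: ideal_mul; exact: rq_repr.
Qed.

Lemma rq_ind (P : ring_quot -> Prop) :
  (forall x, P (\pi_ring_quot x)) -> forall x, P x.
Proof. by move=> h x; rewrite -[x]reprK. Qed.

Lemma rq_addA : associative rq_add.
Proof. by do 3!elim/rq_ind=> ?; rewrite !rq_addE addrA. Qed.
Lemma rq_addC : commutative rq_add.
Proof. by do 2!elim/rq_ind=> ?; rewrite !rq_addE addrC. Qed.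
Lemma rq_add0 : left_id rq_zero rq_add.
Proof. by elim/rq_ind=> ?; rewrite !rq_addE add0r. Qed.
Lemma rq_addN : left_inverse rq_zero rq_opp rq_add.
Proof. by elim/rq_ind=> ?; rewrite rq_oppE !rq_addE addNr. Qed.
HB.instance Definition _ :=
  GRing.isZmodule.Build ring_quot rq_addA rq_addC rq_add0 rq_addN.

Lemma rq_mulA : associative rq_mul.
Proof. by do 3!elim/rq_ind=> ?; rewrite !rq_mulE mulrA. Qed.
Lemma rq_mulC : commutative rq_mul.
Proof. by do 2!elim/rq_ind=> ?; rewrite !rq_mulE mulrC. Qed.
Lemma rq_mul1 : left_id rq_one rq_mul.
Proof. by elim/rq_ind=> ?; rewrite !rq_mulE mul1r. Qed.
Lemma rq_mulDl : left_distributive rq_mul rq_add.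
Proof.
by do 3!elim/rq_ind=> ?; rewrite rq_addE !rq_mulE rq_addE mulrDl.
Qed.
HB.instance Definition _ :=
  GRing.Zmodule_isComPzRing.Build ring_quot rq_mulA rq_mulC rq_mul1 rq_mulDl.

Definition quot_pi (x : R) : ring_quot := \pi_ring_quot x.

Lemma quot_pi_zmod : zmod_morphism quot_pi.
Proof. by move=> x y; rewrite /quot_pi -rq_addE -rq_oppE. Qed.
Lemma quot_pi_monoid : monoid_morphism quot_pi.
Proof. by split=> // x y; rewrite /quot_pi -rq_mulE. Qed.
HB.instance Definition _ :=
  GRing.isZmodMorphism.Build R ring_quot quot_pi quot_pi_zmod.
HB.instance Definition _ :=
  GRing.isMonoidMorphism.Build R ring_quot quot_pi quot_pi_monoid.

Lemma quot_pi_eq0 x : quot_pi x = 0 <-> I x.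
Proof. by rewrite -[X in I X]subr0; exact: ring_quotP. Qed.

Lemma quot_pi_eq x y : quot_pi x = quot_pi y <-> I (x - y).
Proof. exact: ring_quotP. Qed.

Lemma quot_pi_surj z : exists x, quot_pi x = z.
Proof. by exists (repr z); exact: reprK. Qed.

End IdealQuotient.

Section QuotientMap.
Variables (R S : comPzRingType) (I : ring_ideal R) (J : ring_ideal S).
Variables (f : {rmorphism R -> S}) (fIJ : forall x, I x -> J (f x)).

Definition quot_map of (forall x, I x -> J (f x)) :=
  fun z : ring_quot I => quot_pi J (f (repr z)).

Lemma quot_mapE x : quot_map fIJ (quot_pi I x) = quot_pi J (f x).
Proof. by apply/quot_pi_eq; rewrite -rmorphB; exact/fIJ/rq_repr. Qed.

Lemma quot_map_zmod : zmod_morphism (quot_map fIJ).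
Proof.
move=> x y; have [[{}x <-] [{}y <-]] := (quot_pi_surj x, quot_pi_surj y).
by rewrite -rmorphB !quot_mapE !rmorphB.
Qed.
Lemma quot_map_monoid : monoid_morphism (quot_map fIJ).
Proof.
split=> [|x y]; first by rewrite -(rmorph1 (quot_pi I)) quot_mapE !rmorph1.
have [[{}x <-] [{}y <-]] := (quot_pi_surj x, quot_pi_surj y).
by rewrite -rmorphM !quot_mapE !rmorphM.
Qed.
HB.instance Definition _ := GRing.isZmodMorphism.Build
  (ring_quot I) (ring_quot J) (quot_map fIJ) quot_map_zmod.
HB.instance Definition _ := GRing.isMonoidMorphism.Build
  (ring_quot I) (ring_quot J) (quot_map fIJ) quot_map_monoid.
End QuotientMap.

(* The category of affine k-schemes is the opposite of the category of
   commutative k-algebras: a scheme is given by its coordinate ring, with the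
   structure map from k. *)
Record aff_scheme (k : fieldType) := AffScheme {
  coord :> comPzRingType;
  coord_str : {rmorphism k -> coord}
}.

Record aff_hom (k : fieldType) (X Y : aff_scheme k) := AffHom {
  pullback :> {rmorphism coord Y -> coord X};
  pullback_str : forall c, pullback (coord_str Y c) = coord_str X c
}.

Section AffineSchemes.
Variable k : fieldType.
Implicit Types X Y Z : aff_scheme k.

Definition aff_eq X Y (f g : aff_hom X Y) := forall a, f a = g a.

Definition aff_id X : aff_hom X X :=
  @AffHom k X X idfun (fun=> erefl).

Lemma aff_comp_str X Y Z (g : aff_hom Y Z) (f : aff_hom X Y) c :
  (f \o g) (coord_str Z c) = coord_str X c.
Proof. by rewrite /= !pullback_str. Qed.

Definition aff_comp X Y Z (g : aff_hom Y Z) (f : aff_hom X Y) : aff_hom X Z :=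
  @AffHom k X Z (f \o g) (aff_comp_str g f).

Definition aff_iso X Y (f : aff_hom X Y) := exists g : aff_hom Y X,
  aff_eq (aff_comp g f) (aff_id X) /\ aff_eq (aff_comp f g) (aff_id Y).

(* A point of Spec A is a prime ideal of A. *)
Definition prime_ideal (A : comPzRingType) (P : ring_ideal A) :=
  ~ P 1 /\ forall x y, P (x * y) -> P x \/ P y.

Definition aff_nonempty X := exists P : ring_ideal (coord X), prime_ideal P.

Record aff_diagram := AffDiagram {
  dobj : Type;
  dscheme : dobj -> aff_scheme k;
  darrow : dobj -> dobj -> Prop;
  dmap : forall i j, darrow i j -> aff_hom (dscheme i) (dscheme j)
}.

Record cone (D : aff_diagram) (X : aff_scheme k) := Cone {
  leg : forall i : dobj D, aff_hom X (dscheme i);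
  leg_comm : forall i j (a : darrow i j),
    aff_eq (aff_comp (dmap a) (leg i)) (leg j)
}.
End AffineSchemes.

(* The limit of a diagram of affine schemes: its coordinate ring is the
   colimit of the coordinate rings, presented by generators and relations.
   The universal property is proved below. *)
Section Limit.
Variables (k : fieldType) (D : aff_diagram k).

Inductive lterm :=
| LConst of k
| LGen (i : dobj D) of coord (dscheme i)
| LAdd of lterm & lterm
| LMul of lterm & lterm.
Arguments LGen : clear implicits.

Inductive lrel : lterm -> lterm -> Prop :=
| lrel_refl s : lrel s s
| lrel_sym s t : lrel s t -> lrel t s
| lrel_trans s t u : lrel s t -> lrel t u -> lrel s u
| lrel_add s s' t t' : lrel s s' -> lrel t t' -> lrel (LAdd s t) (LAdd s' t')
| lrel_mul s s' t t' : lrel s s' -> lrel t t' -> lrel (LMul s t) (LMul s' t')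
| lrel_addA s t u : lrel (LAdd s (LAdd t u)) (LAdd (LAdd s t) u)
| lrel_addC s t : lrel (LAdd s t) (LAdd t s)
| lrel_add0 s : lrel (LAdd (LConst 0) s) s
| lrel_addN s : lrel (LAdd (LMul (LConst (-1)) s) s) (LConst 0)
| lrel_mulA s t u : lrel (LMul s (LMul t u)) (LMul (LMul s t) u)
| lrel_mulC s t : lrel (LMul s t) (LMul t s)
| lrel_mul1 s : lrel (LMul (LConst 1) s) s
| lrel_mulD s t u : lrel (LMul (LAdd s t) u) (LAdd (LMul s u) (LMul t u))
| lrel_constD a b : lrel (LConst (a + b)) (LAdd (LConst a) (LConst b))
| lrel_constM a b : lrel (LConst (a * b)) (LMul (LConst a) (LConst b))
| lrel_genC i a : lrel (LGen i (coord_str _ a)) (LConst a)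
| lrel_genD i x y : lrel (LGen i (x + y)) (LAdd (LGen i x) (LGen i y))
| lrel_genM i x y : lrel (LGen i (x * y)) (LMul (LGen i x) (LGen i y))
| lrel_map i j (a : darrow i j) x : lrel (LGen j x) (LGen i (dmap a x)).

Definition lterm_rel (s t : {classic lterm}) := `[< lrel s t >].

Lemma lterm_rel_equiv : equiv_class_of lterm_rel.
Proof.
split=> [s|s t|t s u].
- by apply/asboolP; exact: lrel_refl.
- by apply/asboolP/asboolP; exact: lrel_sym.
- by move=> /asboolP st /asboolP tu; apply/asboolP; exact: lrel_trans tu.
Qed.
Canonical lterm_rel_equivRel := EquivRelPack lterm_rel_equiv.

Definition lim_ring := {eq_quot lterm_rel}.
HB.instance Definition _ := Choice.on lim_ring.
HB.instance Definition _ := EqQuotient.on lim_ring.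

Definition lpi (s : lterm) : lim_ring := \pi_lim_ring (s : {classic lterm}).

Lemma lpiP s t : lpi s = lpi t <-> lrel s t.
Proof. by split=> [/eqmodP/asboolP|h] //; apply/eqmodP/asboolP. Qed.

Lemma lpi_ind (P : lim_ring -> Prop) : (forall s, P (lpi s)) -> forall x, P x.
Proof. by move=> h x; rewrite -[x]reprK; exact: h. Qed.

Lemma lpi_repr s : lrel (repr (lpi s)) s.
Proof. by apply/lpiP; rewrite /lpi reprK. Qed.

Definition lim_opp (x : lim_ring) := lpi (LMul (LConst (-1)) (repr x)).
Definition lim_add (x y : lim_ring) := lpi (LAdd (repr x) (repr y)).
Definition lim_mul (x y : lim_ring) := lpi (LMul (repr x) (repr y)).

Lemma lim_oppE s : lim_opp (lpi s) = lpi (LMul (LConst (-1)) s).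
Proof. by apply/lpiP/lrel_mul; [exact: lrel_refl|exact: lpi_repr]. Qed.
Lemma lim_addE s t : lim_add (lpi s) (lpi t) = lpi (LAdd s t).
Proof. by apply/lpiP/lrel_add; exact: lpi_repr. Qed.
Lemma lim_mulE s t : lim_mul (lpi s) (lpi t) = lpi (LMul s t).
Proof. by apply/lpiP/lrel_mul; exact: lpi_repr. Qed.

Lemma lim_addA : associative lim_add.
Proof.
by do 3!elim/lpi_ind=> ?; rewrite !lim_addE; apply/lpiP; exact: lrel_addA.
Qed.
Lemma lim_addC : commutative lim_add.
Proof.
by do 2!elim/lpi_ind=> ?; rewrite !lim_addE; apply/lpiP; exact: lrel_addC.
Qed.
Lemma lim_add0 : left_id (lpi (LConst 0)) lim_add.
Proof.
by elim/lpi_ind=> ?; rewrite !lim_addE; apply/lpiP; exact: lrel_add0.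
Qed.
Lemma lim_addN : left_inverse (lpi (LConst 0)) lim_opp lim_add.
Proof.
by elim/lpi_ind=> ?; rewrite lim_oppE lim_addE; apply/lpiP; exact: lrel_addN.
Qed.
HB.instance Definition _ :=
  GRing.isZmodule.Build lim_ring lim_addA lim_addC lim_add0 lim_addN.

Lemma lim_mulA : associative lim_mul.
Proof.
by do 3!elim/lpi_ind=> ?; rewrite !lim_mulE; apply/lpiP; exact: lrel_mulA.
Qed.
Lemma lim_mulC : commutative lim_mul.
Proof.
by do 2!elim/lpi_ind=> ?; rewrite !lim_mulE; apply/lpiP; exact: lrel_mulC.
Qed.
Lemma lim_mul1 : left_id (lpi (LConst 1)) lim_mul.
Proof.
by elim/lpi_ind=> ?; rewrite !lim_mulE; apply/lpiP; exact: lrel_mul1.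
Qed.
Lemma lim_mulDl : left_distributive lim_mul lim_add.
Proof.
do 3!elim/lpi_ind=> ?; rewrite lim_addE !lim_mulE lim_addE.
by apply/lpiP; exact: lrel_mulD.
Qed.
HB.instance Definition _ :=
  GRing.Zmodule_isComPzRing.Build lim_ring
    lim_mulA lim_mulC lim_mul1 lim_mulDl.

Lemma add_zmod_morphism (U V : zmodType) (f : U -> V) :
  {morph f : x y / x + y} -> zmod_morphism f.
Proof. by move=> fD x y; rewrite -[in RHS](subrK y x) (fD (x - y)) addrK. Qed.

Definition lim_const (a : k) : lim_ring := lpi (LConst a).
Lemma lim_const_zmod : zmod_morphism lim_const.
Proof.
apply: add_zmod_morphism => x y; rewrite [RHS]lim_addE.
by apply/lpiP; exact: lrel_constD.
Qed.
Lemma lim_const_monoid : monoid_morphism lim_const.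
Proof.
by split=> // x y; rewrite [RHS]lim_mulE; apply/lpiP; exact: lrel_constM.
Qed.
HB.instance Definition _ :=
  GRing.isZmodMorphism.Build k lim_ring lim_const lim_const_zmod.
HB.instance Definition _ :=
  GRing.isMonoidMorphism.Build k lim_ring lim_const lim_const_monoid.

Definition aff_lim : aff_scheme k := @AffScheme k lim_ring lim_const.

Definition lim_gen (i : dobj D) (x : coord (dscheme i)) : lim_ring :=
  lpi (LGen i x).
Lemma lim_gen_zmod (i : dobj D) : zmod_morphism (@lim_gen i).
Proof.
apply: add_zmod_morphism => x y; rewrite [RHS]lim_addE.
by apply/lpiP; exact: lrel_genD.
Qed.
Lemma lim_gen_monoid (i : dobj D) : monoid_morphism (@lim_gen i).
Proof.
split=> [|x y].
  by apply/lpiP; rewrite -(rmorph1 (coord_str _)); exact: lrel_genC.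
by rewrite [RHS]lim_mulE; apply/lpiP; exact: lrel_genM.
Qed.
HB.instance Definition _ (i : dobj D) := GRing.isZmodMorphism.Build
  (coord (dscheme i)) lim_ring (@lim_gen i) (@lim_gen_zmod i).
HB.instance Definition _ (i : dobj D) := GRing.isMonoidMorphism.Build
  (coord (dscheme i)) lim_ring (@lim_gen i) (@lim_gen_monoid i).

Lemma lim_gen_str (i : dobj D) c : lim_gen (coord_str (dscheme i) c) = lim_const c.
Proof. by apply/lpiP; exact: lrel_genC. Qed.

Definition lim_proj (i : dobj D) : aff_hom aff_lim (dscheme i) :=
  @AffHom k aff_lim (dscheme i) (@lim_gen i) (@lim_gen_str i).

Lemma lim_proj_comm (i j : dobj D) (a : darrow i j) :
  aff_eq (aff_comp (dmap a) (lim_proj i)) (lim_proj j).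
Proof. by move=> x; apply/lpiP/lrel_sym; exact: lrel_map. Qed.

Definition lim_cone : cone D aff_lim := Cone lim_proj_comm.

Section Lift.
Variables (X : aff_scheme k) (C : cone D X).

Fixpoint leval (s : lterm) : coord X :=
  match s with
  | LConst a => coord_str X a
  | LGen i x => leg C i x
  | LAdd s t => leval s + leval t
  | LMul s t => leval s * leval t
  end.

Lemma leval_rel s t : lrel s t -> leval s = leval t.
Proof.
elim=> {s t} //=.
- by move=> s t u _ -> _ ->.
- by move=> s s' t t' _ -> _ ->.
- by move=> s s' t t' _ -> _ ->.
- by move=> s t u; rewrite addrA.
- by move=> s t; rewrite addrC.
- by move=> s; rewrite rmorph0 add0r.
- by move=> s; rewrite rmorphN1 mulN1r addNr rmorph0.
- by move=> s t u; rewrite mulrA.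
- by move=> s t; rewrite mulrC.
- by move=> s; rewrite rmorph1 mul1r.
- by move=> s t u; rewrite mulrDl.
- by move=> a b; rewrite rmorphD.
- by move=> a b; rewrite rmorphM.
- by move=> i a; rewrite pullback_str.
- by move=> i x y; rewrite rmorphD.
- by move=> i x y; rewrite rmorphM.
- by move=> i j a x; rewrite -(leg_comm C a).
Qed.

Definition lim_fun (x : lim_ring) : coord X := leval (repr x).

Lemma lim_funE s : lim_fun (lpi s) = leval s.
Proof. exact/leval_rel/lpi_repr. Qed.

Lemma lim_fun_zmod : zmod_morphism lim_fun.
Proof.
apply: add_zmod_morphism; do 2!elim/lpi_ind=> ?.
by rewrite [X in lim_fun X]lim_addE !lim_funE.
Qed.
Lemma lim_fun_monoid : monoid_morphism lim_fun.
Proof.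
split; first by rewrite lim_funE /= rmorph1.
by do 2!elim/lpi_ind=> ?; rewrite [X in lim_fun X]lim_mulE !lim_funE.
Qed.
HB.instance Definition _ :=
  GRing.isZmodMorphism.Build lim_ring (coord X) lim_fun lim_fun_zmod.
HB.instance Definition _ :=
  GRing.isMonoidMorphism.Build lim_ring (coord X) lim_fun lim_fun_monoid.

Lemma lim_fun_str c : lim_fun (coord_str aff_lim c) = coord_str X c.
Proof. exact: lim_funE. Qed.

Definition lim_lift : aff_hom X aff_lim := @AffHom k X aff_lim lim_fun lim_fun_str.

Theorem lim_liftP i : aff_eq (aff_comp (lim_proj i) lim_lift) (leg C i).
Proof. by move=> x; exact: lim_funE. Qed.

Theorem lim_lift_uniq (h : aff_hom X aff_lim) :
  (forall i, aff_eq (aff_comp (lim_proj i) h) (leg C i)) ->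
  aff_eq h lim_lift.
Proof.
move=> hC; elim/lpi_ind=> s; rewrite [RHS]lim_funE.
elim: s => /= [a|i x|s IHs t IHt|s IHs t IHt].
- exact: (pullback_str h).
- exact: hC.
- by rewrite -IHs -IHt -rmorphD; congr (h _); rewrite [RHS]lim_addE.
- by rewrite -IHs -IHt -rmorphM; congr (h _); rewrite [RHS]lim_mulE.
Qed.
End Lift.
End Limit.
Local Open Scope classical_set_scope.

Definition bin (d n : nat) := {l : {set 'I_n} | #|l| == d}.

Record matroid (d n : nat) := Matroid {
  bases :> {set bin d n};
  bases_neq0 : bases != finset.set0;
  bases_exchange : forall A B x, A \in bases -> B \in bases ->
    x \in val A :\: val B ->
    exists2 y, y \in val B :\: val A &
      exists2 C, C \in bases & val C = (y |: (val A :\ x))%SET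
}.

Section Plucker.
Variables (k : fieldType) (d n : nat).
Local Notation bin := (bin d n).

(* The polynomial ring with one variable p_l for each d-subset l of [n]. *)
Definition pring := {mpoly k[#|{: bin}|]}.
Local Notation monom := 'X_{1..#|{: bin}|}.

Definition pvar (l : bin) : pring := 'X_(enum_rank l).

Definition generic_mx : 'M[{mpoly k[d * n]}]_(d, n) :=
  \matrix_(i, j) 'X_(mxvec_index i j).

Definition bin_elt (l : bin) (j : 'I_d) : 'I_n :=
  enum_val (cast_ord (esym (eqP (valP l))) j).

Definition minor (l : bin) : {mpoly k[d * n]} :=
  \det (colsub (bin_elt l) generic_mx).

Definition plucker_map : pring -> {mpoly k[d * n]} :=
  mmap (@mpolyC (d * n) k) (fun i => minor (enum_val i)).

(* The homogeneous ideal of Gr(d,n).  For d > 0 the kernel of plucker_map is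
   itself homogeneous and this is the kernel; for d = 0 it is the zero
   ideal. *)
Definition plucker_ideal (f : pring) : Prop :=
  forall e : nat, plucker_map (pihomog mdeg e f) = 0.

Definition mvars (m : monom) : {set bin} := [set l | m (enum_rank l) != 0%N]%SET.

(* For N the set of bases of a matroid M, B_ring N is B_M as a subring of
   pring, and thin_ideal N is I_M.  These and the schemes below depend on M
   only through N, and are defined for every N. *)
Definition B_ring (N : {set bin}) (f : pring) : Prop :=
  forall m, m \in msupp f -> mvars m \subset N.

Definition thin_ideal (N : {set bin}) (f : pring) : Prop :=
  B_ring N f /\ exists g h, plucker_ideal g /\
    f = g + \sum_(l : bin | l \notin N) h l * pvar l.

Record B_ideal (N : {set bin}) := BIdeal {
  B_ideal_set :> pring -> Prop;
  B_ideal_sub : forall f, B_ideal_set f -> B_ring N f;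
  B_ideal_0 : B_ideal_set 0;
  B_ideal_add : forall f g, B_ideal_set f -> B_ideal_set g -> B_ideal_set (f + g);
  B_ideal_mul : forall a f, B_ring N a -> B_ideal_set f -> B_ideal_set (a * f)
}.

Lemma mvars0 : mvars 0%MM = finset.set0.
Proof. by apply/setP=> l; rewrite !inE mnm0E. Qed.

Lemma mvarsD m1 m2 : mvars (m1 + m2) = (mvars m1 :|: mvars m2)%SET.
Proof.
by apply/setP=> l; rewrite !inE mnmDE addn_eq0 negb_and.
Qed.

Section BRing.
Variable N : {set bin}.

Lemma B_ring0 : B_ring N 0.
Proof. by move=> m; rewrite msupp0. Qed.
Lemma B_ringX m : mvars m \subset N -> B_ring N 'X_[m].
Proof. by move=> mN m'; rewrite msuppX inE => /eqP ->. Qed.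
Lemma B_ringC c : B_ring N c%:MP.
Proof.
move=> m; rewrite msuppC; case: ifP => //= _; rewrite inE => /eqP ->.
by rewrite mvars0 finset.sub0set.
Qed.
Lemma B_ringD f g : B_ring N f -> B_ring N g -> B_ring N (f + g).
Proof.
by move=> hf hg m /msuppD_le; rewrite mem_cat => /orP[/hf|/hg].
Qed.
Lemma B_ringM f g : B_ring N f -> B_ring N g -> B_ring N (f * g).
Proof.
move=> hf hg m /msuppM_le /allpairsP[[m1 m2] /= [/hf h1 /hg h2 ->]].
by rewrite mvarsD finset.subUset h1 h2.
Qed.
Lemma B_ringN f : B_ring N f -> B_ring N (- f).
Proof. by move=> hf m; rewrite (perm_mem (msuppN f)); exact: hf. Qed.

Definition B_unit : B_ideal N :=
  @BIdeal N (B_ring N) (fun _ => id) B_ring0 B_ringD B_ringM.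

End BRing.

HB.instance Definition _ := GRing.RMorphism.copy plucker_map
  (mmap (@mpolyC (d * n) k) (fun i => minor (enum_val i))).

Lemma plucker_ideal0 : plucker_ideal 0.
Proof. by move=> e; rewrite !raddf0. Qed.
Lemma plucker_idealD f g :
  plucker_ideal f -> plucker_ideal g -> plucker_ideal (f + g).
Proof. by move=> hf hg e; rewrite !raddfD /= hf hg addr0. Qed.
Lemma plucker_ideal_sum (I : Type) (r : seq I) (P : pred I) F :
  (forall i, P i -> plucker_ideal (F i)) ->
  plucker_ideal (\sum_(i <- r | P i) F i).
Proof.
move=> h; elim/big_ind: _ => //; first exact: plucker_ideal0.
exact: plucker_idealD.
Qed.

Lemma pihomogMX e m (f : pring) :
  pihomog mdeg e ('X_[m] * f) =
  if (mdeg m <= e)%N then 'X_[m] * pihomog mdeg (e - mdeg m) f else 0.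
Proof.
rewrite [in LHS](mpolyE f) [in RHS](mpolyE f) mulr_sumr !raddf_sum /=.
rewrite mulr_sumr.
have -> : (if (mdeg m <= e)%N then \sum_(i <- msupp f)
   'X_[m] * pihomog mdeg (e - mdeg m) (f@_i *: 'X_[i]) else 0) =
   \sum_(i <- msupp f) if (mdeg m <= e)%N then
     'X_[m] * pihomog mdeg (e - mdeg m) (f@_i *: 'X_[i]) else 0 :> pring.
  by case: ifP => // _; rewrite big1.
apply: eq_bigr => m' _.
rewrite -scalerAr -mpolyXD !linearZ /= !pihomogX.
rewrite -[LHS]/(f@_m' *: if mdeg (m + m') == e then 'X_[m + m'] else 0).
rewrite -[in RHS]/(if mdeg m' == (e - mdeg m)%N then 'X_[m'] else 0) mdegD.
case: leqP => [le|lt].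
  rewrite -[in LHS](subnKC le) eqn_add2l.
  by case: eqP => _; rewrite ?mpolyXD ?scalerAr // !scaler0 mulr0.
by rewrite gtn_eqF ?scaler0 //; exact: leq_trans lt (leq_addr _ _).
Qed.

Lemma plucker_idealM a f : plucker_ideal f -> plucker_ideal (a * f).
Proof.
move=> hf; rewrite (mpolyE a) mulr_suml; apply: plucker_ideal_sum => m _ e.
rewrite -scalerAl linearZ /= pihomogMX.
case: ifP => _; last by rewrite scaler0 raddf0.
by rewrite scalerAl rmorphM /= hf mulr0.
Qed.

Section ThinIdeal.
Variable N : {set bin}.

Lemma thin_ideal0 : thin_ideal N 0.
Proof.
split; first exact: B_ring0; exists 0, (fun=> 0); split.
  exact: plucker_ideal0.
by rewrite big1 ?addr0 // => i _; rewrite mul0r.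
Qed.
Lemma thin_idealD f g : thin_ideal N f -> thin_ideal N g -> thin_ideal N (f + g).
Proof.
move=> [Bf [f1 [hf [pf Ef]]]] [Bg [g1 [hg [pg Eg]]]].
split; first exact: B_ringD.
exists (f1 + g1), (fun l => hf l + hg l); split; first exact: plucker_idealD.
rewrite {1}Ef {1}Eg addrACA -big_split /=.
by under eq_bigr do rewrite -mulrDl.
Qed.
Lemma thin_idealM a f : B_ring N a -> thin_ideal N f -> thin_ideal N (a * f).
Proof.
move=> Ba [Bf [f1 [hf [pf Ef]]]]; split; first exact: B_ringM.
exists (a * f1), (fun l => a * hf l); split; first exact: plucker_idealM.
by rewrite Ef mulrDr mulr_sumr; under eq_bigr do rewrite mulrA.
Qed.

Definition I_ideal : B_ideal N :=
  @BIdeal N (thin_ideal N) (fun _ => @proj1 _ _)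
    thin_ideal0 thin_idealD thin_idealM.
End ThinIdeal.
End Plucker.
Section Torus.
Variables (k : fieldType) (d n : nat).
Local Notation bin := (bin d n).
Local Notation pring := (pring k d n).
Local Notation "f %:F" := (tofrac f).

(* Degree zero part of the localization of J at the monomials in the p_l,
   l in N, inside the fraction field of pring. *)
Definition frac0 (N : {set bin}) (J : pring -> Prop) (x : {fraction pring}) :=
  exists f m, [/\ J f, f \is (mdeg m).-homog for mdeg, mvars m \subset N &
    x = f%:F / ('X_[m] : pring)%:F].

Section Frac0.
Variables (N : {set bin}) (J : B_ideal k N).

Lemma monomF_neq0 m : ('X_[m] : pring)%:F != 0.
Proof. by rewrite tofrac_eq0 -msupp_eq0 msuppX. Qed.

Lemma frac0_0 : frac0 N J 0.
Proof.
exists 0, 0%MM; split; rewrite ?rmorph0 ?mul0r ?dhomog0 //.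
  exact: B_ideal_0.
by rewrite mvars0 finset.sub0set.
Qed.

Lemma frac0_add x y : frac0 N J x -> frac0 N J y -> frac0 N J (x + y).
Proof.
move=> [f [m [Jf hf mN ->]]] [g [m' [Jg hg mN' ->]]].
exists ('X_[m'] * f + 'X_[m] * g), (m + m')%MM; split.
- by apply: B_ideal_add; apply: B_ideal_mul => //; exact: B_ringX.
- rewrite mdegD; apply: rpredD; last by apply: dhomogM; rewrite ?dhomogX.
  by rewrite addnC; apply: dhomogM; rewrite ?dhomogX.
- by rewrite mvarsD finset.subUset mN.
- rewrite addf_div ?monomF_neq0 // mpolyXD rmorphD !rmorphM.
  by congr (_ / _); rewrite mulrC [X in _ + X]mulrC.
Qed.

Lemma frac0_mul x y : frac0 N (B_ring N) x -> frac0 N J y -> frac0 N J (x * y).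
Proof.
move=> [f [m [Jf hf mN ->]]] [g [m' [Jg hg mN' ->]]].
exists (f * g), (m + m')%MM; split.
- exact: B_ideal_mul.
- by rewrite mdegD; exact: dhomogM.
- by rewrite mvarsD finset.subUset mN.
- by rewrite mpolyXD !rmorphM mulf_div.
Qed.
End Frac0.

Lemma frac0_C N c : frac0 N (B_ring N) (c%:MP : pring)%:F.
Proof.
exists c%:MP, 0%MM; split.
- exact: B_ringC.
- by rewrite mdeg0 -[c%:MP]mulr1 mul_mpolyC dhomogZ ?dhomog1.
- by rewrite mvars0 finset.sub0set.
- by rewrite mpolyX0 rmorph1 divr1.
Qed.

(* The coordinate ring of T(M), the complement of the coordinate hyperplanes
   in Proj(B_M). *)
Definition torus_pred (N : {set bin}) (x : {fraction pring}) :=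
  `[< frac0 N (B_ring N) x >].

Lemma torus_pred_subring N : subring_closed (torus_pred N).
Proof.
split; rewrite /in_mem /=.
- by apply/asboolP; have := frac0_C N 1; rewrite mpolyC1 rmorph1.
- move=> x y /asboolP hx /asboolP hy; apply/asboolP.
  apply: (@frac0_add N (B_unit k N)) => //; rewrite -mulN1r.
  apply: (@frac0_mul N (B_unit k N)) => //.
  by have := frac0_C N (-1); rewrite mpolyCN mpolyC1 rmorphN1.
- move=> x y /asboolP hx /asboolP hy; apply/asboolP.
  exact: (@frac0_mul N (B_unit k N)).
Qed.
HB.instance Definition _ N := GRing.isSubringClosed.Build
  {fraction pring} (torus_pred N) (torus_pred_subring N).

Definition torus_ring N := {x : {fraction pring} | torus_pred N x}.
HB.instance Definition _ N := SubChoice.on (torus_ring N).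
HB.instance Definition _ N :=
  [SubChoice_isSubComNzRing of torus_ring N by <:].

Lemma torus_ringP N (x : torus_ring N) : frac0 N (B_ring N) (val x).
Proof. by apply/asboolP; exact: (valP x). Qed.

Definition torus_elt N x (hx : frac0 N (B_ring N) x) : torus_ring N :=
  exist _ x (introT (asboolP _) hx).

Definition torus_const N (c : k) : torus_ring N := torus_elt (frac0_C N c).

Lemma torus_const_zmod N : zmod_morphism (torus_const N).
Proof. by move=> x y; apply/val_inj; rewrite /= !rmorphB. Qed.
Lemma torus_const_monoid N : monoid_morphism (torus_const N).
Proof. by split=> [|x y]; apply/val_inj; rewrite /= ?rmorphM ?rmorph1. Qed.
HB.instance Definition _ N := GRing.isZmodMorphism.Build
  k (torus_ring N) (torus_const N) (torus_const_zmod N).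
HB.instance Definition _ N := GRing.isMonoidMorphism.Build
  k (torus_ring N) (torus_const N) (torus_const_monoid N).

Section TorusProj.
Variables (N : {set bin}) (J : B_ideal k N).

Definition torus_ideal : ring_ideal (torus_ring N) :=
  @RingIdeal (torus_ring N) (fun x => frac0 N J (val x))
    (frac0_0 J) (fun x y => @frac0_add N J (val x) (val y))
    (fun a x => @frac0_mul N J (val a) (val x) (torus_ringP a)).

(* T(M) \cap Proj(B_M / J): degree-zero localization is exact, so the
   coordinate ring is a quotient of that of T(M). *)
Definition torus_proj : aff_scheme k :=
  @AffScheme k (ring_quot torus_ideal) (quot_pi torus_ideal \o torus_const N).
End TorusProj.

(* The morphism induced by the inclusion of B_ring N' in B_ring N. *)
Section Induced.
Variables (N N' : {set bin}) (J : B_ideal k N) (J' : B_ideal k N').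
Hypothesis NN : N' \subset N.
Hypothesis JJ : forall f, J' f -> J f.

Lemma B_ring_incl (f : pring) : B_ring N' f -> B_ring N f.
Proof. by move=> hf m mf; exact: fintype.subset_trans (hf m mf) NN. Qed.

Lemma frac0_incl (K K' : pring -> Prop) x :
  (forall f, K' f -> K f) ->
  frac0 N' K' x -> frac0 N K x.
Proof.
move=> KK [f [m [Kf hf mN ->]]]; exists f, m; split=> //.
  exact: KK.
exact: fintype.subset_trans mN NN.
Qed.

Definition torus_incl (x : torus_ring N') : torus_ring N :=
  torus_elt (@frac0_incl _ _ (val x) B_ring_incl
               (torus_ringP x)).

Lemma torus_incl_zmod : zmod_morphism torus_incl.
Proof. by move=> x y; apply/val_inj. Qed.
Lemma torus_incl_monoid : monoid_morphism torus_incl.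
Proof. by split=> [|x y]; apply/val_inj. Qed.
HB.instance Definition _ := GRing.isZmodMorphism.Build
  (torus_ring N') (torus_ring N) torus_incl torus_incl_zmod.
HB.instance Definition _ := GRing.isMonoidMorphism.Build
  (torus_ring N') (torus_ring N) torus_incl torus_incl_monoid.

Lemma torus_incl_ideal x : torus_ideal J' x -> torus_ideal J (torus_incl x).
Proof. by exact: frac0_incl. Qed.

Lemma induced_str c :
  quot_map torus_incl_ideal (coord_str (torus_proj J') c) =
  coord_str (torus_proj J) c.
Proof.
by rewrite /= quot_mapE; congr (quot_pi _ _); exact/val_inj.
Qed.

Definition induced_hom : aff_hom (torus_proj J) (torus_proj J') :=
  @AffHom k (torus_proj J) (torus_proj J') (quot_map torus_incl_ideal)
    induced_str.

Lemma induced_homE x :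
  induced_hom (quot_pi _ x) = quot_pi (torus_ideal J) (torus_incl x).
Proof. exact: quot_mapE. Qed.
End Induced.

Lemma induced_hom_comp N1 N2 N3 (J1 : B_ideal k N1) (J2 : B_ideal k N2)
    (J3 : B_ideal k N3) (n12 : N2 \subset N1) (n23 : N3 \subset N2)
    (n13 : N3 \subset N1) (h12 : forall f, J2 f -> J1 f)
    (h23 : forall f, J3 f -> J2 f) (h13 : forall f, J3 f -> J1 f) :
  aff_eq (aff_comp (induced_hom n23 h23) (induced_hom n12 h12))
         (induced_hom n13 h13).
Proof.
move=> x /=; have [{}x <-] := quot_pi_surj x.
rewrite !quot_mapE; congr (quot_pi _ _); exact/val_inj.
Qed.

End Torus.
Section Polytopes.
Variables (R : realType) (V : lmodType R).
Implicit Types (P F : set V).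

Definition conv_hull (I : finType) (N : {set I}) (p : I -> V) : set V :=
  [set x | exists c : I -> R,
    [/\ forall i, i \in N -> 0 <= c i, \sum_(i in N) c i = 1 &
        x = \sum_(i in N) c i *: p i]].

Definition argmin_set (l : {linear V -> R^o}) P : set V :=
  [set x | P x /\ forall y, P y -> l x <= l y].

(* The nonempty faces of a polytope P, including P itself (l = 0). *)
Definition is_face F P := exists l : {linear V -> R^o}, F = argmin_set l P.
End Polytopes.

Definition lower_face (R : realType) (V : lmodType R)
    (F P : set (V * R^o)%type) :=
  exists2 l : {linear (V * R^o)%type -> R^o}, 0 < l (0, 1) & F = argmin_set l P.

Section MatroidPolytopes.
Variables (R : realType) (d n : nat).
Local Notation bin := (bin d n).

Definition e_vec (l : bin) : 'rV[R]_n := \row_i (i \in val l)%:R.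

Definition matroid_polytope (N : {set bin}) : set 'rV[R]_n :=
  conv_hull N e_vec.

Definition lift_vec (w : bin -> R) (b : bin) : 'rV[R]_n * R^o := (e_vec b, w b).

Definition lifted_polytope (N : {set bin}) (w : bin -> R) :
    set ('rV[R]_n * R^o)%type :=
  conv_hull N (lift_vec w).

Definition is_cell (N : {set bin}) (w : bin -> R) (Q : set 'rV[R]_n) :=
  exists2 F, lower_face F (lifted_polytope N w) & Q = fst @` F.

(* The set of bases of M_Q when Q is the polytope of a matroid: every e_l is a
   vertex of the hypersimplex, so the vertices of Q are the e_l it contains. *)
Definition cell_bases (N : {set bin}) (Q : set 'rV[R]_n) : {set bin} :=
  [set b in N | `[< Q (e_vec b) >]]%SET.

Section Hull.
Variables (V : lmodType R) (I : finType) (N : {set I}) (p : I -> V).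

Lemma conv_hull_pt i : i \in N -> conv_hull N p (p i).
Proof.
move=> iN; exists (fun j => (j == i)%:R); split=> [j _||].
- exact: ler0n.
- by rewrite (bigD1 i) //= eqxx big1 ?addr0 // => j /andP[_ /negPf ->].
- rewrite (bigD1 i) //= eqxx scale1r big1 ?addr0 // => j /andP[_ /negPf ->].
  by rewrite scale0r.
Qed.

(* A point of the hull minimizes l over the hull as soon as it minimizes l
   over the generators. *)
Lemma conv_hull_ge (l : {linear V -> R^o}) c x :
  (forall i, i \in N -> c <= l (p i)) -> conv_hull N p x -> c <= l x.
Proof.
move=> h [a [a0 a1 ->]]; rewrite linear_sum /= -[c]mul1r -a1 mulr_suml.
apply: ler_sum => i iN; rewrite linearZ /=.
by apply: ler_wpM2l; [exact: a0|exact: h].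
Qed.

Lemma conv_hull_min (l : {linear V -> R^o}) c (a : I -> R) :
  (forall i, i \in N -> 0 <= a i) -> \sum_(i in N) a i = 1 ->
  (forall i, i \in N -> c <= l (p i)) ->
  l (\sum_(i in N) a i *: p i) <= c ->
  forall i, i \in N -> l (p i) != c -> a i = 0.
Proof.
move=> a0 a1 h le.
have : \sum_(i in N) a i * (l (p i) - c) == 0.
  rewrite eq_le sumr_ge0 ?andbT => [|i iN].
    under eq_bigr do rewrite mulrBr.
    rewrite sumrB -mulr_suml a1 mul1r subr_le0; apply: le_trans le.
    by rewrite linear_sum; under [leRHS]eq_bigr do rewrite linearZ.
  by rewrite mulr_ge0 ?a0 // subr_ge0 h.
rewrite psumr_eq0 => [/allP h0 i iN ne|i iN]; last first.
  by rewrite mulr_ge0 ?a0 // subr_ge0 h.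
have := h0 i (mem_index_enum _); rewrite iN /= mulf_eq0 subr_eq0 (negPf ne).
by rewrite orbF => /eqP.
Qed.
End Hull.

Definition dotb (v : 'I_n -> R) (l : bin) := \sum_(i in val l) v i.

Definition lin_coef (l : {linear 'rV[R]_n -> R^o}) (i : 'I_n) : R :=
  l (delta_mx 0 i).

Lemma linear_e_vec (l : {linear 'rV[R]_n -> R^o}) b :
  l (e_vec b) = dotb (lin_coef l) b.
Proof.
rewrite (row_sum_delta (e_vec b)) linear_sum /dotb [RHS]big_mkcond /=.
apply: eq_bigr => i _; rewrite linearZ mxE /lin_coef /=.
by case: ifP => _; rewrite ?scale1r ?scale0r.
Qed.

Definition in_left (x : 'rV[R]_n) : 'rV[R]_n * R^o := (x, 0).
Lemma in_left_linear : linear in_left.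
Proof.
move=> a x y; apply/pair_equal_spec; split=> //=.
by rewrite scaler0 addr0.
Qed.
HB.instance Definition _ := GRing.isLinear.Build R 'rV[R]_n
  ('rV[R]_n * R^o)%type _ in_left in_left_linear.

(* the functional  x |-> - \sum_(i in b) x_i  is minimal exactly at e_b *)
Definition sep_fun (b : bin) (x : 'rV[R]_n) : R^o := - \sum_(i in val b) x 0 i.
Lemma sep_fun_linear b : linear (sep_fun b).
Proof.
move=> a x y; rewrite /sep_fun scalerN scaler_sumr -opprD -big_split /=.
by congr (- _); apply: eq_bigr => i _; rewrite !mxE.
Qed.
HB.instance Definition _ b := GRing.isLinear.Build R 'rV[R]_n R^o _
  (sep_fun b) (sep_fun_linear b).

Lemma sep_fun_e b l : sep_fun b (e_vec l) = - (#|val b :&: val l|)%:R.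
Proof.
rewrite /sep_fun; congr (- _); rewrite -sum1_card natr_sum.
rewrite (eq_bigl (fun i => (i \in val b) && (i \in val l))); last first.
  by move=> i; rewrite !inE.
rewrite big_mkcondr /=; apply: eq_bigr => i _; rewrite mxE.
by case: ifP.
Qed.

Lemma sep_fun_ge b l : - d%:R <= sep_fun b (e_vec l).
Proof.
rewrite sep_fun_e lerN2 ler_nat -[X in (_ <= X)%N](eqP (valP b)).
exact/subset_leq_card/finset.subsetIl.
Qed.

Lemma sep_fun_eq b l : sep_fun b (e_vec l) = - d%:R -> l = b.
Proof.
rewrite sep_fun_e => /oppr_inj/eqP; rewrite eqr_nat => /eqP h.
have /eqP cb := valP b; have /eqP cl := valP l.
have /eqP e1 : (val b :&: val l)%SET == val b.
  by rewrite eqEcard finset.subsetIl h cb leqnn.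
have /eqP e2 : (val b :&: val l)%SET == val l.
  by rewrite eqEcard finset.subsetIr h cl leqnn.
by apply/val_inj; rewrite /= -e2 e1.
Qed.

Lemma sep_fun_self b : sep_fun b (e_vec b) = - d%:R.
Proof. by rewrite sep_fun_e finset.setIid (eqP (valP b)). Qed.

Lemma hull_vertex (N : {set bin}) (b : bin) (a : bin -> R) :
  (forall i, i \in N -> 0 <= a i) -> \sum_(i in N) a i = 1 ->
  e_vec b = \sum_(i in N) a i *: e_vec i ->
  b \in N /\ forall (U : lmodType R) (q : bin -> U),
    \sum_(i in N) a i *: q i = q b.
Proof.
move=> a0 a1 e.
have z i : i \in N -> i != b -> a i = 0.
  move=> iN ib; apply: (conv_hull_min (p := e_vec) (l := sep_fun b)
    (c := - d%:R) a0 a1 _ _ iN).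
  - by move=> j _; exact: sep_fun_ge.
  - by rewrite -e [leLHS]sep_fun_self.
  - by apply: contra_neq ib; exact: sep_fun_eq.
have bN : b \in N.
  apply/negPn/negP => nb; move: a1; rewrite big1 => [/eqP|i iN].
    by rewrite eq_sym oner_eq0.
  by apply: z => //; apply: contraNneq nb => <-.
split=> // U q; move: a1; rewrite (bigD1 b) //= big1 ?addr0 => [ab|i /andP[]//].
  rewrite (bigD1 b) //= ab scale1r big1 ?addr0 // => i /andP[iN ib].
  by rewrite z // scale0r.
exact: z.
Qed.

Lemma matroid_polytope_vertex (N : {set bin}) b :
  matroid_polytope N (e_vec b) -> b \in N.
Proof. by move=> [a [a0 a1 e]]; have [] := hull_vertex a0 a1 e. Qed.

Lemma face_sep (N N' : {set bin}) :
  is_face (matroid_polytope N') (matroid_polytope N) ->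
  N' \subset N /\ exists v c, forall b, b \in N ->
    c <= dotb v b /\ (b \in N' <-> dotb v b = c).
Proof.
move=> [l El].
have sub : N' \subset N.
  apply/fintype.subsetP => b bN'; apply: matroid_polytope_vertex.
  have : matroid_polytope N' (e_vec b) by exact: conv_hull_pt.
  by rewrite El => -[].
split=> //; exists (lin_coef l).
have [->|[b0 b0N]] := set_0Vmem N.
  by exists 0 => b; rewrite inE.
have [b1 b1N min] := arg_minP (fun b => l (e_vec b) : R) b0N.
exists (l (e_vec b1)) => b bN; rewrite -linear_e_vec; split; first exact: min.
split=> [bN'|eb].
  have : matroid_polytope N' (e_vec b) by exact: conv_hull_pt.
  rewrite El => -[_ h]; apply/le_anti; rewrite min // andbT.
  by apply: h; exact: conv_hull_pt.
apply: matroid_polytope_vertex; rewrite El; split; first exact: conv_hull_pt.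
by move=> y; rewrite eb; exact: conv_hull_ge.
Qed.

Lemma cell_vertex (N : {set bin}) w (l : {linear ('rV[R]_n * R^o)%type -> R^o})
    b :
  b \in cell_bases N (fst @` argmin_set l (lifted_polytope N w)) <->
  b \in N /\ forall b', b' \in N -> l (lift_vec w b) <= l (lift_vec w b').
Proof.
rewrite inE; split=> [/andP[bN /asboolP[[x t] /= [[a [a0 a1 e]] h] ex]]|[bN h]].
  split=> // b' b'N; have [e1 e2] : x = \sum_(i in N) a i *: e_vec i /\
      t = \sum_(i in N) a i *: (w i : R^o).
    have := congr1 fst e; have := congr1 snd e.
    rewrite !raddf_sum /= => -> ->; split=> //.
  have [_ /(_ _ (w : bin -> R^o)) ew] := hull_vertex a0 a1 (etrans (esym ex) e1).
  have <- : (x, t) = lift_vec w b by rewrite /lift_vec -ex e2 ew.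
  apply: h.
  exact: (conv_hull_pt (lift_vec w)).
rewrite bN; apply/asboolP; exists (lift_vec w b) => //; split.
  exact: (conv_hull_pt (lift_vec w)).
by move=> y; apply: conv_hull_ge.
Qed.

Lemma cell_sep (N : {set bin}) w Q : is_cell N w Q ->
  exists v c, forall b, b \in N ->
    dotb v b + c <= w b /\ (b \in cell_bases N Q <-> w b = dotb v b + c).
Proof.
move=> [F [l l0 ->] ->].
pose a := l (0, 1) : R.
have lE x t : l (x, t) = (l (x, 0) + a * t)%R :> R.
  have -> : (x, t) = ((x, 0) + t *: (0, 1))%R :> ('rV[R]_n * R^o)%type.
    by apply/pair_equal_spec; split; rewrite /= ?scaler0 ?addr0 // add0r [_ *: _]mulr1.
  by rewrite linearD linearZ /= mulrC.
pose v i := - (lin_coef (l \o in_left) i / a) : R.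
have vE b : dotb v b = - (l (e_vec b, 0) / a) :> R.
  have := linear_e_vec (l \o in_left) b; rewrite /= /in_left => ->.
  by rewrite /dotb mulr_suml -sumrN.
have [->|[b0 b0N]] := set_0Vmem N.
  by exists v, 0 => b; rewrite inE.
have [b1 b1N min] := arg_minP (fun b => l (lift_vec w b) : R) b0N.
exists v, (l (lift_vec w b1) / a : R) => b bN.
have E : w b - (dotb v b + l (lift_vec w b1) / a) =
   (l (lift_vec w b) - l (lift_vec w b1)) / a :> R.
  have -> : l (lift_vec w b) = l (e_vec b, 0) + a * w b :> R by exact: lE.
  rewrite vE mulrBl mulrDl [a * w b]mulrC mulfK ?gt_eqF //.
  by rewrite opprD opprK addrA [w b + _]addrC.
split.
  by rewrite -subr_ge0 E divr_ge0 ?(ltW l0) // subr_ge0 min.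
rewrite cell_vertex; split=> [[_ h]|eb].
  apply/eqP; rewrite -subr_eq0 E.
  have -> : l (lift_vec w b) = l (lift_vec w b1).
    by apply/le_anti; rewrite min // h.
  by rewrite subrr mul0r.
split=> // b' b'N; apply: le_trans (min _ b'N).
move/eqP: eb; rewrite -subr_eq0 E mulf_eq0 invr_eq0 (gt_eqF l0) orbF subr_eq0.
by move=> /eqP ->.
Qed.

Lemma cell_polytope (N : {set bin}) w Q : is_cell N w Q ->
  Q = matroid_polytope (cell_bases N Q).
Proof.
move=> [F [l l0 ->] ->]; apply/seteqP; split=> x.
  move=> [[y t] /= [[a [a0 a1 e]] h] <-{x}].
  have [e1 e2] : y = \sum_(i in N) a i *: e_vec i /\
      t = \sum_(i in N) a i *: (w i : R^o).
    have := congr1 fst e; have := congr1 snd e.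
    by rewrite !raddf_sum /= => -> ->.
  set B := cell_bases _ _.
  have z i : i \in N -> i \notin B -> a i = 0.
    move=> iN niB.
    apply: (conv_hull_min (p := lift_vec w) (l := l)
      (c := l (y, t)) a0 a1 _ _ iN).
    - by move=> j jN; apply: h; exact: (conv_hull_pt (lift_vec w)).
    - by rewrite -e.
    - apply: contraNneq niB => ei; apply/cell_vertex; split=> // b' b'N.
      rewrite ei; apply: h.
      exact: (conv_hull_pt (lift_vec w)).
  have BN i : i \in B -> i \in N by rewrite inE => /andP[].
  have sumE (U : lmodType R) (q : bin -> U) :
      \sum_(i in N) a i *: q i = \sum_(i in B) a i *: q i.
    rewrite [LHS]big_mkcond [RHS]big_mkcond /=; apply: eq_bigr => i _.
    case: ifP => iN; case: ifP => iB //; last by move/BN: iB; rewrite iN.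
    by rewrite z ?iB // scale0r.
  exists a; split.
  - by move=> i /BN; exact: a0.
  - rewrite -a1; have := sumE _ (fun=> 1 : R^o).
    by under eq_bigr do rewrite [_ *: _]mulr1; under [X in _ = X -> _]eq_bigr do rewrite [_ *: _]mulr1.
  - by rewrite e1 sumE.
move=> [a [a0 a1 ->]]; set B := cell_bases _ _ in a0 a1 *.
exists (\sum_(i in B) a i *: lift_vec w i); last first.
  by rewrite raddf_sum /=; apply: eq_bigr.
have BN i : i \in B -> i \in N by rewrite inE => /andP[].
split.
  exists (fun i => if i \in B then a i else 0); split.
  - by move=> i _; case: ifP => // /a0.
  - rewrite -a1 [LHS]big_mkcond [RHS]big_mkcond /=; apply: eq_bigr => i _.
    by case: ifP => [|/negP]; case: ifP => // /BN.
  - rewrite [LHS]big_mkcond [RHS]big_mkcond /=; apply: eq_bigr => i _.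
    case: ifP => iB; first by rewrite BN.
    by rewrite scale0r; case: ifP.
move=> y hy; rewrite linear_sum /= -[leRHS]mul1r -a1 mulr_suml.
apply: ler_sum => i iB; rewrite linearZ /=; apply: ler_wpM2l; first exact: a0.
by move/cell_vertex: iB => [_ h]; apply: conv_hull_ge hy.
Qed.
End MatroidPolytopes.
Section Initial.
Variables (R : realType) (k : fieldType) (d n : nat).
Local Notation bin := (bin d n).
Local Notation pring := (pring k d n).
Local Notation monom := 'X_{1..#|{: bin}|}.

Definition mweight (w : bin -> R) (m : monom) : R :=
  \sum_(l : bin) w l *+ m (enum_rank l).

Definition initial (w : bin -> R) (f : pring) : pring :=
  \sum_(m <- msupp f | all (fun m' => mweight w m <= mweight w m') (msupp f))
    f@_m *: 'X_[m].

Definition init_set (N : {set bin}) (w : bin -> R) (f : pring) : Prop :=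
  exists s : seq (pring * pring),
    (forall p, p \in s -> B_ring N p.1 /\ thin_ideal N p.2) /\
    f = \sum_(p <- s) p.1 * initial w p.2.

Definition mfilter (K : nat) (P : pred 'X_{1..K}) (f : {mpoly k[K]}) :=
  \sum_(m <- msupp f | P m) f@_m *: 'X_[m].

Lemma mcoeff_filter K (P : pred 'X_{1..K}) f m :
  (mfilter P f)@_m = if P m then f@_m else 0.
Proof.
rewrite /mfilter raddf_sum /= big_mkcond /=.
have [mf|mf] := boolP (m \in msupp f).
  rewrite (bigD1_seq m) ?msupp_uniq //= mcoeffZ mcoeffX eqxx mulr1.
  rewrite big1 ?addr0 // => m' /negPf ne.
  by case: ifP => // _; rewrite mcoeffZ mcoeffX ne mulr0.
rewrite memN_msupp_eq0 // if_same big_seq big1 // => m' m'f.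
have ne : (m' == m) = false by apply: contraNF mf => /eqP <-.
by case: ifP => // _; rewrite mcoeffZ mcoeffX ne mulr0.
Qed.

Lemma msupp_filter K (P : pred 'X_{1..K}) f m :
  (m \in msupp (mfilter P f)) = P m && (m \in msupp f).
Proof. by rewrite !mcoeff_msupp mcoeff_filter; case: (P m); rewrite ?eqxx. Qed.

Lemma mfilter_zmod K (P : pred 'X_{1..K}) : zmod_morphism (mfilter P).
Proof.
move=> f g; apply/mpolyP=> m; rewrite mcoeffB !mcoeff_filter mcoeffB.
by case: ifP; rewrite ?subr0.
Qed.
HB.instance Definition _ K P := GRing.isZmodMorphism.Build
  {mpoly k[K]} {mpoly k[K]} (@mfilter K P) (@mfilter_zmod K P).

Lemma mfilterZ K (P : pred 'X_{1..K}) c f : mfilter P (c *: f) = c *: mfilter P f.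
Proof.
apply/mpolyP=> m; rewrite mcoeffZ !mcoeff_filter mcoeffZ.
by case: ifP; rewrite ?mulr0.
Qed.

Lemma mfilter_all K (P : pred 'X_{1..K}) f :
  (forall m, m \in msupp f -> P m) -> mfilter P f = f.
Proof.
move=> h; apply/mpolyP=> m; rewrite mcoeff_filter; case: ifP => // nP.
by rewrite memN_msupp_eq0 //; apply/negP => /h; rewrite nP.
Qed.

Lemma mfilter_none K (P : pred 'X_{1..K}) f :
  (forall m, m \in msupp f -> ~~ P m) -> mfilter P f = 0.
Proof.
move=> h; apply/mpolyP=> m; rewrite mcoeff_filter mcoeff0; case: ifP => // nP.
by rewrite memN_msupp_eq0 //; apply/negP => /h; rewrite nP.
Qed.

Lemma mfilterC K (P P' : pred 'X_{1..K}) f :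
  mfilter P (mfilter P' f) = mfilter P' (mfilter P f).
Proof. by apply/mpolyP=> m; rewrite !mcoeff_filter; do 2!case: ifP. Qed.

Lemma mfilter_split K (P : pred 'X_{1..K}) f :
  f = mfilter P f + mfilter (predC P) f.
Proof.
apply/mpolyP=> m; rewrite mcoeffD !mcoeff_filter /=.
by case: (P m); rewrite ?addr0 ?add0r.
Qed.

Lemma pihomog_filter K e (f : {mpoly k[K]}) :
  pihomog mdeg e f = mfilter (fun m => mdeg m == e) f.
Proof. by []. Qed.

Section Weights.
Variables (K : nat) (w : 'I_K -> R).
Definition gweight (m : 'X_{1..K}) : R := \sum_(i < K) w i *+ m i.
Lemma gweightD m m' : gweight (m + m') = gweight m + gweight m'.
Proof.
by rewrite -big_split /=; apply: eq_bigr => i _; rewrite mnmDE mulrnDr.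
Qed.
Lemma gweight0 : gweight 0 = 0.
Proof. by rewrite /gweight big1 // => i _; rewrite mnm0E. Qed.
Lemma gweight1 i : gweight U_(i) = w i.
Proof.
rewrite /gweight (bigD1 i) //= mnm1E eqxx big1 ?addr0 // => j ne.
by rewrite mnm1E eq_sym (negPf ne).
Qed.

Definition ghomog r (f : {mpoly k[K]}) :=
  forall m, m \in msupp f -> gweight m = r.
Lemma ghomogM r r' f g : ghomog r f -> ghomog r' g -> ghomog (r + r') (f * g).
Proof.
move=> hf hg m /msuppM_le /allpairsP[[m1 m2] /= [/hf <- /hg <- ->]].
exact: gweightD.
Qed.
Lemma ghomog1 : ghomog 0 1.
Proof. by move=> m; rewrite msupp1 inE => /eqP ->; exact: gweight0. Qed.
Lemma ghomogX i : ghomog (w i) 'X_i.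
Proof. by move=> m; rewrite msuppX inE => /eqP ->; exact: gweight1. Qed.
Lemma ghomogZ r c f : ghomog r f -> ghomog r (c *: f).
Proof. by move=> h m /msuppZ_le /h. Qed.
Lemma ghomogD r f g : ghomog r f -> ghomog r g -> ghomog r (f + g).
Proof. by move=> hf hg m /msuppD_le; rewrite mem_cat => /orP[/hf|/hg]. Qed.
Lemma ghomog0 r : ghomog r 0.
Proof. by move=> m; rewrite msupp0. Qed.
Lemma ghomog_prod (I : finType) (P : pred I) (r : I -> R) F :
  (forall i, P i -> ghomog (r i) (F i)) ->
  ghomog (\sum_(i | P i) r i) (\prod_(i | P i) F i).
Proof.
move=> h; elim/big_rec2: _ => [|i y x Pi]; first exact: ghomog1.
by apply: ghomogM; exact: h.
Qed.
Lemma ghomogXn r f e : ghomog r f -> ghomog (r *+ e) (f ^+ e).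
Proof.
move=> h; elim: e => [|e IH]; first exact: ghomog1.
by rewrite exprS mulrS; exact: ghomogM.
Qed.
End Weights.

Section PluckerGrading.
Variable v : 'I_n -> R.

Let xweight (i : 'I_(d * n)) : R := mxvec (\matrix_(_ < d, j < n) v j) 0 i.

Lemma dotb_elt (l : bin) : dotb v l = \sum_(j < d) v (bin_elt l j).
Proof.
rewrite /dotb big_enum_val /=.
rewrite (reindex (cast_ord (esym (eqP (valP l))))) //.
exists (cast_ord (eqP (valP l))) => i _; first exact: cast_ordKV.
exact: cast_ordK.
Qed.

Lemma minor_homog (l : bin) : ghomog xweight (dotb v l) (minor k l).
Proof.
rewrite /minor /determinant; elim/big_ind: _ => [|f g|s _].
- exact: ghomog0.
- exact: ghomogD.
rewrite -(rmorph_sign (@mpolyC (d * n) k)) mul_mpolyC; apply: ghomogZ.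
rewrite dotb_elt (reindex_inj (@perm_inj _ s)) /=.
apply: ghomog_prod => i _; rewrite !mxE.
have -> : v (bin_elt l (s i)) = xweight (mxvec_index i (bin_elt l (s i))).
  by rewrite /xweight mxvecE mxE.
exact: ghomogX.
Qed.

Lemma plucker_map_filter r (f : pring) :
  plucker_map (mfilter (fun m => mweight (dotb v) m == r) f) =
  mfilter (fun m => gweight xweight m == r) (plucker_map f).
Proof.
elim/mpolyind: f => [|c m f _ _ IH]; first by rewrite !raddf0.
rewrite !raddfD /= IH; congr (_ + _).
have mapZ a (p : pring) : plucker_map (a *: p) = a *: plucker_map p.
  by rewrite -mul_mpolyC rmorphM -mul_mpolyC; congr (_ * _); exact: mmapC.
rewrite mfilterZ !mapZ mfilterZ; congr (_ *: _).
rewrite [in RHS]/plucker_map mmapX; set M := mmap1 _ m.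
have hM : ghomog xweight (mweight (dotb v) m) M.
  rewrite /mweight (reindex _ (onW_bij _ (@enum_val_bij bin))) /=.
  under eq_bigr do rewrite enum_valK.
  by apply: ghomog_prod => i _; apply: ghomogXn; exact: minor_homog.
have [e|ne] := eqVneq (mweight (dotb v) m) r.
  rewrite mfilter_all => [|m']; last by rewrite msuppX inE => /eqP ->; rewrite e.
  rewrite [LHS]mmapX mfilter_all // => m' /hM ->.
  by rewrite e.
rewrite mfilter_none => [|m']; last by rewrite msuppX inE => /eqP ->.
by rewrite raddf0 mfilter_none // => m' /hM ->.
Qed.

Lemma plucker_ideal_filter r (f : pring) : plucker_ideal f ->
  plucker_ideal (mfilter (fun m => mweight (dotb v) m == r) f).
Proof.
move=> h e; rewrite pihomog_filter mfilterC plucker_map_filter.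
by rewrite -pihomog_filter h raddf0.
Qed.

Lemma plucker_ideal_deg e (f : pring) : plucker_ideal f ->
  plucker_ideal (pihomog mdeg e f).
Proof.
move=> h e'; have [->|ne] := eqVneq e' e; first by rewrite pihomog_id h.
by rewrite (@pihomog_ne0 _ _ _ e) ?raddf0 // 1?eq_sym // pihomogP.
Qed.
End PluckerGrading.

Definition var_ideal (N : {set bin}) (f : pring) :=
  exists h, f = \sum_(l : bin | l \notin N) h l * pvar k l.

Lemma var_idealP N (f : pring) : var_ideal N f <->
  forall m, m \in msupp f -> ~~ (mvars m \subset N).
Proof.
split=> [[h ->] m|hf].
  move/msupp_sum_le/flattenP=> [ms /mapP[l]].
  rewrite mem_filter => /andP[lN _] -> /msuppM_le/allpairsP[[m1 m2] /= [_]].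
  rewrite /pvar msuppX inE => /eqP -> ->.
  apply/negP=> /fintype.subsetP/(_ l); rewrite (negPf lN) inE mnmDE mnm1E eqxx.
  by rewrite addn1 => /(_ isT).
rewrite (mpolyE f) big_seq; elim/big_ind: _ => [|f1 f2|m mf].
- by exists (fun=> 0); rewrite big1 // => l _; rewrite mul0r.
- move=> [h1 ->] [h2 ->]; exists (fun l => h1 l + h2 l).
  by rewrite -big_split /=; under [RHS]eq_bigr do rewrite mulrDl.
have /fintype.subsetPn[l] := hf m mf; rewrite inE => lm lN.
exists (fun l' => if l' == l then f@_m *: 'X_[m - U_(enum_rank l)] else 0).
rewrite (bigD1 l) //= eqxx big1 ?addr0 => [|l' /andP[_ /negPf ->]]; last first.
  by rewrite mul0r.
rewrite -scalerAl -mpolyXD submK //; apply/mnm_lepP=> i; rewrite mnm1E.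
by case: eqP => // <-; rewrite lt0n.
Qed.

Lemma thin_idealP N (f : pring) : thin_ideal N f <->
  B_ring N f /\ exists g h, [/\ plucker_ideal g, var_ideal N h & f = g + h].
Proof.
split=> [[Bf [g [h [pg E]]]]|[Bf [g [h [pg [h' Eh] E]]]]]; split=> //.
  exists g, (\sum_(l : bin | l \notin N) h l * pvar k l); split=> //.
  by exists h.
by exists g, h'; rewrite -Eh.
Qed.

Section Degenerate.
Variables (N N' : {set bin}) (v : 'I_n -> R).
Hypothesis NN : N' \subset N.
Local Notation wt := (mweight (dotb v)).
Local Notation wpart r := (mfilter (fun m => wt m == r)).

Lemma thin_ideal_part N0 r (f : pring) :
  thin_ideal N0 f -> thin_ideal N0 (wpart r f).
Proof.
move=> /thin_idealP[Bf [g [h [pg /var_idealP hh E]]]].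
apply/thin_idealP; split; first by move=> m; rewrite msupp_filter => /andP[_ /Bf].
exists (wpart r g), (wpart r h); split; last by rewrite E raddfD.
  exact: plucker_ideal_filter.
by apply/var_idealP => m; rewrite msupp_filter => /andP[_ /hh].
Qed.

Lemma wpart_sum (f : pring) :
  f = \sum_(r <- undup [seq wt m | m <- msupp f]) wpart r f.
Proof.
apply/mpolyP=> m; rewrite raddf_sum /=; under eq_bigr do rewrite mcoeff_filter.
have [mf|mf] := boolP (m \in msupp f); last first.
  by rewrite big1 => [|r _]; rewrite memN_msupp_eq0 ?if_same.
rewrite (bigD1_seq (wt m)) ?undup_uniq ?mem_undup ?map_f //= eqxx.
by rewrite big1 ?addr0 // => r; rewrite eq_sym => /negPf ->.
Qed.

Lemma thin_ideal_lift e r (f : pring) : thin_ideal N' f ->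
    f \is e.-homog for mdeg -> (forall m, m \in msupp f -> wt m = r) ->
  exists2 h : pring, (forall m, m \in msupp h ->
     [/\ mvars m \subset N, ~~ (mvars m \subset N'), mdeg m = e & wt m = r]) &
    thin_ideal N (f + h).
Proof.
move=> /thin_idealP[Bf [g [s [pg /var_idealP hs E]]]] hf wf.
pose part (p : pring) := wpart r (pihomog mdeg e p).
have partf : part f = f by rewrite /part pihomog_dE // mfilter_all // => m /wf ->.
have Ep : f = part g + part s.
  by rewrite -[LHS]partf {1}E /part !raddfD.
have part_supp p m : m \in msupp (part p) ->
    [/\ m \in msupp p, mdeg m = e & wt m = r].
  by rewrite /part pihomog_filter !msupp_filter => /and3P[/eqP -> /eqP -> ->].
pose Q (m : monom) := mvars m \subset N.
exists (- mfilter Q (part s)) => [m|].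
  rewrite (perm_mem (msuppN _)) msupp_filter => /andP[mN /part_supp[ms -> ->]].
  by split=> //; exact: hs.
apply/thin_idealP; split.
  apply: B_ringD; first by move=> m /Bf mN'; exact: fintype.subset_trans mN' NN.
  by apply: B_ringN => m; rewrite msupp_filter => /andP[].
exists (part g), (mfilter (predC Q) (part s)); split.
- exact/plucker_ideal_filter/plucker_ideal_deg.
- by apply/var_idealP => m; rewrite msupp_filter => /andP[].
- pose A := mfilter Q (part s); pose B := mfilter (predC Q) (part s).
  have S : part s = A + B by exact: mfilter_split.
  by rewrite -/A -/B {1}Ep S addrA addrAC addrK.
Qed.

Lemma thin_ideal_ind (K : B_ideal k N) :
  (forall e r (f : pring), thin_ideal N' f -> f \is e.-homog for mdeg ->
     (forall m, m \in msupp f -> wt m = r) -> K f) ->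
  forall f : pring, thin_ideal N' f -> K f.
Proof.
move=> hK f tf; rewrite (pihomog_partitionE (mf := mdeg) (leqnn (mmeasure mdeg f))).
elim/big_ind: _ => [||e _]; [exact: B_ideal_0|exact: B_ideal_add|].
move: (nat_of_ord e) => {}e.
rewrite (wpart_sum (pihomog _ _ _)).
elim/big_ind: _ => [||r _]; [exact: B_ideal_0|exact: B_ideal_add|].
apply: (hK e r).
- apply: thin_ideal_part; move/thin_idealP: tf.
  move=> [Bf [g [h [pg /var_idealP hh E]]]]; apply/thin_idealP; split.
    by move=> m; rewrite pihomog_filter msupp_filter => /andP[_ /Bf].
  exists (pihomog mdeg e g), (pihomog mdeg e h).
  split; [exact: plucker_ideal_deg| |by rewrite E raddfD].
  apply/var_idealP => m.
  by rewrite pihomog_filter msupp_filter => /andP[_ /hh].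
- apply/dhomogP=> m; rewrite pihomog_filter !msupp_filter.
  by move=> /and3P[_ /eqP].
- by move=> m; rewrite msupp_filter => /andP[/eqP].
Qed.

Lemma mweight_cmp (a u : bin -> R) :
  (forall b, b \in N -> a b <= u b /\ (b \in N' <-> u b = a b)) ->
  forall m : monom, mvars m \subset N ->
    mweight a m <= mweight u m /\
    (mvars m \subset N' <-> mweight u m = mweight a m).
Proof.
move=> hu m /fintype.subsetP mN.
have E : mweight u m - mweight a m =
    \sum_(l : bin) (u l - a l) *+ m (enum_rank l).
  by rewrite -sumrB /=; apply: eq_bigr => l _; rewrite mulrnBl.
have ge l : 0 <= (u l - a l) *+ m (enum_rank l).
  have [->|ml] := eqVneq (m (enum_rank l)) 0%N; first by rewrite mulr0n.
  have /hu[le _] : l \in N by apply: mN; rewrite inE.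
  by rewrite mulrn_wge0 // subr_ge0.
split; first by rewrite -subr_ge0 E sumr_ge0.
split=> [/fintype.subsetP mN'|/eqP].
  apply/eqP; rewrite -subr_eq0 E big1 // => l _.
  have [->|ml] := eqVneq (m (enum_rank l)) 0%N; first by rewrite mulr0n.
  have lN' : l \in N' by apply: mN'; rewrite inE.
  have /hu[_ [h _]] : l \in N by apply: (fintype.subsetP NN).
  by rewrite h // subrr mul0rn.
rewrite -subr_eq0 E psumr_eq0 // => /allP h; apply/fintype.subsetP => l ml.
have /hu[_ [_ h']] : l \in N by apply: mN.
apply: h'; have := h l (mem_index_enum _); rewrite /= mulrn_eq0.
by move: ml; rewrite inE => /negPf ->; rewrite /= subr_eq0 => /eqP.
Qed.

Lemma mweight_addC c (m : monom) :
  mweight (fun b => dotb v b + c) m = wt m + c *+ mdeg m.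
Proof.
rewrite mdegE -sumrMnr (reindex _ (onW_bij _ (@enum_rank_bij bin))) /=.
by rewrite -big_split /=; apply: eq_bigr => l _; rewrite mulrnDl.
Qed.

Lemma mweight_C c (m : monom) : mweight (fun=> c) m = c *+ mdeg m.
Proof.
rewrite mdegE -sumrMnr (reindex _ (onW_bij _ (@enum_rank_bij bin))) //=.
Qed.

Lemma msupp_poly0 (h : pring) : (forall m, m \notin msupp h) -> h = 0.
Proof.
by move=> h0; apply/mpolyP=> m; rewrite mcoeff0 memN_msupp_eq0.
Qed.

Lemma thin_ideal_face c :
  (forall b, b \in N -> c <= dotb v b /\ (b \in N' <-> dotb v b = c)) ->
  forall f : pring, thin_ideal N' f -> thin_ideal N f.
Proof.
move=> /(@mweight_cmp (fun=> c)) cmp.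
apply: (@thin_ideal_ind (I_ideal k N)) => e r f tf hf wf /=.
have [h hh] := thin_ideal_lift tf hf wf.
have [->|f0] := eqVneq f 0; first by move=> _; exact: thin_ideal0.
suff -> : h = 0 by rewrite addr0.
apply: msupp_poly0 => m; apply/negP => /hh[mN mN' me mr].
have ff := mlead_supp f0.
have ffN' : mvars (mlead f) \subset N' by have [+ _] := tf; apply.
have [_ [/(_ ffN') e1 _]] := cmp _ (fintype.subset_trans ffN' NN).
have [_ [_ h2]] := cmp _ mN; move/negP: mN'; apply; apply: h2.
by rewrite mr -(wf _ ff) e1 !mweight_C me (dhomog_mf hf ff).
Qed.

Lemma initialE w (f : pring) : initial w f =
  mfilter (fun m => all (fun m' => mweight w m <= mweight w m') (msupp f)) f.
Proof. by []. Qed.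

Lemma init_set_part w c :
  (forall b, b \in N -> dotb v b + c <= w b /\
     (b \in N' <-> w b = dotb v b + c)) ->
  forall e r (f : pring), thin_ideal N' f -> f \is e.-homog for mdeg ->
     (forall m, m \in msupp f -> wt m = r) -> init_set N w f.
Proof.
move=> /(@mweight_cmp (fun b => dotb v b + c)) cmp e r f tf hf wf.
have [f0|f0] := eqVneq f 0.
  by exists [::]; split=> //; rewrite big_nil.
have [h hh tfh] := thin_ideal_lift tf hf wf.
have fN m : m \in msupp f -> mvars m \subset N' by have [+ _] := tf; apply.
have wf' m : m \in msupp f -> mweight w m = r + c *+ e.
  move=> mf; have mN' := fN m mf.
  have [_ [/(_ mN') -> _]] := cmp _ (fintype.subset_trans mN' NN).
  by rewrite mweight_addC wf // (dhomog_mf hf mf).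
have wh m : m \in msupp h -> r + c *+ e < mweight w m.
  move=> /hh[mN mN' me mr]; have [] := cmp _ mN.
  rewrite mweight_addC mr -[mdeg m]/(mdeg m) me => le iff.
  rewrite lt_neqAle le andbT; apply: contraNneq mN' => eq.
  by apply/iff.
exists [:: (1, f + h)]; split.
  by move=> p; rewrite inE => /eqP -> /=; split=> //; rewrite -mpolyC1; exact: B_ringC.
rewrite big_seq1 mul1r /= initialE; apply/mpolyP => m; rewrite mcoeff_filter.
have hf0 m' : m' \in msupp f -> h@_m' = 0.
  move=> m'f; apply: memN_msupp_eq0; apply/negP => /wh.
  by rewrite wf' // ltxx.
have inF m' : m' \in msupp f -> m' \in msupp (f + h).
  by move=> m'f; rewrite mcoeff_msupp mcoeffD hf0 // addr0 -mcoeff_msupp.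
case: ifPn => [/allP al|].
  rewrite mcoeffD [h@_m]memN_msupp_eq0 ?addr0 //; apply/negP => /wh.
  have := al _ (inF _ (mlead_supp f0)); rewrite (wf' _ (mlead_supp f0)).
  by move=> le /lt_le_trans/(_ le); rewrite ltxx.
move=> nal; apply: memN_msupp_eq0; apply: contra nal => mf.
apply/allP => m' /msuppD_le; rewrite mem_cat (wf' m mf) => /orP[/wf' -> //|/wh].
exact: ltW.
Qed.
End Degenerate.

Section InitIdeal.
Variables (N : {set bin}) (w : bin -> R).

Lemma B_ring_initial (f : pring) : B_ring N f -> B_ring N (initial w f).
Proof. by move=> Bf m; rewrite initialE msupp_filter => /andP[_ /Bf]. Qed.

Lemma init_set_sub (f : pring) : init_set N w f -> B_ring N f.
Proof.
move=> [s [hs ->]]; rewrite big_seq; elim/big_ind: _ => [||p /hs[h1 [h2 _]]].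
- exact: B_ring0.
- exact: B_ringD.
- by apply: B_ringM => //; exact: B_ring_initial.
Qed.
Lemma init_set0 : init_set N w (0 : pring).
Proof. by exists [::]; split=> //; rewrite big_nil. Qed.
Lemma init_set_add (f g : pring) :
  init_set N w f -> init_set N w g -> init_set N w (f + g).
Proof.
move=> [s [hs ->]] [t [ht ->]]; exists (s ++ t); split; last by rewrite big_cat.
by move=> p; rewrite mem_cat => /orP[/hs|/ht].
Qed.
Lemma init_set_mul (a f : pring) :
  B_ring N a -> init_set N w f -> init_set N w (a * f).
Proof.
move=> Ba [s [hs ->]]; exists [seq (a * p.1, p.2) | p <- s]; split.
  by move=> _ /mapP[p /hs[h1 h2] ->]; split=> //; exact: B_ringM.
by rewrite big_map mulr_sumr; apply: eq_bigr => p _; rewrite mulrA.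
Qed.

Definition init_ideal : B_ideal k N :=
  @BIdeal k d n N (init_set N w) init_set_sub init_set0 init_set_add init_set_mul.
End InitIdeal.
End Initial.
Section Cells.
Variables (R : realType) (k : fieldType) (d n : nat).
Local Notation bin := (bin d n).

Definition Gr (N : {set bin}) : aff_scheme k := torus_proj (I_ideal k N).

(* The values of w outside N are not used: the polynomials of thin_ideal N
   only involve the p_l with l in N. *)
Definition init_Gr (N : {set bin}) (w : bin -> R) : aff_scheme k :=
  torus_proj (init_ideal k N w).

Definition in_TGr (N : {set bin}) (w : bin -> R) : Prop :=
  aff_nonempty (init_Gr N w).

Section FaceMap.
Variables (N N' : {set bin}).
Hypothesis NN : is_face (@matroid_polytope R d n N') (@matroid_polytope R d n N).

Lemma face_sub : N' \subset N.
Proof. by have [] := face_sep NN. Qed.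

Lemma face_ideal f : I_ideal k N' f -> I_ideal k N f.
Proof.
have [NN' [v [c h]]] := face_sep NN.
exact: (thin_ideal_face NN' h).
Qed.

Definition phi : aff_hom (Gr N) (Gr N') := induced_hom face_sub face_ideal.
End FaceMap.

Section InitMap.
Variables (N : {set bin}) (w : bin -> R) (Q : set 'rV[R]_n).
Hypothesis cQ : is_cell N w Q.

Lemma cell_sub : cell_bases N Q \subset N.
Proof. by apply/fintype.subsetP=> b; rewrite inE => /andP[]. Qed.

Lemma cell_ideal f : I_ideal k (cell_bases N Q) f -> init_ideal k N w f.
Proof.
have [v [c h]] := cell_sep cQ.
apply: (@thin_ideal_ind R k d n N _ v (init_ideal k N w)) => e r g.
exact: (init_set_part cell_sub h).
Qed.

Definition psi_cell : aff_hom (init_Gr N w) (Gr (cell_bases N Q)) :=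
  induced_hom cell_sub cell_ideal.
End InitMap.

Section Diagram.
Variables (N : {set bin}) (w : bin -> R).

Definition cell := {Q : set 'rV[R]_n | is_cell N w Q}.

Lemma cell_face (Q Q' : cell) : is_face (sval Q') (sval Q) ->
  is_face (@matroid_polytope R d n (cell_bases N (sval Q')))
          (@matroid_polytope R d n (cell_bases N (sval Q))).
Proof. by rewrite -(cell_polytope (svalP Q)) -(cell_polytope (svalP Q')). Qed.

Definition Gr_diagram : aff_diagram k :=
  @AffDiagram k cell (fun Q => Gr (cell_bases N (sval Q)))
    (fun Q Q' => is_face (sval Q') (sval Q))
    (fun Q Q' QQ' => phi (cell_face QQ')).

Definition Gr_lim : aff_scheme k := aff_lim Gr_diagram.

Lemma psi_comm (Q Q' : dobj Gr_diagram) (a : darrow Q Q') :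
  aff_eq (aff_comp (dmap a) (psi_cell (svalP Q))) (psi_cell (svalP Q')).
Proof. exact: induced_hom_comp. Qed.

Definition psi_cone : cone Gr_diagram (init_Gr N w) := Cone psi_comm.

Definition psi : aff_hom (init_Gr N w) Gr_lim := lim_lift psi_cone.
End Diagram.
End Cells.

(* Main.v *)
From HB Require Import structures.
From mathcomp Require Import all_boot all_order all_algebra.
From mathcomp Require Import boolp classical_sets reals.
From mathcomp Require Import mpoly ring lra.
Require Import Defs.

(** Let A be the coordinate ring of the initial degeneration and L that of the
limit of the cells. The map psi is an isomorphism as soon as the ring map L ->
A is bijective ([aff_iso_bij]). Both rings are generated by the ratios p_b /
p_b' of Pluecker coordinates, so the task is to build an L-point of the
initial degeneration that specializes to the tautological ratios on every
cell: units u_b of L, indexed by the bases b, at which all the initial forms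
in_w f with f in I_M vanish.

The units. A cell Q gives a ratio p_b / p_b' in L for all bases b, b' of Q,
and this ratio depends only on b and b', because two cells that share a basis
meet in a common face ([from_cell_ratio]). These ratios come from a potential,
u_b / u_b' = p_b / p_b', since the cycles in the graph of bases are generated
by triangles and squares that lie in cells. In rank 2 this is explicit. Fix an
element a that is not a loop; a basis {i, j} with i not parallel to a is
linked to the base point through the basis {a, i}, and the independence of the
choices uses the star of a, the triangles {a, i, j} and, for elements parallel
to a, squares ([potential_cell]). The squares lie in cells because w is
tropical, which holds because otherwise the initial ideal would contain a
monomial ([tropical_TGr]).

The equations. The three-term Pluecker relations of the cells show that u
satisfies the initial form of every three-term relation ([cells_three_term]).
All the other initial forms follow without any Groebner basis, by lifting u
([tropical_point_initial_eq0]). Suppose that a 2 x n matrix over a polynomial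
ring graded by real weights has minors with leading parts u_b in weight w_b
for the bases b, and zero minors for the nonbases. Every f in I_M vanishes at
these minors, and the leading part of f at the minors is (in_w f)(u); so this
is 0 ([initial_eval_eq0]). To find the matrix, view a rank 2 configuration as
points z_i of the projective line with column scales x_i, the element a being
at infinity, so that p_ij = x_i x_j (z_j - z_i). The weight gives an
ultrametric on the indices i, and u prescribes the leading part of each
difference z_j - z_i. Taking z_i = z_k + T_i, with a new variable T_i and k
the nearest among the earlier indices, realizes all these leading parts at
once ([greedy_ex]).

The conclusion. Every element of L is a fraction f(u) / u^m ([lim_frac]). If
it maps to 0 in A, then f lies in the initial ideal up to a monomial, so that
f(u) = 0 ([psi_inj0]); and the fraction f / p^m in A is the image of f(u) /
u^m ([psi_surj]). *)

Set Implicit Arguments.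
Unset Strict Implicit.
Unset Printing Implicit Defensive.

Import Order.TTheory GRing.Theory Num.Theory.

Local Open Scope ring_scope.

(** * Evaluation and leading coefficients of polynomials *)

(** The universal property of polynomial rings for a target that may be the
zero ring: a nonzero target is repackaged as a nontrivial ring, and the zero
ring receives the constant map. *)
Lemma mpoly_eval_ex (k : fieldType) (S : comPzRingType)
    (str : {rmorphism k -> S}) (K : nat) (u : 'I_K -> S) :
  exists h : {rmorphism {mpoly k[K]} -> S},
    (forall c, h c%:MP = str c) /\ (forall i, h 'X_i = u i).
Proof.
have [S0|S1] := eqVneq (1 : S) 0.
  have E (x y : S) : x = y by rewrite -[x]mul1r -[y]mul1r S0 !mul0r.
  pose f := fun _ : {mpoly k[K]} => 0 : S.
  have fZ : zmod_morphism f by move=> x y; exact: E.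
  have fM : monoid_morphism f by split=> [|x y]; exact: E.
  pose h : {rmorphism {mpoly k[K]} -> S} := HB.pack f
    (GRing.isZmodMorphism.Build _ _ f fZ)
    (GRing.isMonoidMorphism.Build _ _ f fM).
  by exists h; split=> *; exact: E.
pose T : comNzRingType := HB.pack (S : Type)
  (GRing.PzSemiRing_isNonZero.Build S S1) (GRing.ComPzRing.on S).
pose s : {rmorphism k -> T} := str.
pose h : {rmorphism {mpoly k[K]} -> T} := mmap s (u : 'I_K -> T).
exists h; split=> [c|i]; first exact: (mmapC (u : 'I_K -> T) s c).
by rewrite -[LHS]/(mmap s (u : 'I_K -> T) 'X_i) mmapX mmap1U.
Qed.

Section Lead.
Variables (R : realType) (k : fieldType) (S : comPzRingType) (K : nat).
Variables (om : 'I_K -> R) (h : {rmorphism {mpoly k[K]} -> S}).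
Local Notation wt := (gweight om).

(** The elements of weight at least r form a filtration, and [e] is the value
under h of the class of [g] in the graded piece of weight r. The value 0 is
allowed, so that r is only a lower bound for the order of [g]; this makes the
sums in [lead_add] free of case distinctions. *)
Definition lead (g : {mpoly k[K]}) (r : R) (e : S) :=
  (forall m, m \in msupp g -> r <= wt m) /\
  h (mfilter (fun m => wt m == r) g) = e.

Lemma lead0 r : lead 0 r 0.
Proof. by split=> [m|]; rewrite ?msupp0 // !raddf0. Qed.

Lemma lead_add g1 g2 r e1 e2 :
  lead g1 r e1 -> lead g2 r e2 -> lead (g1 + g2) r (e1 + e2).
Proof.
move=> [h1 <-] [h2 <-]; split; last by rewrite !raddfD.
by move=> m /msuppD_le; rewrite mem_cat => /orP[/h1|/h2].
Qed.

Lemma lead_opp g r e : lead g r e -> lead (- g) r (- e).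
Proof.
move=> [h1 <-]; split; last by rewrite !raddfN.
by move=> m; rewrite (perm_mem (msuppN g)); exact: h1.
Qed.

Lemma lead_sum (I : Type) (s : seq I) (P : pred I) F r (e : I -> S) :
  (forall i, P i -> lead (F i) r (e i)) ->
  lead (\sum_(i <- s | P i) F i) r (\sum_(i <- s | P i) e i).
Proof.
move=> H; elim/big_rec2: _ => [|i x y Pi]; first exact: lead0.
exact: lead_add (H i Pi).
Qed.

Lemma lead_lower g r e r' : lead g r e -> r' < r -> lead g r' 0.
Proof.
move=> [h1 _] lt; split=> [m /h1|]; first exact: le_trans (ltW lt).
rewrite mfilter_none ?rmorph0 // => m /h1 le; apply/eqP => E.
by move: (lt_le_trans lt le); rewrite E ltxx.
Qed.

Lemma lead_mul g1 g2 r1 r2 e1 e2 :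
  lead g1 r1 e1 -> lead g2 r2 e2 -> lead (g1 * g2) (r1 + r2) (e1 * e2).
Proof.
move=> [h1 <-] [h2 <-]; split.
  move=> m /msuppM_le /allpairsP[[m1 m2] /= [/h1 le1 /h2 le2 ->]].
  by rewrite gweightD lerD.
pose F r := @mfilter k K (fun m => wt m == r).
pose G r := @mfilter k K (predC (fun m => wt m == r)).
rewrite -rmorphM; congr (h _).
(* the last two terms have weight greater than r1 + r2 *)
have -> : g1 * g2 =
    F r1 g1 * F r2 g2 + (F r1 g1 * G r2 g2 + G r1 g1 * g2).
  by rewrite addrA -mulrDr -mfilter_split -mulrDl -mfilter_split.
rewrite 2!raddfD /=.
have hom r (g : {mpoly k[K]}) : ghomog om r (F r g).
  by move=> m; rewrite msupp_filter => /andP[/eqP].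
rewrite [X in X + _]mfilter_all; last first.
  by move=> m /(ghomogM (hom r1 g1) (hom r2 g2)) ->.
rewrite [X in _ + (X + _)]mfilter_none ?add0r; last first.
  move=> m /msuppM_le /allpairsP[[m1 m2] /= [/hom E + ->]].
  rewrite msupp_filter /= gweightD E => /andP[ne _].
  by apply: contra ne => /eqP/addrI ->.
rewrite [X in _ + X]mfilter_none ?addr0 //.
move=> m /msuppM_le /allpairsP[[m1 m2] /= []].
rewrite msupp_filter /= => /andP[ne m1g] m2g ->; rewrite gweightD.
rewrite gt_eqF //; apply: ltr_leD; last exact: h2.
by rewrite lt_neqAle eq_sym ne h1.
Qed.

Lemma lead_C c : lead c%:MP 0 (h c%:MP).
Proof.
have hom : ghomog om 0 (c%:MP : {mpoly k[K]}).
  move=> m; rewrite msuppC; case: ifP => // _; rewrite inE => /eqP ->.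
  exact: gweight0.
split=> [m /hom -> //|]; congr (h _).
by apply: mfilter_all => m /hom ->.
Qed.

Lemma lead_X i : lead 'X_i (om i) (h 'X_i).
Proof.
have hom := @ghomogX R k K om i; split=> [m /hom -> //|]; congr (h _).
by apply: mfilter_all => m /hom ->.
Qed.

Lemma lead_prod (I : Type) (s : seq I) F (r : I -> R) (e : I -> S) :
  (forall i, lead (F i) (r i) (e i)) ->
  lead (\prod_(i <- s) F i) (\sum_(i <- s) r i) (\prod_(i <- s) e i).
Proof.
move=> H; elim: s => [|i s IH].
  by rewrite !big_nil -mpolyC1 -(rmorph1 h) -mpolyC1; exact: lead_C.
by rewrite !big_cons; exact: lead_mul.
Qed.

Lemma lead_exp g r e n : lead g r e -> lead (g ^+ n) (r *+ n) (e ^+ n).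
Proof.
move=> H; elim: n => [|n IH].
  by rewrite !expr0 mulr0n -(rmorph1 h) -mpolyC1; exact: lead_C.
by rewrite !exprS mulrS; exact: lead_mul.
Qed.

(** The filtration is separated, as a polynomial has finitely many monomials.
*)
Lemma eq0_of_lead g : (forall r, exists e, lead g r e) -> g = 0.
Proof.
move=> H; apply/eqP; rewrite -msupp_eq0; case E: (msupp g) => [//|m s].
have [e [/(_ m)]] := H (wt m + 1).
by rewrite E mem_head => /(_ isT); rewrite leNgt ltrDl ltr01.
Qed.
End Lead.

(** * Pairs and three-term relations *)

Section Pairs.
Variable n : nat.
Local Notation bin := (bin 2 n).
Implicit Types (N : {set bin}) (b : bin).

Definition fst_elt (b : bin) : 'I_n := bin_elt b ord0.
Definition snd_elt (b : bin) : 'I_n := bin_elt b ord_max.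

Lemma fst_neq_snd b : fst_elt b != snd_elt b.
Proof. by apply/negP => /eqP /enum_val_inj /(congr1 val). Qed.

Lemma bin_elts b : val b = [set fst_elt b; snd_elt b]%SET.
Proof.
apply/esym/eqP; rewrite eqEcard cards2 fst_neq_snd (eqP (valP b)) andbT.
by apply/fintype.subsetP => x /set2P[] ->; exact: enum_valP.
Qed.

(** Rank 2 bases are handled as ordered pairs of elements; [None] stands for a
pair of equal elements, so that no distinctness hypothesis is needed. *)
Definition pair_bin (i j : 'I_n) : option bin := insub [set i; j]%SET.

Lemma pair_binE i j b : pair_bin i j = Some b -> val b = [set i; j]%SET.
Proof. by rewrite /pair_bin; case: insubP => //= b' _ e [<-]. Qed.

Lemma pair_bin_neq i j b : pair_bin i j = Some b -> i != j.
Proof.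
move=> /pair_binE E; have := eqP (valP b); rewrite E cards2.
by case: (i != j).
Qed.

Lemma pair_bin_some i j : i != j -> exists b, pair_bin i j = Some b.
Proof.
move=> ij; have h : #|[set i; j]%SET| == 2%N by rewrite cards2 ij.
exists (exist (fun l : {set 'I_n} => #|l| == 2%N) _ h).
by rewrite /pair_bin insubT.
Qed.

Lemma pair_binC i j : pair_bin i j = pair_bin j i.
Proof. by rewrite /pair_bin finset.setUC. Qed.

Lemma pair_binii i : pair_bin i i = None.
Proof.
by case E : (pair_bin i i) => [b|//]; move/pair_bin_neq: E; rewrite eqxx.
Qed.

Lemma pair_binK b : pair_bin (fst_elt b) (snd_elt b) = Some b.
Proof. by rewrite /pair_bin -bin_elts; exact: valK. Qed.

Lemma pair_bin_elts i j b : pair_bin i j = Some b ->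
  (fst_elt b = i /\ snd_elt b = j) \/ (fst_elt b = j /\ snd_elt b = i).
Proof.
move=> /pair_binE; rewrite bin_elts => E; have ne := fst_neq_snd b.
have /set2P[e1|e1] : fst_elt b \in [set i; j]%SET by rewrite -E set21.
- left; split=> //; have /set2P[e2|//] : snd_elt b \in [set i; j]%SET.
    by rewrite -E set22.
  by move: ne; rewrite e1 e2 eqxx.
- right; split=> //; have /set2P[//|e2] : snd_elt b \in [set i; j]%SET.
    by rewrite -E set22.
  by move: ne; rewrite e1 e2 eqxx.
Qed.

Lemma dotb_pair (R : realType) (v : 'I_n -> R) i j b :
  pair_bin i j = Some b -> dotb v b = v i + v j.
Proof.
move=> E; rewrite /dotb (pair_binE E) big_setU1 ?big_set1 //=.
by rewrite inE; exact: pair_bin_neq E.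
Qed.

Definition pair_in (N : {set bin}) i j : bool :=
  if pair_bin i j is Some b then b \in N else false.

Lemma pair_inC N i j : pair_in N i j = pair_in N j i.
Proof. by rewrite /pair_in pair_binC. Qed.

Lemma pair_in_neq N i j : pair_in N i j -> i != j.
Proof. by rewrite /pair_in; case E: pair_bin => //;
  rewrite (pair_bin_neq E). Qed.

Lemma pair_inii N i : pair_in N i i = false.
Proof. by rewrite /pair_in pair_binii. Qed.

Lemma pair_inP N i j :
  reflect (exists2 b, pair_bin i j = Some b & b \in N) (pair_in N i j).
Proof.
rewrite /pair_in; apply: (iffP idP) => [|[b -> //]].
by case: pair_bin => // b bN; exists b.
Qed.

Definition pair_wt (R : realType) (w : bin -> R) i j : R :=
  if pair_bin i j is Some b then w b else 0.

Lemma pair_wtC (R : realType) (w : bin ->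
  R) i j : pair_wt w i j = pair_wt w j i.
Proof. by rewrite /pair_wt pair_binC. Qed.

Section Signed.
Variable V : zmodType.

(** The antisymmetric function of (i, j) given by F on N and extended by 0.
With F the Pluecker coordinates this is the minor of the columns i and j, with
the usual sign, for every order of i and j. *)
Definition signed (N : {set bin}) (F : bin -> V) i j : V :=
  if pair_bin i j is Some b then
    if b \in N then if fst_elt b == i then F b else - F b else 0
  else 0.

Lemma signedC N F i j : signed N F i j = - signed N F j i.
Proof.
rewrite /signed pair_binC; case E: pair_bin => [b|]; last by rewrite oppr0.
case: ifP => _; last by rewrite oppr0.
have ne := pair_bin_neq E.
have [[-> _]|[-> _]] := pair_bin_elts E; rewrite eqxx.
  by rewrite (negPf ne).
by rewrite eq_sym (negPf ne) opprK.
Qed.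

Lemma signedN0 N F i j : ~~ pair_in N i j -> signed N F i j = 0.
Proof. by rewrite /signed /pair_in; case: pair_bin => // b /negPf ->. Qed.

Lemma signed_elts N F b : b \in N -> signed N F (fst_elt b) (snd_elt b) = F b.
Proof. by move=> bN; rewrite /signed pair_binK bN eqxx. Qed.

End Signed.

Lemma signed_mul1 (S : comPzRingType) N (F G : bin -> S) i j :
  (forall b, b \in N -> F b * G b = 1) -> pair_in N i j ->
  signed N F i j * signed N G i j = 1.
Proof.
rewrite /signed /pair_in => H; case: pair_bin => // b bN; rewrite bN.
by case: ifP => _; rewrite ?mulrNN H.
Qed.

Lemma signed_morph (U V : zmodType) (f : U -> V) N F i j :
  f 0 = 0 -> {morph f : x / - x} ->
  f (signed N F i j) = signed N (fun b => f (F b)) i j.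
Proof.
move=> f0 fN; rewrite /signed; case: pair_bin => // b.
by do 2!case: ifP => // _.
Qed.
End Pairs.

Lemma det2 (S : comNzRingType) (A : 'M[S]_2) :
  \det A = A ord0 ord0 * A ord_max ord_max - A ord0 ord_max * A ord_max ord0.
Proof.
rewrite (expand_det_row A ord0) big_ord_recl big_ord1 /cofactor !det_mx11 !mxE.
rewrite /= expr0 expr1 mul1r mulN1r mulrN.
by congr (_ * A _ _ - A _ _ * A _ _); exact/val_inj.
Qed.

Lemma mvars_pvar d n (b : bin d n) : mvars U_(enum_rank b)%MM = [set b]%SET.
Proof.
apply/setP => l; rewrite !inE mnm1E eqb0 negbK.
by rewrite (inj_eq enum_rank_inj) eq_sym.
Qed.

Section Plucker2.
Variables (k : fieldType) (n : nat).
Local Notation bin := (bin 2 n).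
Local Notation pring := (pring k 2 n).
Implicit Types (N : {set bin}) (b : bin).
Local Notation P N := (signed N (@pvar k 2 n)).

(** The Pluecker relation of i, j, l, m with the coordinates outside N set to
0. *)
Definition three_term (N : {set bin}) (i j l m : 'I_n) : pring :=
  P N i j * P N l m
  - P N i l * P N j m
  + P N i m * P N j l.

Lemma minor2 (b : bin) : minor k b =
  'X_(mxvec_index ord0 (fst_elt b)) * 'X_(mxvec_index ord_max (snd_elt b))
  - 'X_(mxvec_index ord0 (snd_elt b)) * 'X_(mxvec_index ord_max (fst_elt b)).
Proof.
by rewrite /minor det2 !mxE /fst_elt /snd_elt.
Qed.

Lemma plucker_map_pvar (b : bin) : plucker_map (pvar k b) = minor k b.
Proof. by rewrite /plucker_map /pvar mmapX mmap1U enum_rankK. Qed.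

Lemma plucker_map_signed i j :
  plucker_map (P finset.setT i j) =
  'X_(mxvec_index ord0 i) * 'X_(mxvec_index ord_max j)
  - 'X_(mxvec_index ord0 j) * 'X_(mxvec_index ord_max i).
Proof.
have [->|ij] := eqVneq i j.
  by rewrite /signed pair_binii rmorph0 subrr.
have [b E] := pair_bin_some ij.
have fN x : plucker_map (- x) = - plucker_map x :> {mpoly k[2 * n]}.
  exact: rmorphN.
rewrite /signed E finset.in_setT.
have -> : plucker_map (if fst_elt b == i then pvar k b else - pvar k b) =
   if fst_elt b == i then minor k b else - minor k b.
  by case: ifP => _; rewrite ?fN plucker_map_pvar.
rewrite minor2.
have [[-> ->]|[-> ->]] := pair_bin_elts E; rewrite ?eqxx //.
by rewrite eq_sym (negPf ij) opprB.
Qed.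

Lemma signed_homog N i j :
  P N i j \is 1.-homog for mdeg.
Proof.
rewrite /signed; case: pair_bin => [b|]; rewrite ?dhomog0 //.
case: ifP => _; rewrite ?dhomog0 //.
by case: ifP => _; rewrite ?rpredN dhomogX; apply/eqP; exact: mdeg1.
Qed.

Lemma three_term_homog N i j l m : three_term N i j l m \is 2.-homog for mdeg.
Proof.
rewrite /three_term; apply: rpredD; first apply: rpredB;
 by rewrite -[2%N]/(1 + 1)%N; apply: dhomogM; exact: signed_homog.
Qed.

Lemma B_ring_signed N i j : B_ring N (P N i j).
Proof.
rewrite /signed; case: pair_bin => [b|]; last exact: B_ring0.
case: ifP => bN; last exact: B_ring0.
have H : B_ring N (pvar k b).
  by apply: B_ringX; rewrite mvars_pvar finset.sub1set.
by case: ifP => _ //; exact: B_ringN.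
Qed.

Lemma B_ring_three_term N i j l m : B_ring N (three_term N i j l m).
Proof.
have H x y z t : B_ring N
    (P N x y * P N z t).
  by apply: B_ringM; exact: B_ring_signed.
by apply: B_ringD; [apply: B_ringD => //; exact: B_ringN|].
Qed.

Lemma plucker_three_term i j l m :
  plucker_ideal (three_term finset.setT i j l m).
Proof.
move=> e; have [<-|ne] := eqVneq 2 e; last first.
  by rewrite (pihomog_ne0 ne) ?rmorph0 //; exact: three_term_homog.
rewrite pihomog_dE; last exact: three_term_homog.
rewrite /three_term !(rmorphD, rmorphN, rmorphM) /= !plucker_map_signed.
ring.
Qed.

Lemma var_idealD N (f g : pring) :
  var_ideal N f -> var_ideal N g -> var_ideal N (f + g).
Proof.
move=> /var_idealP hf /var_idealP hg; apply/var_idealP => m /msuppD_le.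
by rewrite mem_cat => /orP[/hf|/hg].
Qed.
Lemma var_idealN N (f : pring) : var_ideal N f -> var_ideal N (- f).
Proof.
move=> /var_idealP hf; apply/var_idealP => m.
by rewrite (perm_mem (msuppN f)); exact: hf.
Qed.
Lemma var_idealM N (f g : pring) : var_ideal N f -> var_ideal N (g * f).
Proof.
move=> /var_idealP hf; apply/var_idealP => m /msuppM_le.
move=> /allpairsP[[m1 m2] /= [_ /hf + ->]]; apply: contra.
by rewrite mvarsD finset.subUset => /andP[].
Qed.

Lemma var_ideal_signed N i j :
  var_ideal N (P finset.setT i j - P N i j).
Proof.
have V0 : var_ideal N (0 : pring).
  by apply/var_idealP => m; rewrite msupp0.
rewrite /signed; case: pair_bin => [b|]; rewrite ?subrr // finset.in_setT.
case: (boolP (b \in N)) => bN; first by rewrite subrr.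
have H : var_ideal N (pvar k b).
  apply/var_idealP => m; rewrite msuppX inE => /eqP ->.
  by rewrite mvars_pvar finset.sub1set.
by rewrite subr0; case: ifP => _ //; exact: var_idealN.
Qed.

(** Setting to 0 the variables outside N changes a product of two variables by
an element of the ideal that these variables generate. *)
Lemma var_ideal_signedM N i j l m :
  var_ideal N (P finset.setT i j * P finset.setT l m - P N i j * P N l m).
Proof.
set A := P finset.setT i j; set B := P finset.setT l m.
set A' := P N i j; set B' := P N l m.
have -> : A * B - A' * B' = A * (B - B') + B' * (A - A') by ring.
by apply: var_idealD; apply: var_idealM; exact: var_ideal_signed.
Qed.

Lemma thin_three_term N i j l m : thin_ideal N (three_term N i j l m).
Proof.
apply/thin_idealP; split; first exact: B_ring_three_term.
exists (three_term finset.setT i j l m),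
  (- (three_term finset.setT i j l m - three_term N i j l m)).
split; [exact: plucker_three_term| |by rewrite opprB addrC subrK].
apply: var_idealN.
have -> : three_term finset.setT i j l m - three_term N i j l m =
    (P finset.setT i j * P finset.setT l m - P N i j * P N l m)
    - (P finset.setT i l * P finset.setT j m - P N i l * P N j m)
    + (P finset.setT i m * P finset.setT j l - P N i m * P N j l).
  by rewrite /three_term; ring.
apply: var_idealD; first apply: var_idealD; try apply: var_idealN;
  exact: var_ideal_signedM.
Qed.
End Plucker2.

(** * Initial forms through a lift of the point *)

Lemma rmorph_mpolyX (k : fieldType) (S : comPzRingType) (K : nat)
    (f : {rmorphism {mpoly k[K]} -> S}) m :
  f 'X_[m] = \prod_(i < K) f 'X_i ^+ m i.
Proof.
rewrite mpolyXE_id rmorph_prod; apply: eq_bigr => i _.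
by rewrite rmorphXn.
Qed.

Lemma rmorph_mpolyE (k : fieldType) (S : comPzRingType) (K : nat)
    (f : {rmorphism {mpoly k[K]} -> S}) (g : {mpoly k[K]}) :
  f g = \sum_(m <- msupp g) f (g@_m)%:MP * f 'X_[m].
Proof.
rewrite {1}(mpolyE g) rmorph_sum; apply: eq_bigr => m _.
by rewrite -mul_mpolyC rmorphM.
Qed.

Lemma mpoly_hom_eq (k : fieldType) (S : comPzRingType) (K : nat)
    (f g : {rmorphism {mpoly k[K]} -> S}) :
  (forall c, f c%:MP = g c%:MP) -> (forall i, f 'X_i = g 'X_i) -> f =1 g.
Proof.
move=> fgC fgX p; rewrite !(rmorph_mpolyE _ p); apply: eq_bigr => m _.
rewrite fgC (rmorph_mpolyX f) (rmorph_mpolyX g); congr (_ * _).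
apply: eq_bigr => i _.
by congr (_ ^+ _); exact: fgX.
Qed.

Section InitialEval.
Variables (R : realType) (k : fieldType) (n : nat) (S : comPzRingType).
Local Notation bin := (bin 2 n).
Local Notation pring := (pring k 2 n).
Variables (K : nat) (om : 'I_K -> R) (h : {rmorphism {mpoly k[K]} -> S}).
Variable ev : {rmorphism pring -> S}.
Hypothesis hC : forall c, h c%:MP = ev c%:MP.
Variables (N : {set bin}) (w : bin -> R) (p q : 'I_n -> {mpoly k[K]}).

Definition col_minor i j := p i * q j - p j * q i.

Hypothesis minor_lead : forall b, b \in N ->
  lead om h (col_minor (fst_elt b) (snd_elt b)) (w b) (ev (pvar k b)).
Hypothesis minor_eq0 : forall b, b \notin N ->
  col_minor (fst_elt b) (snd_elt b) = 0.

Let sub_minor : {rmorphism pring -> {mpoly k[K]}} :=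
  mmap (@mpolyC K k) (fun i =>
    col_minor (fst_elt (enum_val i)) (snd_elt (enum_val i))).

Let sub_entry : {rmorphism {mpoly k[2 * n]} -> {mpoly k[K]}} :=
  mmap (@mpolyC K k) (fun i =>
    mxvec (\matrix_(r < 2, j < n) if r == ord0 then p j else q j) 0 i).

Let sub_minorC c : sub_minor c%:MP = c%:MP.
Proof. exact: mmapC. Qed.

Let sub_minorX b : sub_minor (pvar k b) = col_minor (fst_elt b) (snd_elt b).
Proof. by rewrite /sub_minor /= /pvar mmapX mmap1U enum_rankK. Qed.

(** Both sides substitute the matrix with rows p and q for the generic one,
the left-hand side after taking minors. *)
Lemma sub_minorE f : sub_minor f = sub_entry (plucker_map f).
Proof.
apply: (mpoly_hom_eq (f := sub_minor) (g := sub_entry \o @plucker_map k 2 n)).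
  move=> c; rewrite sub_minorC /=.
  by rewrite [plucker_map _]mmapC [RHS]mmapC.
move=> i; rewrite -[i]enum_valK -/(pvar k (enum_val i)) sub_minorX.
rewrite [RHS]/= plucker_map_pvar minor2.
have E r j : sub_entry 'X_(mxvec_index r j) = if r == ord0 then p j else q j.
  by rewrite /sub_entry /= mmapX mmap1U mxvecE mxE.
by rewrite rmorphB !rmorphM !E.
Qed.

Lemma sub_minor_thin f : thin_ideal N f -> sub_minor f = 0.
Proof.
move=> [_ [g [l [pg ->]]]]; rewrite rmorphD rmorph_sum big1 ?addr0; last first.
  by move=> b bN; rewrite rmorphM sub_minorX minor_eq0 // mulr0.
rewrite sub_minorE; apply: etrans (rmorph0 sub_entry); congr (sub_entry _).
rewrite (pihomog_partitionE (mf := mdeg) (leqnn (mmeasure mdeg g))).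
by rewrite raddf_sum big1 // => e _; exact: pg.
Qed.

(** Each variable p_b is replaced by a polynomial whose leading part has
weight w_b and value ev p_b, and leading parts are multiplicative. *)
Lemma sub_minor_lead m : mvars m \subset N ->
  lead om h (sub_minor 'X_[m]) (mweight w m) (ev 'X_[m]).
Proof.
move=> /fintype.subsetP mN.
rewrite (rmorph_mpolyX sub_minor) (rmorph_mpolyX ev).
rewrite /mweight (reindex _ (onW_bij _ (@enum_val_bij bin))) /=.
apply: lead_prod => i; rewrite enum_valK.
have [-> |mi] := eqVneq (m i) 0%N.
  by rewrite !expr0 mulr0n -(rmorph1 h) -mpolyC1; exact: lead_C.
apply: lead_exp; rewrite -[i]enum_valK -/(pvar k (enum_val i)) sub_minorX.
by rewrite enum_valK; apply: minor_lead; apply: mN; rewrite inE enum_valK.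
Qed.

(** Let m0 be a monomial of f of minimal weight. Substituting the minors in f
gives 0, as f lies in the thin ideal. On the other hand the part of weight
[mweight w m0] of the result comes only from the leading parts of the minors
and from the terms of f of minimal weight: its value is that of the initial
form. *)
Theorem initial_eval_eq0 f : thin_ideal N f -> ev (initial w f) = 0.
Proof.
move=> tf; have [->|f0] := eqVneq f 0.
  by rewrite /initial msupp0 big_nil rmorph0.
have [m0 m0f m0min] : exists2 m0, m0 \in msupp f &
    all (fun m' => mweight w m0 <= mweight w m') (msupp f).
  have : msupp f != [::] by rewrite msupp_eq0.
  elim: (msupp f) => //= m s IH _; have [->|s0] := eqVneq s [::].
    by exists m; rewrite ?mem_head //= lexx.
  have [m1 m1s /allP m1min] := IH s0.
  have [le|lt] := leP (mweight w m) (mweight w m1).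
    exists m; rewrite ?mem_head //= lexx; apply/allP => m' /m1min.
    exact: le_trans.
  exists m1; first by rewrite inE m1s orbT.
  by rewrite /= (ltW lt); apply/allP.
pose e m : S := if mweight w m == mweight w m0 then ev (f@_m *: 'X_[m]) else 0.
have H : lead om h (sub_minor f) (mweight w m0) (\sum_(m <- msupp f) e m).
  rewrite {1}(mpolyE f) rmorph_sum /= big_seq [X in lead _ _ _ _ X]big_seq.
  apply: lead_sum => m mf.
  have mN : mvars m \subset N by have [+ _] := tf; apply.
  rewrite -mul_mpolyC rmorphM sub_minorC.
  have L : lead om h ((f@_m)%:MP * sub_minor 'X_[m]) (0 + mweight w m)
      (h (f@_m)%:MP * ev 'X_[m]).
    by apply: lead_mul; [exact: lead_C|exact: sub_minor_lead].
  rewrite add0r in L; rewrite /e; case: eqP => [<-|/eqP ne].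
    by rewrite -mul_mpolyC rmorphM -hC.
  apply: lead_lower L _; rewrite lt_neqAle eq_sym ne.
  exact: (allP m0min).
move: H; rewrite sub_minor_thin // => -[_]; rewrite !raddf0 => E.
rewrite /initial rmorph_sum [RHS]E [LHS]big_mkcond; apply: eq_big_seq => m mf.
rewrite /e; congr (if _ then _ else _); apply/allP/eqP => [al|-> m' m'f].
  by apply/le_anti; rewrite al // (allP m0min).
exact: (allP m0min).
Qed.
End InitialEval.

(** * Lifting an ultrametric configuration of points *)

Section Greedy.
Variables (R : realType) (k : fieldType) (S : comPzRingType) (n : nat).
Variables (fin : pred 'I_n) (adj : rel 'I_n).
Variables (v : 'I_n -> 'I_n -> R) (c : 'I_n -> 'I_n -> S).

(** Points z_i whose differences z_j - z_i have order v i j; indices that are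
not [adj] stand for equal points, of difference of infinite order. So [near r]
says that the difference has order at least r. *)
Definition near (r : R) i j := adj i j ==> (r <= v i j).
(** The coefficient in weight r of a difference z_j - z_i of order at least r
and leading coefficient c i j. *)
Definition gap_part (r : R) i j : S :=
  if adj i j && (v i j == r) then c i j else 0.

Hypothesis adjii : forall i, ~~ adj i i.
Hypothesis adjC : forall i j, adj i j = adj j i.
Hypothesis vC : forall i j, v i j = v j i.
Hypothesis cC : forall i j, c i j = - c j i.
Hypothesis near_trans : forall r i j l, fin i -> fin j -> fin l ->
  near r i j -> near r j l -> near r i l.
Hypothesis gap_part_add : forall r i j l, fin i -> fin j -> fin l ->
  near r i j -> near r j l -> near r i l ->
  gap_part r i j + gap_part r j l = gap_part r i l.

Lemma nearC r i j : near r i j = near r j i.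
Proof. by rewrite /near adjC vC. Qed.

Lemma gap_partC r i j : gap_part r i j = - gap_part r j i.
Proof. by rewrite /gap_part adjC vC cC; case: ifP; rewrite ?oppr0. Qed.

(** An index among the smaller ones that is nearest to i, possibly at infinite
order. *)
Lemma nearest_ex : exists nb : 'I_n -> 'I_n, forall i : 'I_n,
  (exists2 j : 'I_n, (j < i)%N & fin j) ->
  [/\ fin (nb i), (nb i < i)%N & forall j : 'I_n, (j < i)%N -> fin j ->
      forall r, near r j i -> near r (nb i) i].
Proof.
pose P (i j0 : 'I_n) := (exists2 j : 'I_n, (j < i)%N & fin j) ->
  [/\ fin j0, (j0 < i)%N & forall j : 'I_n, (j < i)%N -> fin j ->
      forall r, near r j i -> near r j0 i].
suff /boolp.choice[nb nbP] : forall i, exists j, P i j by exists nb.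
move=> i; rewrite /P {P}.
have [[j0 lt0 f0]|no] := pselect (exists2 j : 'I_n, (j < i)%N & fin j);
  last first.
  by exists i => h.
have [/existsP[j /and3P[jlt fj nadj]]|none] :=
    boolP [exists j : 'I_n, [&& (j < i)%N, fin j & ~~ adj j i]].
  by exists j => _; split=> // j' _ _ r _; rewrite /near (negPf nadj).
pose P (j : 'I_n) := (j < i)%N && fin j.
have P0 : P j0 by rewrite /P lt0.
have [j /andP[jlt fj] jmax] := arg_maxP (fun j => v j i) P0.
exists j => _; split=> // j' lt' f' r.
have adj' : adj j' i.
  by move/existsPn: none => /(_ j'); rewrite lt' f' /= negbK.
rewrite /near adj' /= => le; apply/implyP => _; apply: le_trans le _.
by apply: jmax; rewrite /P lt'.
Qed.

(** Put z_i = z_k + T_i with k = nb i, or z_i = z_k when the two points are to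
coincide. For j < i in the ball of radius r around i, the index k, being the
nearest to i, lies in this ball too. Hence so do all three indices, and z_i -
z_j = (z_k - z_j) + T_i has the sum of the two parts in weight r, which is the
required one by [gap_part_add]. *)
Lemma greedy_ex (K : nat) (om : 'I_K -> R) (h : {rmorphism {mpoly k[K]} -> S})
    (T : 'I_n -> 'I_K) (nb : 'I_n -> 'I_n) :
  (forall i : 'I_n, (exists2 j : 'I_n, (j < i)%N & fin j) ->
    [/\ fin (nb i), (nb i < i)%N & forall j : 'I_n, (j < i)%N -> fin j ->
      forall r, near r j i -> near r (nb i) i]) ->
  (forall i, om (T i) = v (nb i) i) -> (forall i, h 'X_(T i) = c (nb i) i) ->
  exists z : 'I_n -> {mpoly k[K]}, forall i j, fin i -> fin j ->
    forall r, near r i j -> lead om h (z j - z i) r (gap_part r i j).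
Proof.
move=> nbP omT hT.
pose good (m : nat) (z : 'I_n -> {mpoly k[K]}) := forall i j : 'I_n,
  (i < m)%N -> (j < m)%N -> fin i -> fin j ->
  forall r, near r i j -> lead om h (z j - z i) r (gap_part r i j).
suff [z gz] : exists z, good n z by exists z => i j; apply: gz.
have gap_ii r i : gap_part r i i = 0 by rewrite /gap_part (negPf (adjii i)).
suff H m : (m <= n)%N -> exists z, good m z by exact: H.
elim: m => [|m IH] le.
  by exists (fun=> 0).
have [z gz] := IH (ltnW le).
pose i0 : 'I_n := Ordinal le.
pose tau i : {mpoly k[K]} := if adj (nb i) i then 'X_(T i) else 0.
have lead_tau i r : near r (nb i) i ->
  lead om h (tau i) r (gap_part r (nb i) i).
  rewrite /near /tau /gap_part; case: ifP => _ /= => [le_r|_];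
    last exact: lead0.
  case: eqP => [<-|/eqP ne].
    by rewrite -omT -hT; exact: lead_X.
  have := lead_X om h (T i); rewrite omT => L; apply: lead_lower L _.
  by rewrite lt_neqAle eq_sym ne.
pose z' i := if i == i0 then z (nb i0) + tau i0 else z i.
exists z'.
have step (j : 'I_n) : (j < m)%N -> fin j -> fin i0 -> forall r, near r j i0 ->
    lead om h (z' i0 - z' j) r (gap_part r j i0).
  move=> jm fj f0 r nr.
  have [|fk klt kmax] := nbP i0; first by exists j.
  have nk : near r (nb i0) i0 by apply: kmax nr.
  have njk : near r j (nb i0).
    by apply: near_trans nr _ => //; rewrite nearC.
  rewrite /z' eqxx (_ : j == i0 = false); last first.
    by apply/eqP => E; move: jm; rewrite E /= ltnn.
  rewrite -(gap_part_add fj fk f0 njk nk nr).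
  rewrite addrAC; apply: lead_add; last exact: lead_tau.
  exact: gz.
move=> i j; rewrite !ltnS (leq_eqVlt i) (leq_eqVlt j).
have eq0 (l : 'I_n) : (l == m :> nat) = (l == i0) by [].
rewrite !eq0 => /orP[/eqP->|im] /orP[/eqP->|jm] fi fj r nr.
- by rewrite subrr gap_ii; exact: lead0.
- rewrite -opprB gap_partC; apply: lead_opp; apply: step => //.
  by rewrite nearC.
- exact: step.
- have ne (l : 'I_n) : (l < m)%N -> (l == i0) = false.
    by move=> lm; apply/eqP => E; move: lm; rewrite E /= ltnn.
  by rewrite /z' !ne //; exact: gz.
Qed.
End Greedy.

(** * Vanishing of initial forms at tropical points *)

Section Tropical.
Variables (R : realType) (n : nat) (N : {set bin 2 n}) (w : bin 2 n -> R).
Local Notation inN := (pair_in N).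
Local Notation W := (pair_wt w).

(** The minimum of the weights of the three terms of a Pluecker relation is
attained twice: a term that is present is accompanied by another one, of at
most the same weight. In this form the condition holds trivially when indices
are repeated. *)
Definition tropical := forall i j l m, inN i j -> inN l m ->
  [/\ inN i l, inN j m & W i l + W j m <= W i j + W l m] \/
  [/\ inN i m, inN j l & W i m + W j l <= W i j + W l m].

(** The parallelism relation of a rank 2 matroid, recovered from the tropical
relations: two elements parallel to a are parallel to each other. *)
Lemma tropical_star a c i j : tropical -> inN a c -> inN i j ->
  inN a i || inN a j.
Proof.
by move=> trop ac ij; have [[-> _ _ //]|[-> _ _]] := trop _ _ _ _ ac ij;
  rewrite orbT.
Qed.

(** The term (i j)(l m) of a three-term relation, provided that it is present
with weight exactly t. *)
Definition min_term (S : comPzRingType) (u : bin 2 n -> S) (t : R)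
    i j l m : S :=
  if [&& inN i j, inN l m & W i j + W l m == t]
  then signed N u i j * signed N u l m else 0.

(** The initial form of each three-term relation vanishes at u. Quantifying
over a lower bound t of the weights, rather than taking their minimum, covers
all the shapes of the initial form, and is void when no term has weight t. *)
Definition initial_three_term (S : comPzRingType) (u : bin 2 n -> S) :=
  forall t i j l m, uniq [:: i; j; l; m] ->
  (inN i j -> inN l m -> t <= W i j + W l m) ->
  (inN i l -> inN j m -> t <= W i l + W j m) ->
  (inN i m -> inN j l -> t <= W i m + W j l) ->
  min_term u t i j l m - min_term u t i l j m + min_term u t i m j l = 0.
End Tropical.

Section PointLift.
Variables (R : realType) (k : fieldType) (n : nat) (S : comPzRingType).
Local Notation bin := (bin 2 n).
Local Notation pring := (pring k 2 n).
Variables (N : {set bin}) (w : bin -> R).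
Variables (ev : {rmorphism pring -> S}) (ubar : bin -> S).
Local Notation u := (fun b => ev (pvar k b)).
Hypothesis uK : forall b, b \in N -> ev (pvar k b) * ubar b = 1.
Hypothesis trop : tropical N w.
Hypothesis init3 : initial_three_term N w u.
Variables (a c0 : 'I_n).
Hypothesis ac0 : pair_in N a c0.

Local Notation inN := (pair_in N).
Local Notation W := (pair_wt w).
Local Notation s := (signed N u).
Local Notation xi := (signed N ubar).
Local Notation fin := (inN a).

Let v i j := W i j - W a i - W a j.
Let c i j := s i j * xi a i * xi a j.

Let sxi i j : inN i j -> s i j * xi i j = 1.
Proof. by move=> ij; rewrite (signed_mul1 _ ij). Qed.

Let vC i j : v i j = v j i.
Proof. by rewrite /v pair_wtC addrAC. Qed.

Let cC i j : c i j = - c j i.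
Proof. by rewrite /c signedC; ring. Qed.

(** The three-term relations of a, i, j, l, divided by the coordinates of the
pairs containing a, say that v is an ultrametric. *)
Let trop_trans r i j l : fin i -> fin j -> fin l ->
  near inN v r i j -> near inN v r j l -> near inN v r i l.
Proof.
move=> fi fj fl /implyP nij /implyP njl; apply/implyP => il.
have [[_ jl le]|[_ ji le]] := trop fj il.
  by apply: le_trans (njl jl) _; rewrite /v; lra.
rewrite pair_inC in ji.
apply: le_trans (nij ji) _; move: le; rewrite (pair_wtC _ j i) /v; lra.
Qed.

(** The relation of a, i, j, l divided by the product of the coordinates of
{a, i}, {a, j} and {a, l} is the additivity of the differences z_j - z_i. *)
Let part_add r i j l : fin i -> fin j -> fin l ->
  near inN v r i j -> near inN v r j l -> near inN v r i l ->
  gap_part inN v c r i j + gap_part inN v c r j l = gap_part inN v c r i l.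
Proof.
move=> fi fj fl nij njl nil.
have gii x : gap_part inN v c r x x = 0 by rewrite /gap_part pair_inii.
have gC x y : gap_part inN v c r x y = - gap_part inN v c r y x.
  by apply: gap_partC => *; rewrite 1?pair_inC.
have [<-|ij] := eqVneq i j; first by rewrite gii add0r.
have [<-|jl] := eqVneq j l; first by rewrite gii addr0.
have [<-|il] := eqVneq i l; first by rewrite gii gC addNr.
have ne x : fin x -> (a == x) = false.
  by move=> fx; apply/negbTE; exact: pair_in_neq fx.
(* the weight of a term of the relation whose difference has order exactly r *)
pose t := r + W a i + W a j + W a l.
have bound x y z : t = r + W a x + W a y + W a z -> near inN v r y z ->
    inN a x -> inN y z -> t <= W a x + W y z.
  by move=> -> /implyP nyz _ /nyz; rewrite /v; lra.
have term x y z : t = r + W a x + W a y + W a z -> fin x -> fin y -> fin z ->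
    min_term N w u t a x y z = gap_part inN v c r y z * (s a x * s a y * s a z).
  move=> et fx fy fz; rewrite /min_term /gap_part fx /=.
  have -> : (W a x + W y z == t) = (v y z == r).
    by rewrite et /v; apply/eqP/eqP; lra.
  case: ifP => _; last by rewrite mul0r.
  transitivity (s a x * s y z * (s a y * xi a y) * (s a z * xi a z)).
    by rewrite !sxi // !mulr1.
  by rewrite /c; ring.
have U : uniq [:: a; i; j; l].
  by rewrite /= !inE !negb_or ij il jl !ne.
have e1 : t = r + W a i + W a j + W a l by [].
have e2 : t = r + W a j + W a i + W a l by rewrite e1; lra.
have e3 : t = r + W a l + W a i + W a j by rewrite e1; lra.
have := init3 U (bound _ _ _ e1 njl) (bound _ _ _ e2 nil) (bound _ _ _ e3 nij).
rewrite !term // => E.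
apply/eqP; rewrite -subr_eq0; apply/eqP.
have -> :
  gap_part inN v c r i j + gap_part inN v c r j l - gap_part inN v c r i l
  = (gap_part inN v c r i j + gap_part inN v c r j l - gap_part inN v c r i l)
    * (s a i * xi a i) * (s a j * xi a j) * (s a l * xi a l).
  by rewrite !sxi // !mulr1.
by apply: etrans (mul0r (xi a i * xi a j * xi a l)); rewrite -E; ring.
Qed.

Let fin_one i j : inN i j -> fin i || fin j.
Proof. exact: tropical_star trop ac0. Qed.

Let polar_one i j : inN i j -> ~~ fin i -> inN i c0.
Proof.
move=> ij /negPf fi; have [[ai _ _]|[_ ci _]] := trop ac0 ij.
  by rewrite ai in fi.
by rewrite pair_inC.
Qed.

(** An element i parallel to a is at infinity, so p_ij is the scale of the
column j up to a factor that does not depend on j. This holds for the weights,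
and below for the coordinates. *)
Let polar_fin i j : inN i c0 -> ~~ fin i -> fin j ->
  inN i j /\ W i j = W i c0 - W a c0 + W a j.
Proof.
move=> ic /negPf fi fj.
have [[]|[ij _ le]] := trop ic fj; first by rewrite pair_inC fi.
split=> //; apply/le_anti/andP; split.
  by move: le; rewrite (pair_wtC _ c0 a); lra.
have [[]|[_ _ le']] := trop ij ac0; first by rewrite pair_inC fi.
by move: le'; rewrite (pair_wtC _ j a); lra.
Qed.

Let polar_val i j : inN i c0 -> ~~ fin i -> fin j ->
  s i j = s a j * (s i c0 * xi a c0).
Proof.
move=> ic fi fj; have [ij Wij] := polar_fin ic fi fj.
have [->|jc] := eqVneq j c0.
  by rewrite mulrCA sxi // mulr1.
have [->|ia] := eqVneq i a; first by rewrite sxi // mulr1.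
have U : uniq [:: a; i; j; c0].
  by rewrite /= !inE !negb_or eq_sym ia jc (pair_in_neq ij) (pair_in_neq ic)
    (pair_in_neq fj) (pair_in_neq ac0).
have := init3 (t := W a j + W i c0) U _ _ _.
rewrite /min_term (negPf fi) /= fj ic eqxx ac0 ij Wij /= (_ : _ == _);
  last first.
  by apply/eqP; lra.
move=> /(_ _ _ _) H.
have E : - (s a j * s i c0) + s a c0 * s i j = 0.
  by rewrite -[RHS]H ?sub0r // => *; lra.
have -> : s i j = s i j * (s a c0 * xi a c0) by rewrite sxi // mulr1.
apply/eqP; rewrite -subr_eq0; apply/eqP.
by apply: etrans (mul0r (xi a c0)); rewrite -E; ring.
Qed.

(** The lift. The columns of the matrix are X_i (1, z_i) for the elements i
that form a basis with a, X_i (0, -1) for those parallel to a, and 0 for the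
loops, with weights and values of the variables X_i and T_i read off from the
coordinates of the bases that contain a or c0. *)
Theorem tropical_point_initial_eq0 f : thin_ideal N f -> ev (initial w f) = 0.
Proof.
have [nb nbP] := nearest_ex fin inN v.
(* the first n variables are the scales X_i, the last n the steps T_i *)
pose K := (n + n)%N.
pose wX i : R := if fin i then W a i else W i c0 - W a c0.
pose om (x : 'I_K) : R :=
  match fintype.split x with inl i => wX i | inr i => v (nb i) i end.
pose hX i : S := if fin i then s a i else s i c0 * xi a c0.
pose hv (x : 'I_K) : S :=
  match fintype.split x with inl i => hX i | inr i => c (nb i) i end.
have [h [hC hU]] := mpoly_eval_ex (ev \o @mpolyC _ k) hv.
pose X i : {mpoly k[K]} := 'X_(lshift n i).
have leadX i : lead om h (X i) (wX i) (hX i).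
  have := lead_X om h (lshift n i); rewrite hU /om /hv.
  by rewrite (unsplitK (inl _ i)).
have omT i : om (rshift n i) = v (nb i) i.
  by rewrite /om (unsplitK (inr _ i)).
have hT i : h 'X_(rshift n i) = c (nb i) i.
  by rewrite hU /hv (unsplitK (inr _ i)).
have [z zP] : exists z : 'I_n -> {mpoly k[K]}, forall i j, fin i -> fin j ->
    forall r, near inN v r i j ->
      lead om h (z j - z i) r (gap_part inN v c r i j).
  apply: (greedy_ex _ _ _ _ trop_trans part_add nbP omT hT) => *.
  - by rewrite pair_inii.
  - exact: pair_inC.
  - exact: vC.
  - exact: cC.
pose polar i := ~~ fin i && inN i c0.
pose p i := if fin i then X i else 0.
pose q i := if fin i then X i * z i else if polar i then - X i else 0.
apply: (initial_eval_eq0 (om := om) (h := h) (p := p) (q := q) hC) => b bN.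
- set i := fst_elt b; set j := snd_elt b.
  have ij : inN i j by rewrite /pair_in pair_binK.
  have <- : s i j = ev (pvar k b) by exact: signed_elts.
  have <- : W i j = w b by rewrite /pair_wt pair_binK.
  rewrite /col_minor /p /q /polar.
  case: ifP (fin_one ij) => fi /=; case: ifP => fj //= _.
  + have -> : X i * (X j * z j) - X j * (X i * z i) =
        X i * X j * (z j - z i) by ring.
    have -> : W i j = W a i + W a j + v i j by rewrite /v; lra.
    have -> : s i j = s a i * s a j * c i j.
      transitivity (s i j * (s a i * xi a i) * (s a j * xi a j)).
        by rewrite !sxi // !mulr1.
      by rewrite /c; ring.
    have Li := leadX i; have Lj := leadX j.
    rewrite /wX /hX fi in Li; rewrite /wX /hX fj in Lj.
    apply: lead_mul; first exact: lead_mul.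
    have := zP i j fi fj (v i j); rewrite /near ij lexx => /(_ isT).
    by rewrite /gap_part ij eqxx.
  + have ji : inN j i by rewrite pair_inC.
    have nfj : ~~ fin j by rewrite fj.
    have jc := polar_one ji nfj; have [_ Wji] := polar_fin jc nfj fi.
    rewrite jc pair_wtC Wji signedC (polar_val jc nfj fi) mul0r subr0 fj /=
      mulrN.
    have Li := leadX i; have Lj := leadX j.
    rewrite /wX /hX fi in Li; rewrite /wX /hX fj in Lj.
    by apply: lead_opp; rewrite addrC; exact: lead_mul.
  + have nfi : ~~ fin i by rewrite fi.
    have ic := polar_one ij nfi; have [_ ->] := polar_fin ic nfi fj.
    rewrite ic (polar_val ic nfi fj) mul0r sub0r mulrN opprK.
    have Li := leadX i; have Lj := leadX j.
    rewrite /wX /hX fi in Li; rewrite /wX /hX fj in Lj.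
    by rewrite addrC; exact: lead_mul.
- set i := fst_elt b; set j := snd_elt b.
  have nij : inN i j = false by rewrite /pair_in pair_binK (negPf bN).
  rewrite /col_minor /p /q /polar.
  case: ifP => fi /=; case: ifP => fj /=.
  + have -> : X i * (X j * z j) - X j * (X i * z i) =
        X i * X j * (z j - z i) by ring.
    rewrite (@eq0_of_lead R k S K om h (z j - z i)) ?mulr0 // => r.
    exists (gap_part inN v c r i j); apply: zP => //.
    by rewrite /near nij.
  + case: ifP => jc; last by rewrite !mul0r mulr0 subr0.
    by have /andP[_ jc'] := jc; have [] := polar_fin jc' (negbT fj) fi;
      rewrite pair_inC nij.
  + case: ifP => ic; last by rewrite mul0r mulr0 subr0.
    by have [] := polar_fin ic (negbT fi) fj; rewrite nij.
  + by rewrite !mul0r subr0.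
Qed.
End PointLift.

(** * Cells of the regular subdivision *)

Section Hulls.
Local Open Scope classical_set_scope.
Variables (R : realType) (V : lmodType R) (I : finType).
Implicit Types (N B : {set I}) (p : I -> V).

Lemma sum_supp N B (U : lmodType R) (a : I -> R) (q : I -> U) :
  B \subset N -> (forall i, i \in N -> i \notin B -> a i = 0) ->
  \sum_(i in N) a i *: q i = \sum_(i in B) a i *: q i.
Proof.
move=> /fintype.subsetP BN z; rewrite [LHS]big_mkcond [RHS]big_mkcond /=.
apply: eq_bigr => i _; case: ifP => iN; case: ifP => iB //.
  by rewrite z ?iB // scale0r.
by move: (BN _ iB); rewrite iN.
Qed.

Lemma sum_supp1 N B (a : I -> R) :
  B \subset N -> (forall i, i \in N -> i \notin B -> a i = 0) ->
  \sum_(i in N) a i = \sum_(i in B) a i.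
Proof.
move=> BN z; have := sum_supp (fun=> 1 : R^o) BN z.
under eq_bigr do rewrite [_ *: _]mulr1.
by under [X in _ = X]eq_bigr do rewrite [_ *: _]mulr1.
Qed.

(** A point of the hull at which l is minimal puts no mass on the generators
at which l is not minimal. *)
Lemma argmin_conv_hull N B p (l : {linear V -> R^o}) (c : R) :
  B \subset N -> (exists i, i \in B) ->
  (forall i, i \in N -> c <= l (p i) /\ (i \in B <-> l (p i) = c)) ->
  argmin_set l (conv_hull N p) = conv_hull B p.
Proof.
move=> BN [i0 i0B] H; have sBN := fintype.subsetP BN.
have ge i : i \in N -> c <= l (p i) by move=> /H[].
have eqc i : i \in B -> l (p i) = c :> R by move=> iB; apply/(H _ (sBN _ iB)).2.
apply/seteqP; split=> x.
  move=> [[a [a0 a1 ex]] xmin].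
  have z i : i \in N -> i \notin B -> a i = 0.
    move=> iN niB.
    apply: (conv_hull_min (l := l) (c := c) (p := p) a0 a1 ge _ iN).
      rewrite -ex -[leRHS](eqc _ i0B); apply: xmin.
      by apply: conv_hull_pt; exact: sBN.
    by apply: contraNneq niB => e; apply/(H _ iN).2.
  exists a; split=> [i /sBN /a0 //||]; first by rewrite -(sum_supp1 BN z).
  by rewrite ex (sum_supp _ BN z).
move=> [a [a0 a1 ->]].
pose a' i := if i \in B then a i else 0.
have z i : i \in N -> i \notin B -> a' i = 0 by rewrite /a' => _ /negPf ->.
split.
  exists a'; split=> [i _||].
  - by rewrite /a'; case: ifP => // /a0.
  - by rewrite (sum_supp1 BN z) -a1; apply: eq_bigr => i; rewrite /a' => ->.
  - by rewrite (sum_supp _ BN z); apply: eq_bigr => i; rewrite /a' => ->.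
move=> y /(conv_hull_ge ge); apply: le_trans.
rewrite linear_sum /=; have -> : c = \sum_(i in B) a i * c.
  by rewrite -mulr_suml a1 mul1r.
by apply: ler_sum => i iB; rewrite linearZ /= eqc.
Qed.
End Hulls.

Section Cells2.
Local Open Scope classical_set_scope.
Variables (R : realType) (n : nat).
Local Notation bin := (bin 2 n).
Variables (N : {set bin}) (w : bin -> R).
Local Notation inN := (pair_in N).
Local Notation W := (pair_wt w).
Local Notation cell := (@cell R 2 n N w).
Definition cbases (Q : cell) : {set bin} := cell_bases N (sval Q).

Definition dot_fun (nu : 'I_n -> R) (x : 'rV[R]_n) : R^o := \sum_i nu i * x 0 i.
Lemma dot_fun_linear nu : linear (dot_fun nu).
Proof.
move=> a x y; rewrite /dot_fun scaler_sumr -big_split /=; apply: eq_bigr => i _.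
by rewrite !mxE mulrDr mulrCA.
Qed.
HB.instance Definition _ nu := GRing.isLinear.Build R 'rV[R]_n R^o _
  (dot_fun nu) (dot_fun_linear nu).

Lemma dot_fun_e nu (b : bin) : dot_fun nu (e_vec R b) = dotb nu b.
Proof.
rewrite /dot_fun /dotb [RHS]big_mkcond; apply: eq_bigr => i _.
by rewrite mxE; case: ifP; rewrite ?mulr1 ?mulr0.
Qed.

(** The height above the graph of the linear function with coefficients nu;
lower faces are the sets where such functions are minimal. *)
Definition height_fun (nu : 'I_n -> R) (x : 'rV[R]_n * R^o) : R^o :=
  x.2 - dot_fun nu x.1.
Lemma height_fun_linear nu : linear (height_fun nu).
Proof.
move=> a x y; rewrite /height_fun /= linearP.
by rewrite scalerBr opprD addrACA.
Qed.
HB.instance Definition _ nu :=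
  GRing.isLinear.Build R ('rV[R]_n * R^o)%type R^o _
  (height_fun nu) (height_fun_linear nu).

(** A linear function below w on the bases cuts out the cell where it agrees
with w. A constant term is not lost: all points e_b lie on the hyperplane with
coordinate sum 2. Conversely every cell arises in this way ([cell_fun]). *)
Lemma cell_of_fun (nu : 'I_n -> R) :
  (forall i j, inN i j -> nu i + nu j <= W i j) ->
  (exists i j, inN i j /\ nu i + nu j = W i j) ->
  exists Q : cell, forall i j,
    pair_in (cbases Q) i j = inN i j && (nu i + nu j == W i j).
Proof.
move=> le [i0 [j0 [ij0 eq0]]].
have lE b : height_fun nu (lift_vec w b) =
    W (fst_elt b) (snd_elt b) - (nu (fst_elt b) + nu (snd_elt b)) :> R.
  rewrite /height_fun /= dot_fun_e (dotb_pair _ (pair_binK b)).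
  by rewrite /pair_wt pair_binK.
pose Q := fst @` argmin_set (height_fun nu) (lifted_polytope N w).
have cQ : is_cell N w Q.
  exists (argmin_set (height_fun nu) (lifted_polytope N w)) => //.
  exists (height_fun nu) => //.
  change (0 < (1 - dot_fun nu 0 : R)).
  by rewrite [dot_fun nu 0]raddf0 subr0 ltr01.
have le' b : b \in N -> 0 <= height_fun nu (lift_vec w b) :> R.
  by move=> bN; rewrite lE subr_ge0 le // /pair_in pair_binK.
exists (exist _ Q cQ) => i j; rewrite /pair_in /cbases /=.
case E: (pair_bin i j) => [b|//].
have Eb : height_fun nu (lift_vec w b) = W i j - (nu i + nu j) :> R.
  rewrite lE; have [[-> ->] //|[-> ->]] := pair_bin_elts E.
  by rewrite pair_wtC [nu j + _]addrC.
have [b0 E0 b0N] := pair_inP _ _ _ ij0.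
have Eb0 : height_fun nu (lift_vec w b0) = 0 :> R.
  rewrite lE; have [[-> ->]|[-> ->]] := pair_bin_elts E0;
    rewrite -?eq0 ?subrr //.
  by rewrite pair_wtC -eq0 [nu j0 + _]addrC subrr.
apply/idP/andP => [/cell_vertex[bN min]|[bN /eqP e]].
  split=> //; rewrite eq_sym -subr_eq0 -Eb eq_le le' // andbT.
  by apply: le_trans (min b0 b0N) _; rewrite [leLHS]Eb0.
apply/cell_vertex; split=> // b' b'N.
by rewrite [leLHS]Eb e subrr; exact: le'.
Qed.

Lemma cell_fun (Q : cell) : exists nu : 'I_n -> R,
  (forall i j, inN i j -> nu i + nu j <= W i j) /\
  (forall i j, pair_in (cbases Q) i j = inN i j && (nu i + nu j == W i j)).
Proof.
have [v [c H]] := cell_sep (svalP Q).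
(* the constant c is shared between the two elements of a basis *)
exists (fun i => v i + c / 2); split=> i j.
  case/pair_inP => b E bN; have [+ _] := H b bN.
  by rewrite (dotb_pair _ E) /pair_wt E; lra.
rewrite /pair_in /pair_wt /cbases; case E: pair_bin => [b|//].
have [bN|bN] /= := boolP (b \in N); last first.
  by apply/negbTE; apply: contra bN; rewrite inE => /andP[].
have [_ e] := H b bN; rewrite (dotb_pair _ E) in e.
by apply/idP/eqP => [/e ->|h]; [lra|apply/e; lra].
Qed.

Lemma cbases_sub (Q : cell) b : b \in cbases Q -> b \in N.
Proof. by rewrite inE => /andP[]. Qed.

Lemma pair_in_cell (Q : cell) i j : pair_in (cbases Q) i j -> inN i j.
Proof. by have [nu [_ ->]] := cell_fun Q; case/andP. Qed.

Lemma pair_in_elts (B : {set bin}) b :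
  pair_in B (fst_elt b) (snd_elt b) = (b \in B).
Proof. by rewrite /pair_in pair_binK. Qed.

Lemma cell_neq0 (Q : cell) : N != finset.set0 -> exists b, b \in cbases Q.
Proof.
move=> /set0Pn[b0 b0N]; have [F [l l0 EF] EQ] := svalP Q.
have [b bN min] := arg_minP (fun b => l (lift_vec w b) : R) b0N.
by exists b; rewrite /cbases EQ EF; apply/cell_vertex; split.
Qed.

(** If nu and nu' cut out the two cells, then nu - nu' is nonnegative on the
larger one and vanishes exactly on the smaller one. *)
Lemma cell_face_sub (Q Q' : cell) : N != finset.set0 ->
  cbases Q' \subset cbases Q -> is_face (sval Q') (sval Q).
Proof.
move=> N0 sub; have [nu [le E]] := cell_fun Q;
  have [nu' [le' E']] := cell_fun Q'.
pose f i := nu i - nu' i; exists (dot_fun f).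
rewrite {1}(cell_polytope (svalP Q)) {1}(cell_polytope (svalP Q')).
apply/esym/(argmin_conv_hull (c := 0)) => //; first exact: cell_neq0.
move=> b bQ.
suff : 0 <= dot_fun f (e_vec R b) :> R /\
  (b \in cbases Q' <-> dot_fun f (e_vec R b) = 0 :> R) by [].
rewrite dot_fun_e (dotb_pair _ (pair_binK b)).
have := le' (fst_elt b) (snd_elt b);
  rewrite pair_in_elts => /(_ (cbases_sub bQ)).
move: (bQ); rewrite -/(cbases Q) -pair_in_elts E => /andP[bN /eqP e] le0.
rewrite /f; split; first by lra.
rewrite -(pair_in_elts (cbases Q')) E' bN /=.
by split=> [/eqP|] h; [lra|apply/eqP; lra].
Qed.

(** The average of two functions below w agrees with w where both do. *)
Lemma cell_meet (Q Q' : cell) b : b \in cbases Q -> b \in cbases Q' ->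
  exists Q'' : cell, cbases Q'' = (cbases Q :&: cbases Q')%SET.
Proof.
move=> bQ bQ'; have [nu [le E]] := cell_fun Q;
  have [nu' [le' E']] := cell_fun Q'.
have [i j ij|| Q'' E''] := @cell_of_fun (fun i => (nu i + nu' i) / 2).
- by have := le i j ij; have := le' i j ij; lra.
- exists (fst_elt b), (snd_elt b).
  move: bQ bQ'; rewrite -!pair_in_elts E E' =>
    /andP[-> /eqP h] /andP[_ /eqP h'].
  by split=> //; lra.
exists Q''; apply/setP => b'.
rewrite finset.in_setI -!pair_in_elts E E' E''.
have [bN|//] := boolP (inN (fst_elt b') (snd_elt b')); rewrite /=.
have := le _ _ bN; have := le' _ _ bN => h' h.
by apply/eqP/andP => [e|[/eqP e /eqP e']]; [split; apply/eqP; lra|lra].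
Qed.

(** It suffices to prescribe the linear function on a set F of elements, when
the cell is to use bases inside F only: very negative values on the other
elements keep it below w. *)
Lemma cell_of_fun_in (F : {set 'I_n}) (nu : 'I_n -> R) :
  (forall i j, i \in F -> j \in F -> inN i j -> nu i + nu j <= W i j) ->
  (exists i j, [/\ i \in F, j \in F, inN i j & nu i + nu j = W i j]) ->
  exists Q : cell, forall i j,
    pair_in (cbases Q) i j =
    [&& inN i j, i \in F, j \in F & nu i + nu j == W i j].
Proof.
move=> le [i0 [j0 [iF jF ij0 eq0]]].
pose A := \sum_(b : bin) `|w b|; pose B := \sum_i `|nu i|.
(* - A bounds w from below and B bounds nu from above, so - C + B < w *)
pose C := A + B + 1.
have A0 : 0 <= A by apply: sumr_ge0.
have B0 : 0 <= B by apply: sumr_ge0.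
have WA i j : - A <= W i j.
  rewrite /pair_wt; case: pair_bin => [b|]; last by rewrite oppr_le0.
  rewrite lerNl; apply: le_trans (ler_norm _) _;
    rewrite normrN /A (bigD1 b) //=.
  by rewrite lerDl sumr_ge0.
have nuB i : nu i <= B.
  apply: le_trans (ler_norm _) _; rewrite /B (bigD1 i) //=.
  by rewrite lerDl sumr_ge0.
pose nu' i := if i \in F then nu i else - C.
have nu'B i : nu' i <= B.
  by rewrite /nu'; case: ifP => _; rewrite ?nuB // /C; lra.
have lt i j : ~~ ((i \in F) && (j \in F)) -> nu' i + nu' j < W i j.
  have out x : x \notin F -> nu' x = - C by rewrite /nu' => /negPf ->.
  have := WA i j; have := nu'B i; have := nu'B j.
  by rewrite negb_and => hj hi hW /orP[] /out ->; rewrite /C; lra.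
have [i j ij||Q E] := @cell_of_fun nu'.
- have [/andP[hi hj]|/lt/ltW //] := boolP ((i \in F) && (j \in F)).
  by rewrite /nu' hi hj le.
- by exists i0, j0; rewrite /nu' iF jF.
exists Q => i j; rewrite E; congr (_ && _).
have [/andP[hi hj]|nF] := boolP ((i \in F) && (j \in F)).
  by rewrite /nu' hi hj.
rewrite (lt_eqF (lt _ _ nF)); move: nF.
by case: (i \in F); case: (j \in F).
Qed.
End Cells2.

(** * Cells containing stars, triangles and squares *)

Section SomeCells.
Variables (R : realType) (n : nat).
Local Notation bin := (bin 2 n).
Variables (N : {set bin}) (w : bin -> R).
Local Notation inN := (pair_in N).
Local Notation W := (pair_wt w).
Local Notation cell := (@cell R 2 n N w).

(** With a at infinity, J is a set of points whose differences have order at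
least r. The cell contains, besides the bases {a, j}, those bases {j, l} for
which the order is exactly r. *)
Lemma star_cell a (J : {set 'I_n}) r :
  (exists j, j \in J) -> (forall j, j \in J -> inN a j) ->
  (forall j l, j \in J -> l \in J -> inN j l -> r + W a j + W a l <= W j l) ->
  exists Q : cell, (forall j, j \in J -> pair_in (cbases Q) a j) /\
    (forall j l, j \in J -> l \in J -> inN j l -> W j l = r + W a j + W a l ->
       pair_in (cbases Q) j l).
Proof.
move=> [j0 j0J] aJ le.
have naJ j : j \in J -> (j == a) = false.
  by move=> jJ; apply: contraTF (aJ _ jJ) => /eqP ->; rewrite pair_inii.
(* so that nu a + nu j = W a j and nu j + nu l = r + W a j + W a l *)
pose nu x := if x == a then - r / 2 else W a x + r / 2.
have nua : nu a = - r / 2 by rewrite /nu eqxx.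
have nuJ j : j \in J -> nu j = W a j + r / 2.
  by move=> jJ; rewrite /nu naJ.
have [i j||Q E] := @cell_of_fun_in R n N w (a |: J)%SET nu.
- move=> /setU1P[->|iJ] /setU1P[->|jJ]; rewrite ?pair_inii // ?nua.
  + by move=> _; rewrite nuJ //; lra.
  + by move=> _; rewrite nuJ // (pair_wtC _ i a); lra.
  + by move=> ij; have := le _ _ iJ jJ ij; rewrite !nuJ //; lra.
- exists a, j0; rewrite setU11 setU1r // aJ //; split=> //.
  by rewrite nua nuJ //; lra.
exists Q; split=> [j jJ|j l jJ lJ jl e]; rewrite E.
  by rewrite aJ // setU11 setU1r //= nua nuJ //; apply/eqP; lra.
by rewrite jl !setU1r //= !nuJ // e; apply/eqP; lra.
Qed.

(** All the bases containing a lie in one cell, cut out by giving r a very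
negative value in [star_cell]. *)
Lemma full_star_cell a : (exists j, inN a j) ->
  exists Q : cell, forall j, inN a j -> pair_in (cbases Q) a j.
Proof.
move=> [j0 aj0]; pose f (x : 'I_n * 'I_n) := W a x.1 + W a x.2 - W x.1 x.2.
pose A := \sum_x `|f x|.
have fA x : f x <= A.
  apply: le_trans (ler_norm _) _; rewrite /A (bigD1 x) //=.
  by rewrite lerDl sumr_ge0.
have [||j l _ _ _|Q [H _]] := @star_cell a [set j | inN a j]%SET (- A).
- by exists j0; rewrite inE.
- by move=> j; rewrite inE.
- by have := fA (j, l); rewrite /f /=; lra.
by exists Q => j aj; apply: H; rewrite inE.
Qed.

Lemma triangle_cell a i j : inN a i -> inN a j -> inN i j ->
  exists Q : cell, [/\ pair_in (cbases Q) a i, pair_in (cbases Q) a j &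
    pair_in (cbases Q) i j].
Proof.
move=> ai aj ij.
have [||x y|Q [H1 H2]] := @star_cell a [set i; j]%SET (W i j - W a i - W a j).
- by exists i; rewrite set21.
- by move=> x /set2P[] ->.
- have Wji := pair_wtC w j i.
  by move=> /set2P[] -> /set2P[] ->; rewrite ?pair_inii // => _; rewrite ?Wji;
    lra.
exists Q; split; [apply: H1|apply: H1|apply: H2]; rewrite ?set21 ?set22 //.
lra.
Qed.

(** Four bases forming a square of the octahedron i, j, l, m lie in a cell as
soon as the two diagonals of the square have the same weight, and the third
diagonal no less. The cell contains the third diagonal exactly when its weight
is the same. *)
Lemma square_cell i j l m : uniq [:: i; j; l; m] ->
  inN i j -> inN l m -> inN i l -> inN j m ->
  W i l + W j m = W i j + W l m ->
  (inN i m -> inN j l -> W i j + W l m <= W i m + W j l) ->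
  exists Q : cell, [/\ pair_in (cbases Q) i j, pair_in (cbases Q) l m,
    pair_in (cbases Q) i l, pair_in (cbases Q) j m &
    pair_in (cbases Q) i m && pair_in (cbases Q) j l =
    [&& inN i m, inN j l & W i m + W j l == W i j + W l m]].
Proof.
move=> U ij lm il jm eq le.
move: U; rewrite /= !inE !negb_or -!andbA andbT.
move=> /and4P[nij nil nim /and3P[njl njm nlm]].
(* the values of nu are determined by the four equations up to a
   parameter s, chosen so that the cell contains {i, m} if this is a basis, and
   so that nu does not exceed w at {j, l} otherwise *)
pose s := if inN i m then (W i m - W l m + W i l) / 2
  else (W i j + W i l - W j l) / 2.
pose nu x := if x == i then s else if x == j then W i j - s
  else if x == l then W i l - s else W l m - W i l + s.
have nui : nu i = s by rewrite /nu eqxx.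
have nuj : nu j = W i j - s by rewrite /nu eq_sym (negPf nij) eqxx.
have nul : nu l = W i l - s.
  by rewrite /nu eq_sym (negPf nil) eq_sym (negPf njl) eqxx.
have num : nu m = W l m - W i l + s.
  by rewrite /nu eq_sym (negPf nim) eq_sym (negPf njm) eq_sym (negPf nlm).
have Ws x y : W y x = W x y by exact: pair_wtC.
have Is x y : inN y x = inN x y by exact: pair_inC.
have imE : inN i m -> nu i + nu m = W i m.
  by move=> im; rewrite nui num /s im; lra.
have jlle : inN j l -> nu j + nu l <= W j l.
  move=> jl; rewrite nuj nul /s; case: ifP => im; last by lra.
  by have := le im jl; lra.
have jlE : inN i m -> inN j l ->
    (nu j + nu l == W j l) = (W i m + W j l == W i j + W l m).
  by move=> im jl; rewrite nuj nul /s im; apply/eqP/eqP; lra.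
pose F := [set x in [:: i; j; l; m]]%SET.
have inF x : (x \in F) = (x \in [:: i; j; l; m]) by rewrite inE.
have [iF jF lF mF] : [/\ i \in F, j \in F, l \in F & m \in F].
  by rewrite !inF !inE !eqxx !orbT.
have eqij : nu i + nu j = W i j by rewrite nui nuj; lra.
have eqil : nu i + nu l = W i l by rewrite nui nul; lra.
have eqlm : nu l + nu m = W l m by rewrite nul num; lra.
have eqjm : nu j + nu m = W j m by rewrite nuj num; lra.
have [x y||Q E] := @cell_of_fun_in R n N w F nu.
- have sw a b : (inN a b -> nu a + nu b <= W a b) ->
    (inN b a -> nu b + nu a <= W b a).
    by rewrite (Is b a) (Ws b a) [nu b + _]addrC.
  have le1 : inN i m -> nu i + nu m <= W i m by move/imE->.
  rewrite !inF !inE.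
  by move=> /or4P[]/eqP-> /or4P[]/eqP->;
    rewrite ?pair_inii // ?eqij ?eqil ?eqlm ?eqjm //;
    apply: sw; rewrite ?eqij ?eqil ?eqlm ?eqjm.
- by exists i, j.
exists Q; rewrite !E iF jF lF mF ij lm il jm /= eqij eqil eqlm eqjm !eqxx.
split=> //.
case im: (inN i m) => //=; rewrite imE // eqxx /=.
by case jl: (inN j l) => //=; rewrite jlE.
Qed.

Section Relation.
Variables (S : comPzRingType) (u : bin -> S).
Hypothesis cell_rel : forall (Q : cell) i j l m,
  signed (cbases Q) u i j * signed (cbases Q) u l m
  - signed (cbases Q) u i l * signed (cbases Q) u j m
  + signed (cbases Q) u i m * signed (cbases Q) u j l = 0.
Hypothesis trop : tropical N w.

Let active t i j l m := [&& inN i j, inN l m & W i j + W l m == t].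

Let signed_in (Q : cell) i j : pair_in (cbases Q) i j ->
  signed (cbases Q) u i j = signed N u i j.
Proof.
move=> ij; have := pair_in_cell ij; move: ij; rewrite /pair_in /signed.
by case: pair_bin => // b -> ->.
Qed.

Let min_termE t i j l m : min_term N w u t i j l m =
  if active t i j l m then signed N u i j * signed N u l m else 0.
Proof. by []. Qed.

Let activeCr t i j l m : active t i j m l = active t i j l m.
Proof. by rewrite /active (pair_inC N m) (pair_wtC w m). Qed.

Let min_termCr t i j l m :
  min_term N w u t i j m l = - min_term N w u t i j l m.
Proof.
rewrite !min_termE activeCr (signedC _ _ m) mulrN.
by case: ifP; rewrite ?oppr0.
Qed.

(** When two terms of a three-term relation attain the minimum t, a square
cell contains exactly the bases occurring in the terms of weight t, up to one
factor of the third term, so that its relation is the initial form. *)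
Let square_rel t i j l m : uniq [:: i; j; l; m] ->
  active t i j l m -> active t i l j m ->
  (inN i m -> inN j l -> t <= W i m + W j l) ->
  min_term N w u t i j l m - min_term N w u t i l j m
    + min_term N w u t i m j l = 0.
Proof.
move=> U a1 a2 le; rewrite !min_termE a1 a2.
move: (a1) (a2) => /and3P[ij lm /eqP e1] /and3P[il jm /eqP e2].
have [|im jl|Q [qij qlm qil qjm E]] := square_cell U ij lm il jm.
- by rewrite e1 e2.
- by rewrite e1; exact: le.
have := cell_rel Q i j l m;
  rewrite !(signed_in qij, signed_in qlm, signed_in qil, signed_in qjm).
suff -> : signed (cbases Q) u i m * signed (cbases Q) u j l =
  if active t i m j l then signed N u i m * signed N u j l else 0 by [].
rewrite /active -e1 -E; case: ifP => [/andP[im jl]|];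
  first by rewrite !signed_in.
by move/negbT; rewrite negb_and => /orP[] /signedN0 ->; rewrite ?mul0r ?mulr0.
Qed.

(** Since w is tropical, either no term has weight t or two have; the three
pairs of terms are exchanged by permuting j, l and m. *)
Lemma cells_three_term : initial_three_term N w u.
Proof.
move=> t i j l m U b1 b2 b3.
have trop3 x y z v : active t x y z v ->
   (inN x z -> inN y v -> t <= W x z + W y v) ->
   (inN x v -> inN y z -> t <= W x v + W y z) ->
   active t x z y v \/ active t x v y z.
  move=> /and3P[xy zv /eqP e] h1 h2.
  have [[xz yv le]|[xv yz le]] := trop xy zv; [left|right]; rewrite /active.
    by rewrite xz yv eq_le -{1}e le h1.
  by rewrite xv yz eq_le -{1}e le h2.
have U2 : uniq [:: i; j; m; l].
  rewrite (@perm_uniq _ _ [:: i; j; l; m]) //= !perm_cons.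
  by rewrite (perm_catC [:: m] [:: l]).
have U3 : uniq [:: i; l; m; j].
  rewrite (@perm_uniq _ _ [:: i; j; l; m]) // perm_cons.
  by rewrite (perm_catC [:: l; m] [:: j]).
have C23 : active t i l j m -> active t i m j l ->
   min_term N w u t i j l m - min_term N w u t i l j m
    + min_term N w u t i m j l = 0.
  move=> a2 a3.
  have a2' : active t i l m j by rewrite activeCr.
  have a3' : active t i m l j by rewrite activeCr.
  have := square_rel U3 a2' a3' b1.
  rewrite (min_termCr t i l) (min_termCr t i m) => <-; ring.
have C13 : active t i j l m -> active t i m j l ->
   min_term N w u t i j l m - min_term N w u t i l j m
    + min_term N w u t i m j l = 0.
  move=> a1 a3; apply: oppr_inj; rewrite oppr0.
  have a1' : active t i j m l by rewrite activeCr.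
  have := square_rel U2 a1' a3 b2.
  rewrite (min_termCr t i j) => <-; ring.
have [a1|n1] := boolP (active t i j l m).
  have [a2|a3] := trop3 _ _ _ _ a1 b2 b3; first exact: square_rel.
  exact: C13.
have [a2|n2] := boolP (active t i l j m).
  have Wlj : W l j = W j l by exact: pair_wtC.
  have [|a1|a3] := trop3 _ _ _ _ a2 b1.
  - by rewrite pair_inC (pair_wtC _ l j) => *; apply: b3; rewrite 1?pair_inC.
  - by rewrite a1 in n1.
  - by apply: C23 => //; move: a3; rewrite activeCr.
have [a3|n3] := boolP (active t i m j l).
  have := trop3 _ _ _ _ a3; rewrite (pair_inC _ m l) (pair_inC _ m j)
    (pair_wtC _ m l) (pair_wtC _ m j).
  case=> // [a1|a2].
    by move: a1; rewrite activeCr (negPf n1).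
  by move: a2; rewrite activeCr (negPf n2).
by rewrite !min_termE (negPf n1) (negPf n2) (negPf n3) subrr addr0.
Qed.
End Relation.
End SomeCells.

(** * Coordinate rings of tori *)

Section Ratios.
Variables (k : fieldType) (d n : nat).
Local Notation bin := (bin d n).
Local Notation pring := (pring k d n).
Local Notation "f %:F" := (tofrac f).
Implicit Types (N B : {set bin}).

Lemma ratio_proof B b b' : b \in B -> b' \in B ->
  frac0 B (@B_ring k d n B) ((pvar k b)%:F / (pvar k b')%:F).
Proof.
move=> bB b'B; exists (pvar k b), U_(enum_rank b')%MM; split=> //.
- by apply: B_ringX; rewrite mvars_pvar finset.sub1set.
- by rewrite mdeg1 dhomogX; apply/eqP; exact: mdeg1.
- by rewrite mvars_pvar finset.sub1set.
Qed.

(** The default value 0 is taken when the ratio is not regular on the torus of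
B. *)
Definition ratio B b b' : torus_ring k B :=
  insubd (0 : torus_ring k B) ((pvar k b)%:F / (pvar k b')%:F).

Lemma val_ratio B b b' : b \in B -> b' \in B ->
  val (ratio B b b') = (pvar k b)%:F / (pvar k b')%:F.
Proof.
move=> bB b'B; rewrite /ratio insubdK //.
by apply/asboolP; exact: ratio_proof.
Qed.

Lemma pvarF_neq0 (b : bin) : (pvar k b)%:F != 0.
Proof. exact: monomF_neq0. Qed.

Lemma torus_valX B (x : torus_ring k B) e : val (x ^+ e) = val x ^+ e.
Proof. by elim: e => [//|e IH]; rewrite exprSr [RHS]exprSr -IH. Qed.

Lemma ratioM B b b' b'' : b \in B -> b' \in B -> b'' \in B ->
  ratio B b b' * ratio B b' b'' = ratio B b b''.
Proof.
move=> h h' h''; apply/val_inj; rewrite rmorphM /= !val_ratio //.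
by rewrite mulrA divfK // pvarF_neq0.
Qed.

Lemma ratio1 B b : b \in B -> ratio B b b = 1.
Proof.
move=> h; apply/val_inj; rewrite rmorph1 val_ratio //.
by rewrite divff // pvarF_neq0.
Qed.

Section Generated.
Variables (B : {set bin}) (S : comPzRingType).
Variables (ht : {rmorphism torus_ring k B -> S}) (ev : {rmorphism pring -> S}).
Variable b0 : bin.
Hypothesis b0B : b0 \in B.
Hypothesis htC : forall c, ht (torus_const B c) = ev c%:MP.
Hypothesis ht_ratio : forall b, b \in B ->
  ht (ratio B b b0) * ev (pvar k b0) = ev (pvar k b).

Let mono (m : 'X_{1..#|{: bin}|}) : torus_ring k B :=
  \prod_i ratio B (enum_val i) b0 ^+ m i.

Let mem_enum_val (m : 'X_{1..#|{: bin}|}) i :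
  mvars m \subset B -> m i != 0%N -> enum_val i \in B.
Proof. by move=> /fintype.subsetP mB mi; apply: mB; rewrite inE enum_valK. Qed.

Let val_mono m : mvars m \subset B ->
  val (mono m) = ('X_[m] : pring)%:F / (pvar k b0)%:F ^+ mdeg m.
Proof.
move=> mB; rewrite /mono rmorph_prod /=.
rewrite (mpolyXE_id k m) rmorph_prod mdegE -prodrXr -prodf_div.
apply: eq_bigr => i _.
have [->|mi] := eqVneq (m i) 0%N; first by rewrite !expr0 rmorph1 divr1.
have -> : sval (ratio B (enum_val i) b0 ^+ m i) =
    val (ratio B (enum_val i) b0) ^+ m i by exact: torus_valX.
rewrite val_ratio ?(mem_enum_val mB) // /pvar enum_valK.
by rewrite expr_div_n rmorphXn.
Qed.

Let ht_mono m : mvars m \subset B ->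
  ht (mono m) * ev (pvar k b0) ^+ mdeg m = ev 'X_[m].
Proof.
move=> mB; rewrite /mono rmorph_prod (rmorph_mpolyX ev m) mdegE -prodrXr
  -big_split.
apply: eq_bigr => i _; rewrite /= rmorphXn -exprMn_comm; last exact: mulrC.
have [->|mi] := eqVneq (m i) 0%N; first by rewrite !expr0.
by rewrite ht_ratio ?(mem_enum_val mB) // /pvar enum_valK.
Qed.

(** The ratios to p_b0 generate the torus ring up to inverting monomials, so a
ring map is known on all fractions once it is known on these ratios. *)
Lemma torus_hom_frac (x : torus_ring k B) (f : pring) m :
  B_ring B f -> f \is (mdeg m).-homog for mdeg -> mvars m \subset B ->
  val x = f%:F / ('X_[m] : pring)%:F ->
  ht x * ev 'X_[m] = ev f.
Proof.
move=> Bf hf mB ex.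
pose y := \sum_(m' <- msupp f) torus_const B f@_m' * mono m'.
have val_y : val y = f%:F / (pvar k b0)%:F ^+ mdeg m.
  rewrite /y rmorph_sum [in RHS](mpolyE f) rmorph_sum mulr_suml.
  rewrite big_seq [RHS]big_seq; apply: eq_bigr => m' m'f.
  rewrite rmorphM /= val_mono; last exact: Bf.
  by rewrite (dhomog_mf hf m'f) -mul_mpolyC rmorphM mulrA.
have ht_y : ht y * ev (pvar k b0) ^+ mdeg m = ev f.
  rewrite /y rmorph_sum mulr_suml (rmorph_mpolyE ev f) big_seq [RHS]big_seq.
  apply: eq_bigr => m' m'f; rewrite rmorphM htC -mulrA; congr (_ * _).
  by rewrite -(ht_mono (Bf _ m'f)) (dhomog_mf hf m'f).
have xy : x * mono m = y.
  apply/val_inj; rewrite rmorphM /= val_y ex val_mono //.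
  by rewrite mulrA divfK // monomF_neq0.
by rewrite -(ht_mono mB) mulrA -rmorphM xy.
Qed.
End Generated.
End Ratios.

(** * A potential on the limit *)

Section Potential.
Variables (R : realType) (k : fieldType) (n : nat).
Local Notation bin := (bin 2 n).
Variables (N : {set bin}) (w : bin -> R).
Local Notation inN := (pair_in N).
Local Notation W := (pair_wt w).
Local Notation cell := (@cell R 2 n N w).
Local Notation D := (@Gr_diagram R k 2 n N w).
Local Notation L := (lim_ring D).

Definition from_cell (Q : cell) : {rmorphism torus_ring k (cbases Q) -> L} :=
  @lim_gen k D Q \o quot_pi (torus_ideal (I_ideal k (cbases Q))).

Lemma from_cell_const (Q : cell) c :
  from_cell Q (torus_const (cbases Q) c) = lim_const D c.
Proof. exact: (@lim_gen_str k D Q c). Qed.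

Lemma from_cell_eq0 (Q : cell) x :
  torus_ideal (I_ideal k (cbases Q)) x -> from_cell Q x = 0.
Proof.
move=> /quot_pi_eq0 E; rewrite /from_cell /= E;
  exact: (rmorph0 (@lim_gen k D Q)).
Qed.

Hypothesis N0 : N != finset.set0.

Lemma from_cell_sub (Q Q' : cell) (sub : cbases Q' \subset cbases Q) x :
  from_cell Q (torus_incl sub x) = from_cell Q' x.
Proof.
have a : darrow (a := D) Q Q' by exact: (cell_face_sub N0 sub).
have := lim_proj_comm a (quot_pi (torus_ideal (I_ideal k (cbases Q'))) x).
rewrite /= quot_mapE => E; apply: etrans E.
have -> : torus_incl sub x =
  torus_incl (face_sub (cell_face a)) x by exact/val_inj.
by [].
Qed.

(** Two cells that share b and b' have the intersection as a common face, and
the limit identifies the ratio on each of them with the ratio on this face. *)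
Lemma from_cell_ratio (Q Q' : cell) b b' :
  b \in cbases Q -> b' \in cbases Q -> b \in cbases Q' -> b' \in cbases Q' ->
  from_cell Q (ratio k (cbases Q) b b') =
    from_cell Q' (ratio k (cbases Q') b b').
Proof.
move=> bQ b'Q bQ' b'Q'; have [Q2 E] := cell_meet bQ bQ'.
have bQ2 : b \in cbases Q2 by rewrite E finset.in_setI bQ.
have b'Q2 : b' \in cbases Q2 by rewrite E finset.in_setI b'Q.
have H (P : cell) : cbases Q2 \subset cbases P ->
    b \in cbases P -> b' \in cbases P ->
    from_cell P (ratio k (cbases P) b b') =
    from_cell Q2 (ratio k (cbases Q2) b b').
  move=> sub bP b'P; rewrite -(from_cell_sub sub); congr (from_cell P _).
  by apply/val_inj; rewrite [RHS]/= !val_ratio.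
by rewrite !H // E ?finset.subsetIl ?finset.subsetIr.
Qed.

Definition cocellular b b' :=
  exists Q : cell, b \in cbases Q /\ b' \in cbases Q.

(** The common value of p_b / p_b' on the cells containing b and b'; the value
1 is a default for bases that share no cell. *)
Definition lim_ratio b b' : L :=
  match pselect (cocellular b b') with
  | left h => from_cell (projT1 (cid h)) (ratio k _ b b')
  | right _ => 1
  end.

Lemma lim_ratioE (Q : cell) b b' : b \in cbases Q -> b' \in cbases Q ->
  lim_ratio b b' = from_cell Q (ratio k (cbases Q) b b').
Proof.
move=> bQ b'Q; rewrite /lim_ratio; case: pselect => [h|[]]; last by exists Q.
by case: (cid h) => Q' [h1 h2] /=; exact: from_cell_ratio.
Qed.

Lemma lim_ratioM (Q : cell) b b' b'' :
  b \in cbases Q -> b' \in cbases Q -> b'' \in cbases Q ->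
  lim_ratio b b' * lim_ratio b' b'' = lim_ratio b b''.
Proof. by move=> *; rewrite !(@lim_ratioE Q) // -rmorphM ratioM. Qed.

Lemma lim_ratio1 (Q : cell) b : b \in cbases Q -> lim_ratio b b = 1.
Proof. by move=> *; rewrite !(@lim_ratioE Q) // ratio1 // rmorph1. Qed.

Lemma pair_in_some (Q : cell) i j b : pair_bin i j = Some b ->
  pair_in (cbases Q) i j = (b \in cbases Q).
Proof. by rewrite /pair_in => ->. Qed.

Hypothesis trop : tropical N w.
Variables (a c0 : 'I_n).
Hypothesis ac0 : inN a c0.
Local Notation fin := (inN a).

Let fin_one i j : inN i j -> fin i || fin j.
Proof. exact: tropical_star trop ac0. Qed.

Let base : bin := odflt (xchoose (set0Pn _ N0)) (pair_bin a c0).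
Let beta i : bin := odflt base (pair_bin a i).

Let betaE i : fin i -> pair_bin a i = Some (beta i).
Proof. by rewrite /beta /pair_in; case: pair_bin. Qed.

Let baseE : pair_bin a c0 = Some base.
Proof. by move: ac0; rewrite /base /pair_in; case: pair_bin. Qed.

Let star : exists Qa : cell, base \in cbases Qa /\
  forall i, fin i -> beta i \in cbases Qa.
Proof.
have [|Qa H] := @full_star_cell R n N w a; first by exists c0.
exists Qa; split=> [|i fi].
  by rewrite -(pair_in_some Qa baseE); exact: H.
by rewrite -(pair_in_some Qa (betaE fi)); exact: H.
Qed.

(** An element of b that forms a basis with a. *)
Let sel (b : bin) := if fin (fst_elt b) then fst_elt b else snd_elt b.
Let x i := lim_ratio (beta i) base.
(** The product of the ratios along the path from b through {a, i} to {a, c0}.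
*)
Definition potential b : L := lim_ratio b (beta (sel b)) * x (sel b).
Definition potential_inv b : L :=
  lim_ratio base (beta (sel b)) * lim_ratio (beta (sel b)) b.

Let fin_sel b : b \in N -> fin (sel b).
Proof.
move=> bN; rewrite /sel; have : inN (fst_elt b) (snd_elt b).
  by rewrite pair_in_elts.
by move/fin_one; case: ifP.
Qed.

Let xM i j : fin i -> fin j -> lim_ratio (beta i) (beta j) * x j = x i.
Proof.
move=> fi fj; have [Qa [h H]] := star.
by rewrite /x (@lim_ratioM Qa) // H.
Qed.

Let sel_cell b i : pair_bin a i = Some (beta i) -> b \in N -> i \in val b ->
  fin i -> exists Q : cell, b \in cbases Q /\ beta i \in cbases Q.
Proof.
move=> Ei bN ib fi.
have [|Q H] := @full_star_cell R n N w i.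
  by exists a; rewrite pair_inC.
exists Q; rewrite -(pair_in_some Q Ei) pair_inC H; last by rewrite pair_inC.
split=> //; have /set2P[e|e] : i \in [set fst_elt b; snd_elt b]%SET.
    by rewrite -bin_elts.
  by rewrite -(pair_in_some Q (pair_binK b)) -e H // e pair_in_elts.
rewrite -(pair_in_some Q (pair_binK b)) pair_inC -e H // e pair_inC.
by rewrite pair_in_elts.
Qed.

Let sel_in b : sel b \in val b.
Proof. by rewrite bin_elts /sel; case: ifP => _; rewrite ?set21 ?set22. Qed.

(** If both elements of b form a basis with a, the choice between them is
immaterial: the two paths differ by the triangle {a, i}, {a, j}, {i, j}. *)
Lemma potentialE i j b : pair_bin i j = Some b -> b \in N -> fin i ->
  potential b = lim_ratio b (beta i) * x i.
Proof.
move=> E bN fi; rewrite /potential.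
have [->//|ne] := eqVneq (sel b) i.
have fs := fin_sel bN.
have es : sel b = j.
  have := sel_in b; rewrite (pair_binE E) => /set2P[e|//].
  by rewrite e eqxx in ne.
rewrite es in fs *; have ij : inN i j by rewrite /pair_in E.
have [Q [qi qj qb]] := triangle_cell w fi fs ij.
rewrite -(xM fi fs) mulrA (@lim_ratioM Q) //.
- by rewrite -(pair_in_some Q E).
- by rewrite -(pair_in_some Q (betaE fi)).
- by rewrite -(pair_in_some Q (betaE fs)).
Qed.

Lemma potentialK b : b \in N -> potential b * potential_inv b = 1.
Proof.
move=> bN; have fs := fin_sel bN; have [Qa [h H]] := star.
have [Q [q1 q2]] := sel_cell (betaE fs) bN (sel_in b) fs.
rewrite /potential /potential_inv /x.
rewrite mulrA -[X in X * _]mulrA (@lim_ratioM Qa) ?H // (@lim_ratio1 Qa) ?H //.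
by rewrite mulr1 (@lim_ratioM Q) // (@lim_ratio1 Q).
Qed.

(** If i is not parallel to a, then b, b' and {a, i} are in the star of i.
Otherwise j and l are not parallel to a, and the paths from b and b' run along
the sides of the square {i, j}, {j, a}, {a, l}, {l, i}, which lies in a cell
since {i, a} is not a basis and w is tropical. *)
Lemma potential_adj (Q : cell) i j l b b' :
  pair_bin i j = Some b -> pair_bin i l = Some b' ->
  b \in cbases Q -> b' \in cbases Q ->
  lim_ratio b b' * potential b' = potential b.
Proof.
move=> E E' bQ b'Q; have bN := cbases_sub bQ; have b'N := cbases_sub b'Q.
have [e|jl] := eqVneq j l.
  by move: E'; rewrite -e E => -[<-]; rewrite (@lim_ratio1 Q) // mul1r.
have ij : inN i j by rewrite /pair_in E.
have il : inN i l by rewrite /pair_in E'.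
have [fi|nfi] := boolP (fin i).
  rewrite (potentialE E) // (potentialE E') // mulrA.
  have [|Qi H] := @full_star_cell R n N w i; first by exists j.
  rewrite (@lim_ratioM Qi) //.
  - by rewrite -(pair_in_some Qi E) H.
  - by rewrite -(pair_in_some Qi E') H.
  by rewrite -(pair_in_some Qi (betaE fi)) pair_inC H // pair_inC.
have fj : fin j by have := fin_one ij; rewrite (negPf nfi).
have fl : fin l by have := fin_one il; rewrite (negPf nfi).
have E2 : pair_bin j i = Some b by rewrite pair_binC.
have E2' : pair_bin l i = Some b' by rewrite pair_binC.
rewrite (potentialE E2) // (potentialE E2') // -(xM fj fl) !mulrA;
  congr (_ * _).
suff [Q' [q1 q2 q3 q4]] : exists Q' : cell, [/\ b \in cbases Q',
    b' \in cbases Q', beta j \in cbases Q' & beta l \in cbases Q'].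
  by rewrite !(@lim_ratioM Q').
have [ia|ia] := eqVneq i a.
  have [Qa [_ H]] := star; exists Qa.
  have -> : b = beta j by apply: Some_inj; rewrite -E -(betaE fj) ia.
  have -> : b' = beta l by apply: Some_inj; rewrite -E' -(betaE fl) ia.
  by split; apply: H.
have U : uniq [:: i; j; l; a].
  rewrite /= !inE !negb_or ia jl (pair_in_neq ij) (pair_in_neq il).
  by rewrite (eq_sym j) (eq_sym l) (pair_in_neq fj) (pair_in_neq fl).
have la : inN l a by rewrite pair_inC.
have ja : inN j a by rewrite pair_inC.
have nia : inN i a = false by rewrite pair_inC (negPf nfi).
have eq : W i l + W j a = W i j + W l a.
  apply/le_anti/andP; split.
    have [[//]|[]] := trop ij la; last by rewrite nia.
  have [[_ _]|[]] := trop il ja; last by rewrite nia.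
  by [].
have [|Q' [q1 q2 q3 q4 _]] := square_cell U ij la il ja eq.
  by rewrite nia.
exists Q'; split.
- by rewrite -(pair_in_some Q' E).
- by rewrite -(pair_in_some Q' E').
- by rewrite -(pair_in_some Q' (betaE fj)) pair_inC.
- by rewrite -(pair_in_some Q' (betaE fl)) pair_inC.
Qed.

(** Within a cell, two disjoint bases are joined through a third one that
meets both: w minus the linear function of the cell is tropical and
nonnegative, so it vanishes on one of the other two diagonals of the
octahedron. *)
Lemma potential_cell (Q : cell) b b' : b \in cbases Q -> b' \in cbases Q ->
  lim_ratio b b' * potential b' = potential b.
Proof.
move=> bQ b'Q; have [nu [le H]] := cell_fun Q.
have step y : y \in cbases Q ->
    lim_ratio b y * potential y = potential b ->
    lim_ratio y b' * potential b' = potential y ->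
    lim_ratio b b' * potential b' = potential b.
  by move=> yQ <- <-; rewrite mulrA (@lim_ratioM Q).
have E := pair_binK b; have E' := pair_binK b'.
move: (bQ) (b'Q); rewrite -(pair_in_some Q E) -(pair_in_some Q E') !H.
move=> /andP[ij /eqP e] /andP[lm /eqP e'].
have get y z : pair_in (cbases Q) y z ->
    exists2 b'', pair_bin y z = Some b'' & b'' \in cbases Q.
  by move/pair_inP.
have [[il jm lew]|[im jl lew]] := trop ij lm.
  have /get[y Ey yQ] : pair_in (cbases Q) (fst_elt b) (fst_elt b').
    by rewrite H il /=; apply/eqP; have := le _ _ il; have := le _ _ jm; lra.
  apply: (step y yQ).
    exact: potential_adj E Ey bQ yQ.
  by rewrite pair_binC in Ey; exact: potential_adj Ey E' yQ b'Q.
have /get[y Ey yQ] : pair_in (cbases Q) (fst_elt b) (snd_elt b').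
  by rewrite H im /=; apply/eqP; have := le _ _ im; have := le _ _ jl; lra.
rewrite pair_binC in E'; apply: (step y yQ).
  exact: potential_adj E Ey bQ yQ.
by rewrite pair_binC in Ey; exact: potential_adj Ey E' yQ b'Q.
Qed.

(** Paths in the cell complex from all bases to one of them. They propagate
identities between ratios to all pairs of bases. *)
Lemma cocellular_chain : exists2 b0, b0 \in N & forall b, b \in N ->
  exists b', [/\ b' \in N, cocellular b b' & cocellular b' b0].
Proof.
exists base; first by move: ac0; rewrite /pair_in baseE.
move=> b bN; have fs := fin_sel bN; exists (beta (sel b)); split.
- by move: (fs); rewrite /pair_in (betaE fs).
- exact: sel_cell (betaE fs) bN (sel_in b) fs.
- by have [Qa [h H]] := star; exists Qa; split=> //; exact: H.
Qed.
End Potential.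

(** * Tropicality of the weight *)

Section Tropicality.
Variables (R : realType) (k : fieldType) (n : nat).
Local Notation bin := (bin 2 n).
Local Notation pring := (pring k 2 n).
Variables (N : {set bin}) (w : bin -> R).
Local Notation inN := (pair_in N).
Local Notation W := (pair_wt w).

(** A monomial is a unit on the torus, so it cannot vanish on a nonempty
scheme. *)
Lemma no_monomial_initial m : in_TGr k N w -> mvars m \subset N ->
  ~ init_set N w ('X_[m] : pring).
Proof.
move=> [P [P1 _]] mN im; apply: P1.
have e : (1 : coord (init_Gr k N w)) = 0.
  rewrite -(rmorph1 (quot_pi _)); apply/quot_pi_eq0.
  exists 'X_[m], m; split=> //; first by rewrite dhomogX.
  by rewrite divff //; exact: monomF_neq0.
by rewrite e; exact: ideal_0.
Qed.

Lemma initial_dominant c m (g : pring) : c != 0 ->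
  (forall m', m' \in msupp g -> mweight w m < mweight w m') ->
  initial w (c *: 'X_[m] + g) = c *: 'X_[m].
Proof.
move=> c0 lt; have mg : m \notin msupp g by apply/negP => /lt; rewrite ltxx.
have mf : m \in msupp (c *: 'X_[m] + g).
  rewrite mcoeff_msupp mcoeffD mcoeffZ mcoeffX eqxx mulr1.
  by rewrite (memN_msupp_eq0 mg) addr0.
rewrite initialE; apply/mpolyP => m'; rewrite mcoeff_filter.
rewrite mcoeffD mcoeffZ mcoeffX.
have [<-|ne] := eqVneq m m'.
  rewrite (memN_msupp_eq0 mg) addr0; case: ifP => // /negP[].
  apply/allP => m2; rewrite mcoeff_msupp mcoeffD mcoeffZ mcoeffX.
  have [<- //|ne2] := eqVneq m m2.
  by rewrite mulr0 add0r -mcoeff_msupp => /lt/ltW.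
rewrite mulr0 add0r; case: ifP => // /allP al; apply: memN_msupp_eq0.
by apply/negP => /lt; rewrite ltNge al.
Qed.

Lemma signed_pvarE i j : inN i j -> exists2 b, pair_bin i j = Some b &
  exists e : bool, signed N (@pvar k 2 n) i j =
    (-1) ^+ e *: 'X_[U_(enum_rank b)].
Proof.
move=> /pair_inP[b E bN]; exists b => //; rewrite /signed E bN.
case: ifP => _; [exists false|exists true]; first by rewrite expr0 scale1r.
by rewrite expr1 scaleN1r.
Qed.

Lemma mweight_pvar (b : bin) : mweight w U_(enum_rank b)%MM = w b.
Proof.
rewrite /mweight (bigD1 b) //= mnm1E eqxx mulr1n big1 ?addr0 // => l lb.
by rewrite mnm1E (inj_eq enum_rank_inj) eq_sym (negPf lb) mulr0n.
Qed.

Lemma mweightD (m m' : 'X_{1..#|{: bin}|}) :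
  mweight w (m + m')%MM = mweight w m + mweight w m'.
Proof. by rewrite -big_split; apply: eq_bigr => b _; rewrite mnmDE mulrnDr. Qed.

Lemma msupp_signedM i j l m m' :
  m' \in msupp (signed N (@pvar k 2 n) i j * signed N (@pvar k 2 n) l m) ->
  [/\ inN i j, inN l m & mweight w m' = W i j + W l m].
Proof.
have [ij|nij] := boolP (inN i j); last by rewrite signedN0 // mul0r msupp0.
have [lm|nlm] := boolP (inN l m); last by rewrite (signedN0 _ nlm) mulr0 msupp0.
have [b E [e ->]] := signed_pvarE ij; have [b' E' [e' ->]] := signed_pvarE lm.
rewrite -scalerAl -scalerAr scalerA -mpolyXD => /msuppZ_le.
rewrite msuppX inE => /eqP ->; split=> //.
by rewrite mweightD !mweight_pvar /pair_wt E E'.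
Qed.

(** If a term of a three-term relation had a weight smaller than all the other
terms, it would be the initial form of the relation. *)
Lemma tropical_TGr : in_TGr k N w -> tropical N w.
Proof.
move=> wT i j l m ij lm; apply: contrapT => no.
have [b E [e eb]] := signed_pvarE ij; have [b' E' [e' eb']] := signed_pvarE lm.
pose mm := (U_(enum_rank b) + U_(enum_rank b'))%MM.
pose g : pring := - (signed N (@pvar k 2 n) i l * signed N (@pvar k 2 n) j m)
  + signed N (@pvar k 2 n) i m * signed N (@pvar k 2 n) j l.
pose c : k := (-1) ^+ e * (-1) ^+ e'.
have c0 : c != 0 by rewrite mulf_neq0 ?signr_eq0.
have ef : three_term k N i j l m = c *: 'X_[mm] + g.
  rewrite /three_term /g addrA; congr (_ - _ + _).
  by rewrite eb eb' -scalerAl -scalerAr scalerA mpolyXD.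
have wmm : mweight w mm = W i j + W l m.
  by rewrite mweightD !mweight_pvar /pair_wt E E'.
have lt m' : m' \in msupp g -> mweight w mm < mweight w m'.
  rewrite wmm => /msuppD_le; rewrite mem_cat (perm_mem (msuppN _)).
  by case/orP => /msupp_signedM[h1 h2 ->]; rewrite ltNge;
    apply/negP => le; apply: no; [left|right].
have mN : mvars mm \subset N.
  rewrite mvarsD !mvars_pvar finset.subUset !finset.sub1set.
  by move: ij lm; rewrite /pair_in E E' => -> ->.
apply: (@no_monomial_initial mm wT mN).
exists [:: ((c^-1)%:MP, three_term k N i j l m)]; split.
  move=> p; rewrite inE => /eqP -> /=; split; first exact: B_ringC.
  exact: thin_three_term.
by rewrite big_seq1 /= ef initial_dominant // mul_mpolyC scalerA mulVf //
  scale1r.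
Qed.
End Tropicality.

(** * The isomorphism *)

(** The inverse of a bijective ring map is a ring map. *)
Lemma aff_iso_bij (k : fieldType) (X Y : aff_scheme k) (f : aff_hom X Y) :
  (forall y, f y = 0 -> y = 0) -> (forall x, exists y, f y = x) -> aff_iso f.
Proof.
move=> inj0 surj; have [g fg] := boolp.choice surj.
have inj x y : f x = f y -> x = y.
  by move=> e; apply/eqP; rewrite -subr_eq0; apply/eqP/inj0;
    rewrite rmorphB e subrr.
have gf y : g (f y) = y by exact: inj.
have gZ : zmod_morphism g by move=> x y; apply: inj; rewrite rmorphB !fg.
have gM : monoid_morphism g.
  by split=> [|x y]; apply: inj; rewrite ?rmorphM !fg ?rmorph1.
pose gr : {rmorphism coord X -> coord Y} := HB.pack g
  (GRing.isZmodMorphism.Build _ _ g gZ) (GRing.isMonoidMorphism.Build _ _ g gM).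
have gs c : gr (coord_str X c) = coord_str Y c.
  by apply: inj; rewrite [LHS]fg pullback_str.
exists (@AffHom k Y X gr gs); split=> x /=; [exact: fg|exact: gf].
Qed.

Section Isomorphism.
Variables (R : realType) (k : fieldType) (n : nat).
Local Notation bin := (bin 2 n).
Local Notation pring := (pring k 2 n).
Variables (N : {set bin}) (w : bin -> R).
Local Notation cell := (@cell R 2 n N w).
Local Notation D := (@Gr_diagram R k 2 n N w).
Local Notation L := (lim_ring D).
Local Notation "f %:F" := (tofrac f).
Local Notation ratioN := (ratio k N).
Local Notation piA := (quot_pi (torus_ideal (init_ideal k N w))).
Local Notation psiL := (pullback (psi k N w)).

Lemma psi_from_cell (Q : cell) x :
  psiL (from_cell k Q x) = piA (torus_incl (cell_sub N (sval Q)) x).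
Proof.
have := @lim_liftP _ _ _ (psi_cone k N w) Q
  (quot_pi (torus_ideal (I_ideal k (cbases Q))) x).
by move=> E; apply: etrans E _; exact: induced_homE.
Qed.

Lemma psi_const c : psiL (lim_const D c) = piA (torus_const N c).
Proof. exact: (pullback_str (psi k N w) c). Qed.

Section WithPoint.
Variable ev : {rmorphism pring -> L}.
Hypothesis evC : forall c, ev c%:MP = lim_const D c.
Hypothesis N0 : N != finset.set0.
Hypothesis ev_cell : forall (Q : cell) b b', b \in cbases Q ->
  b' \in cbases Q ->
  from_cell k Q (ratio k (cbases Q) b b') * ev (pvar k b') = ev (pvar k b).

(** On each cell the tautological point is given by the coordinates ev p_b, by
[torus_hom_frac]. *)
Lemma from_cell_frac (Q : cell) (x : torus_ring k (cbases Q)) (f : pring) m :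
  B_ring (cbases Q) f -> f \is (mdeg m).-homog for mdeg ->
  mvars m \subset cbases Q -> val x = f%:F / ('X_[m] : pring)%:F ->
  from_cell k Q x * ev 'X_[m] = ev f.
Proof.
have [b0 b0Q] := cell_neq0 Q N0.
apply: (torus_hom_frac b0Q) => [c|b bQ]; last exact: ev_cell.
by rewrite from_cell_const evC.
Qed.

(** The three-term relation holds on the thin Schubert cell of the matroid of
the cell; dividing by a monomial of degree 2 brings it to degree 0. *)
Lemma ev_three_term (Q : cell) i j l m :
  ev (three_term k (cbases Q) i j l m) = 0.
Proof.
have [b0 b0Q] := cell_neq0 Q N0.
pose m0 := (U_(enum_rank b0) + U_(enum_rank b0))%MM.
have m0Q : mvars m0 \subset cbases Q.
  by rewrite mvarsD !mvars_pvar finset.setUid finset.sub1set.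
have deg0 : mdeg m0 = 2 by rewrite mdegD !mdeg1.
have hf : three_term k (cbases Q) i j l m \is (mdeg m0).-homog for mdeg.
  by rewrite deg0; exact: three_term_homog.
pose fr := (three_term k (cbases Q) i j l m)%:F / ('X_[m0] : pring)%:F.
have frB : frac0 (cbases Q) (@B_ring k 2 n (cbases Q)) fr.
  by exists (three_term k (cbases Q) i j l m), m0; split=> //;
    exact: B_ring_three_term.
have <- := @from_cell_frac Q (torus_elt frB)
  (three_term k (cbases Q) i j l m) m0 (@B_ring_three_term _ _ _ _ _ _ _) hf
    m0Q erefl.
rewrite from_cell_eq0 ?mul0r //.
by exists (three_term k (cbases Q) i j l m), m0; split=> //;
  exact: thin_three_term.
Qed.

Hypothesis ev_unit : forall b, b \in N -> exists y, ev (pvar k b) * y = 1.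
Hypothesis ev_initial : forall f, thin_ideal N f -> ev (initial w f) = 0.
Variable b0 : bin.
Hypothesis b0N : b0 \in N.
Hypothesis chain : forall b, b \in N ->
  exists b', [/\ b' \in N, cocellular N w b b' & cocellular N w b' b0].

Lemma ev_monom_unit m : mvars m \subset N -> exists y, ev 'X_[m] * y = 1.
Proof.
move=> mN; rewrite (rmorph_mpolyX ev m).
elim/big_ind: _ => [|x y [x' ex] [y' ey]|i _]; first by exists 1; rewrite mulr1.
  by exists (x' * y'); rewrite mulrACA ex ey mulr1.
have [->|mi] := eqVneq (m i) 0%N; first by exists 1; rewrite expr0 mulr1.
have /ev_unit[y ey] : enum_val i \in N.
  by apply: (fintype.subsetP mN); rewrite inE enum_valK.
exists (y ^+ m i); rewrite -exprMn_comm; last exact: mulrC.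
by rewrite -[i]enum_valK -/(pvar k (enum_val i)) ey expr1n.
Qed.

Lemma ev_init_set f : init_set N w f -> ev f = 0.
Proof.
move=> [s [hs ->]]; rewrite rmorph_sum big_seq big1 // => p /hs[_ tp].
by rewrite rmorphM ev_initial // mulr0.
Qed.

Lemma psi_ratio b b' : cocellular N w b b' ->
  piA (ratioN b b') * psiL (ev (pvar k b')) = psiL (ev (pvar k b)).
Proof.
move=> [Q [bQ b'Q]]; rewrite -(ev_cell bQ b'Q) rmorphM psi_from_cell.
congr (piA _ * _); apply/val_inj; rewrite [RHS]/= !val_ratio //.
  exact: cbases_sub bQ.
exact: cbases_sub b'Q.
Qed.

(** The point of the initial degeneration with coordinates psi (ev p_b) is the
tautological one: the ratios agree along the cells, hence along [chain]. *)
Lemma psi_frac (x : torus_ring k N) (f : pring) m :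
  B_ring N f -> f \is (mdeg m).-homog for mdeg -> mvars m \subset N ->
  val x = f%:F / ('X_[m] : pring)%:F ->
  piA x * psiL (ev 'X_[m]) = psiL (ev f).
Proof.
apply: (torus_hom_frac (ht := piA) (ev := psiL \o ev) b0N) => [c|b bN] /=.
  by rewrite evC psi_const.
have [b' [b'N bb' b'b0]] := chain bN.
by rewrite -(psi_ratio bb') -(psi_ratio b'b0) mulrA -rmorphM ratioM.
Qed.

Lemma psi_surj z : exists y, psiL y = z.
Proof.
have [x <-] := quot_pi_surj z.
have [f [m [Bf hf mN ex]]] := torus_ringP x.
have [y ey] := ev_monom_unit mN.
exists (ev f * y); rewrite rmorphM -(psi_frac Bf hf mN ex) -mulrA -rmorphM.
by rewrite ey rmorph1 mulr1.
Qed.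

(** The fractions form a subring that contains the constants and the image of
every cell, and these generate the coordinate ring of the limit. *)
Lemma lim_frac (y : L) : exists f m, [/\ B_ring N f,
  f \is (mdeg m).-homog for mdeg, mvars m \subset N & y * ev 'X_[m] = ev f].
Proof.
elim/lpi_ind: y; elim=> [c|Q z|
  s [f [m [Bf hf mN ef]]] t [g [m' [Bg hg mN' eg]]]|
  s [f [m [Bf hf mN ef]]] t [g [m' [Bg hg mN' eg]]]].
- exists c%:MP, 0%MM; split.
  + exact: B_ringC.
  + by rewrite mdeg0 -[c%:MP]mulr1 mul_mpolyC dhomogZ ?dhomog1.
  + by rewrite mvars0 finset.sub0set.
  + by rewrite mpolyX0 rmorph1 mulr1 evC.
- have [x <-] := quot_pi_surj z.
  have [f [m [Bf hf mQ ex]]] := torus_ringP x.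
  have sub := cell_sub N (sval Q).
  exists f, m; split=> //.
  + exact: B_ring_incl sub _ Bf.
  + exact: fintype.subset_trans mQ sub.
  + exact: (@from_cell_frac Q x f m Bf hf mQ ex).
- exists ('X_[m'] * f + 'X_[m] * g), (m + m')%MM; split.
  + by apply: B_ringD; apply: B_ringM => //; exact: B_ringX.
  + rewrite mdegD; apply: rpredD; last by apply: dhomogM; rewrite ?dhomogX.
    by rewrite addnC; apply: dhomogM; rewrite ?dhomogX.
  + by rewrite mvarsD finset.subUset mN.
  + have -> : lpi (LAdd s t) = lpi s + lpi t :> L by rewrite [RHS]lim_addE.
    by rewrite mpolyXD !rmorphM rmorphD !rmorphM -ef -eg; ring.
- exists (f * g), (m + m')%MM; split.
  + exact: B_ringM.
  + by rewrite mdegD; exact: dhomogM.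
  + by rewrite mvarsD finset.subUset mN.
  + have -> : lpi (LMul s t) = lpi s * lpi t :> L by rewrite [RHS]lim_mulE.
    by rewrite mpolyXD !rmorphM -ef -eg; ring.
Qed.

(** If the fraction f / X^m vanishes on the initial degeneration, it is equal
to a fraction g / X^m' with g in the initial ideal, at which [ev] vanishes. *)
Lemma psi_inj0 y : psiL y = 0 -> y = 0.
Proof.
move=> y0; have [f [m [Bf hf mN ey]]] := lim_frac y.
have frB : frac0 N (@B_ring k 2 n N) (f%:F / ('X_[m] : pring)%:F).
  by exists f, m.
have E := psi_frac Bf hf mN (erefl (val (torus_elt frB))).
have [v ev1] := ev_monom_unit mN.
have x0 : piA (torus_elt frB) = 0.
  rewrite -[LHS]mulr1 -(rmorph1 psiL) -ev1 rmorphM mulrA E -ey.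
  by rewrite rmorphM y0 !mul0r.
have [g [m' [ig _ mN' /= e]]] : torus_ideal (init_ideal k N w) (torus_elt frB).
  exact/quot_pi_eq0.
have fg : f * 'X_[m'] = g * 'X_[m].
  apply/eqP; rewrite -tofrac_eq !rmorphM /=; apply/eqP.
  move/eqP: e; rewrite eqr_div ?monomF_neq0 // => /eqP ->.
  by [].
have f0 : ev f = 0.
  have [v' ev'] := ev_monom_unit mN'.
  rewrite -[LHS]mulr1 -ev' mulrA -rmorphM fg rmorphM ev_init_set //.
  by rewrite !mul0r.
by rewrite -[LHS]mulr1 -ev1 mulrA ey f0 mul0r.
Qed.
End WithPoint.

(** The evaluation [ev] at the potential is an L-point of the initial
degeneration. The basis b1 supplies the element a, which is not a loop, and
the element c0, which is not parallel to it. *)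
Theorem psi_iso : N != finset.set0 -> in_TGr k N w -> aff_iso (psi k N w).
Proof.
move=> N0 wT; have trop := tropical_TGr wT.
have [b1 b1N] := set0Pn _ N0.
have ac0 : pair_in N (fst_elt b1) (snd_elt b1) by rewrite pair_in_elts.
pose u := @potential R k n N w N0 (fst_elt b1) (snd_elt b1).
have [ev [evC evX]] := mpoly_eval_ex (lim_const D)
  (fun i : 'I_#|{: bin}| => u (enum_val i)).
have evu b : ev (pvar k b) = u b by rewrite /pvar evX enum_rankK.
have ev_cell (Q : cell) b b' : b \in cbases Q -> b' \in cbases Q ->
    from_cell k Q (ratio k (cbases Q) b b') * ev (pvar k b') = ev (pvar k b).
  move=> bQ b'Q; rewrite !evu -(lim_ratioE k N0 bQ b'Q).
  exact: (potential_cell k N0 trop ac0 bQ b'Q).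
have uK b : b \in N -> ev (pvar k b) *
    @potential_inv R k n N w N0 (fst_elt b1) (snd_elt b1) b = 1.
  by move=> bN; rewrite evu; exact: potentialK.
have cell_rel : initial_three_term N w (fun b => ev (pvar k b)).
  apply: cells_three_term trop => Q i j l m.
  have := ev_three_term evC N0 ev_cell Q i j l m.
  have evS x y : ev (signed (cbases Q) (@pvar k 2 n) x y) =
     signed (cbases Q) (fun b => ev (pvar k b)) x y.
    by apply: signed_morph; [exact: rmorph0|exact: rmorphN].
  by rewrite rmorphD rmorphB !rmorphM !evS.
have ev_initial f : thin_ideal N f -> ev (initial w f) = 0.
  exact: (tropical_point_initial_eq0 uK trop cell_rel ac0).
have ev_unit b : b \in N -> exists y, ev (pvar k b) * y = 1.
  by move=> /uK e; eexists; exact: e.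
have [b0 b0N chain] := cocellular_chain N0 trop ac0.
apply: aff_iso_bij.
  exact: (psi_inj0 evC N0 ev_cell ev_unit ev_initial b0N chain).
exact: (psi_surj evC ev_cell ev_unit b0N chain).
Qed.
End Isomorphism.

Theorem lemma3p8 (R : realType) (k : closedFieldType)
    (char0 : [pchar k]%R =i pred0) (n : nat) (M : matroid 2 n)
    (w : bin 2 n -> R) (wT : in_TGr k M w) :
  aff_iso (psi k M w).
Proof. exact: psi_iso (bases_neq0 M) wT. Qed.
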